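(* Let $k$ be an algebraically closed field, let $s\geq 1$, and let $\underline t=(t_1,\ldots,t_s)$, $T$, $Y$ be indeterminates. Let $F\in k[\underline t][T,Y]$ be a polynomial that is irreducible in $\overline{k(\underline t)}[T,Y]$ and monic in $Y$, with $n=\deg_Y(F)\geq 2$ and $m=\deg_T(F)\geq 1$. Assume that $k$ is of characteristic $0$ or of characteristic $p>(2n-1)m$. Let $\mathcal{B}_F\in k[\underline t]$ be the bad prime divisor of $F$. If $(t_1^\ast,\ldots,t_s^\ast)\in k^s$ satisfies $\mathcal{B}_F(t_1^\ast,\ldots,t_s^\ast)\neq 0$, then the polynomial $F(t_1^\ast,\ldots,t_s^\ast,T,Y)$ is irreducible in $k[T,Y]$.
   Context: Definition of the bad prime divisor. Let $A$ be an integrally closed domain (here $A=k[\underline t]$) with fraction field $K$, and let $F\in A[T,Y]$ be irreducible in $\overline{K}[T,Y]$, monic in $Y$, with $n=\deg_Y(F)\geq 2$, $m=\deg_T(F)\geq 1$, the characteristic of $A$ being $0$ or $p>(2n-1)m$. Let $\Delta_F=\mathrm{disc}_Y(F)\in A[T]$ be the discriminant of $F$ relative to $Y$; it is non-zero. Let $\Delta_{F,0}\in A$ be the leading coefficient of $\Delta_F$ (as a polynomial in $T$) and $\tau_1,\ldots,\tau_\rho$ the distinct roots of $\Delta_F$ in $\overline K$. The reduced discriminant is $$\Delta_F^{\mathrm{red}}=(\Delta_{F,0})^\rho\prod_{i=1}^\rho(T-\tau_i),$$ which lies in $A[T]$. Its discriminant is $$\mathrm{disc}(\Delta_F^{\mathrm{red}})=(\Delta_{F,0})^{2\rho(\rho-1)}\prod_{1\leq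 i\neq j\leq\rho}(\tau_j-\tau_i),$$ a non-zero element of $A$. The bad prime divisor of $F$ is the non-zero element $$\mathcal{B}_F=\Delta_{F,0}\cdot\mathrm{disc}(\Delta_F^{\mathrm{red}})\in A.$$ *)

(* Defs.v *)
From HB Require Import structures.
From mathcomp Require Import all_boot all_order all_algebra.
From mathcomp Require Import mpoly.
Set Implicit Arguments.
Unset Strict Implicit.
Unset Printing Implicit Defensive.
Import GRing.Theory.
Local Open Scope ring_scope.

(* [irreducible_poly] is not suitable for {poly {poly R}}: over a coefficient
   ring that is not a field, its divisibility is up to scalar factors. *)
Definition irreducible_elt (R : idomainType) (x : R) : Prop :=
  [/\ x != 0, x \isn't a GRing.unit
    & forall a b : R, x = a * b -> a \is a GRing.unit \/ b \is a GRing.unit].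

(* Bivariate polynomials in T, Y over R are elements of {poly {poly R}}: the
   outer indeterminate is Y, the inner one is T. *)
Definition degY (R : nzRingType) (F : {poly {poly R}}) : nat := (size F).-1.
Definition degT (R : nzRingType) (F : {poly {poly R}}) : nat := (sizeY F).-1.

Definition map_bipoly (R S : nzRingType) (f : R -> S) (F : {poly {poly R}}) :
  {poly {poly S}} := map_poly (map_poly f) F.

(* The discriminant relative to Y of F monic in Y. Discriminants are normalised
   without sign: the discriminant of c (X - r_1) ... (X - r_d) is c^(2d-2) times
   the product of the r_j - r_i over all i != j, which for c = 1 is the
   resultant of the polynomial and its derivative. The Sylvester matrix uses the
   actual degree of the derivative, which is harmless since F is monic. *)
Definition discY (R : comNzRingType) (F : {poly {poly R}}) : {poly R} :=
  resultant F F^`().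

Section ClosedField.
Variable L : closedFieldType.

(* the roots of P, listed with multiplicity (for P != 0) *)
Definition closed_roots (P : {poly L}) : seq L :=
  sval (closed_field_poly_normal P).

Definition distinct_roots (P : {poly L}) : seq L := undup (closed_roots P).

Definition disc (P : {poly L}) : L :=
  let r := closed_roots P in
  lead_coef P ^+ (2 * (size r).-1) *
  \prod_(i < size r) \prod_(j < size r | j != i) (r`_j - r`_i).

Definition reduced (P : {poly L}) : {poly L} :=
  let tau := distinct_roots P in
  (lead_coef P ^+ size tau) *: \prod_(x <- tau) ('X - x%:P).

End ClosedField.

Section BadPrimeDivisor.
Variables (k : closedFieldType) (s : nat) (L : closedFieldType).

(* L, with the embedding iota, is an algebraic closure of k(t_1, ..., t_s) *)
Definition is_algebraic_closure
    (iota : {rmorphism {fraction {mpoly k[s]}} -> L}) : Prop :=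
  forall x : L, algebraicOver iota x.

Variable iota : {rmorphism {fraction {mpoly k[s]}} -> L}.

Definition embed (a : {mpoly k[s]}) : L := iota (tofrac a).

(* The reduced discriminant is built from the roots in L, so that the bad prime
   divisor is specified by its image in L. As embed is injective, at most one B
   satisfies this; one exists under the standing assumptions on F since
   k[t_1, ..., t_s] is integrally closed. *)
Definition is_bad_prime_divisor (F : {poly {poly {mpoly k[s]}}})
    (B : {mpoly k[s]}) : Prop :=
  let Delta := discY F in
  embed B = embed (lead_coef Delta) * disc (reduced (map_poly embed Delta)).

End BadPrimeDivisor.

Section Explicit.
Variable L : closedFieldType.
Implicit Types P : {poly L}.

Lemma closed_rootsE P :
  P = lead_coef P *: \prod_(x <- closed_roots P) ('X - x%:P).
Proof. by rewrite /closed_roots; case: closed_field_poly_normal. Qed.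

Lemma mem_distinct_roots P x : P != 0 -> (x \in distinct_roots P) = root P x.
Proof.
move=> P0; rewrite mem_undup [in RHS](closed_rootsE P).
by rewrite rootZ ?lead_coef_eq0 // root_prod_XsubC.
Qed.

Lemma disc_reducedE P (tau := distinct_roots P) : P != 0 ->
  disc (reduced P) = lead_coef P ^+ (2 * size tau * (size tau).-1) *
    \prod_(x <- tau) \prod_(y <- tau | y != x) (y - x).
Proof.
move=> P0; have lP : lead_coef P ^+ size tau != 0.
  by rewrite expf_neq0 // lead_coef_eq0.
have lE : lead_coef (reduced P) = lead_coef P ^+ size tau.
  by rewrite lead_coefZ (monicP (monic_prod_XsubC _ _ _)) mulr1.
have pE : perm_eq (closed_roots (reduced P)) tau.
  apply: prod_XsubC_eq; apply/(scalerI lP).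
  by rewrite -{1}lE -closed_rootsE.
have uR : uniq (closed_roots (reduced P)) by rewrite (perm_uniq pE) undup_uniq.
rewrite /disc lE -exprM (perm_size pE) mulnCA mulnA; congr (_ * _).
rewrite -(perm_big _ pE) /= -(perm_size pE) (big_nth 0) big_mkord.
apply: eq_bigr => i _; rewrite -(perm_big _ pE) /= (big_nth 0) big_mkord.
by apply: eq_bigl => j; rewrite nth_uniq.
Qed.

End Explicit.

(* Main.v *)
(* Ruppert: as F is irreducible over the closure L of k(t) and the characteristic exceeds (2n-1)m,
   the solutions (Q, H) of F Q_T - Q F_T - F H_Y + H F_Y = 0 with deg_Y Q, deg_Y H < n and
   deg_T Q <= m are the multiples of (F_Y, F_T). After one normalization this linear system over
   k[t] is injective, hence has a left inverse up to a factor dlt != 0.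

   Suppose F(tstar, T, Y) = g h with g and h monic in Y of positive degree, and restrict F to a
   line t = tstar + eps u on which dlt and the leading coefficient of the discriminant do not
   vanish identically. As B(tstar) != 0, the branch points stay finite and pairwise distinct at a
   place of L above eps = 0. By tameness the Puiseux expansions at each of them, and at infinity,
   then have coefficients in the valuation ring (purity), so g and h lift locally; these local
   lifts show that an approximate factorization F = G H mod eps^j can be improved over k[eps][T],
   and bound the T-degrees modulo eps^j. Since (G_Y H, G_T H) solves the system for G H, this gives
   for every j a normalized solution mod eps^j that is nonzero mod eps; hence every eps^j divides
   dlt on the line, which is absurd. *)

Require Import Defs.
From HB Require Import structures.
From mathcomp Require Import all_boot all_order all_algebra.
From mathcomp Require Import mpoly.
From mathcomp Require Import perm generic_quotient.
From mathcomp Require Import zify ring.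
From mathcomp Require boolp classical_sets.
Set Implicit Arguments.
Unset Strict Implicit.
Unset Printing Implicit Defensive.
Import GRing.Theory.
Local Open Scope ring_scope.

(** * Formal power series *)

(** Irreducibility of F may be lost on a line, and a formal factorization over k[[eps]] is not one
    over L. The linear system is used because a left inverse up to [dlt] survives every ring
    morphism out of k[t]. The bound (2n-1)m is the T-degree of a Sylvester determinant of size 2n-1
    with entries of degree at most m: below the characteristic, two polynomials of such degree with
    zero Wronskian are proportional. The place of L must have its values in k itself, and as L is
    algebraically closed its value group is divisible, so the valuation ring V is not noetherian.
    Hence purity is proved by hand, by reducing a basis of the function algebra until its
    determinant is a unit at w = 0, and Nakayama's lemma is replaced by the choice of an entry of
    largest value among finitely many. The factors g and h are coprime only over k(T), so lifting
    them over k[T] meets a denominator, the discriminant modulo eps; the local lifts serve to show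
    that it cancels. *)

Record series (R : Type) := Series { scoef :> nat -> R }.

Lemma seriesP (R : Type) (a b : series R) : a =1 b -> a = b.
Proof. by case: a b => [a] [b] /= /boolp.funext ->. Qed.

HB.instance Definition _ (R : Type) := boolp.gen_eqMixin (series R).
HB.instance Definition _ (R : Type) := boolp.gen_choiceMixin (series R).

Section SeriesRing.
Variable R : comNzRingType.
Implicit Types (a b c : series R) (p q : {poly R}).

Definition strunc n a : {poly R} := \poly_(i < n) a i.

Definition sadd a b := Series (fun i => a i + b i).
Definition sopp a := Series (fun i => - a i).
Definition szero : series R := Series (fun=> 0).
Definition sone : series R := Series (fun i => (i == 0%N)%:R).
Definition smul a b := Series (fun i => \sum_(j < i.+1) a j * b (i - j)%N).

(** A product coefficient only sees coefficients of lower or equal index, so the ring laws of series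
    are inherited from truncations in the polynomial ring. *)
Lemma coefM_eq p p' q q' i : (forall j, (j <= i)%N -> p`_j = p'`_j) ->
  (forall j, (j <= i)%N -> q`_j = q'`_j) -> (p * q)`_i = (p' * q')`_i.
Proof.
move=> hp hq; rewrite !coefM; apply: eq_bigr => j _.
by rewrite hp ?hq ?leq_subr // -ltnS.
Qed.

Lemma coef_strunc n a i : (i < n)%N -> (strunc n a)`_i = a i.
Proof. by move=> h; rewrite coef_poly h. Qed.

Lemma smul_strunc n a b i : (i < n)%N ->
  smul a b i = (strunc n a * strunc n b)`_i.
Proof.
move=> h; rewrite coefM; apply: eq_bigr => j _.
rewrite !coef_strunc //; first by rewrite (leq_trans _ h) // ltnS leq_subr.
by rewrite (leq_trans (ltn_ord j)).
Qed.

Fact saddA : associative sadd.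
Proof. by move=> a b c; apply/seriesP => i /=; rewrite addrA. Qed.
Fact saddC : commutative sadd.
Proof. by move=> a b; apply/seriesP => i /=; rewrite addrC. Qed.
Fact sadd0 : left_id szero sadd.
Proof. by move=> a; apply/seriesP => i /=; rewrite add0r. Qed.
Fact saddN : left_inverse szero sopp sadd.
Proof. by move=> a; apply/seriesP => i /=; rewrite addNr. Qed.

HB.instance Definition _ :=
  GRing.isZmodule.Build (series R) saddA saddC sadd0 saddN.

Fact smulC : commutative smul.
Proof.
move=> a b; apply/seriesP => i.
by rewrite !(smul_strunc _ _ (ltnSn i)) mulrC.
Qed.

Fact smulA : associative smul.
Proof.
move=> a b c; apply/seriesP => i; rewrite !(smul_strunc _ _ (ltnSn i)).
transitivity ((strunc i.+1 a * (strunc i.+1 b * strunc i.+1 c))`_i).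
  by apply: coefM_eq => // j hj; rewrite coef_strunc // -smul_strunc.
by rewrite mulrA; apply: coefM_eq => // j hj; rewrite coef_strunc // -smul_strunc.
Qed.

Fact smul1 : left_id sone smul.
Proof.
move=> a; apply/seriesP => i /=; rewrite big_ord_recl /= mul1r subn0.
by rewrite big1 ?addr0 // => j _; rewrite mul0r.
Qed.

Fact smulDl : left_distributive smul sadd.
Proof.
move=> a b c; apply/seriesP => i /=; rewrite -big_split /=.
by apply: eq_bigr => j _; rewrite mulrDl.
Qed.

Fact sone_neq0 : sone != szero.
Proof.
by apply/eqP => /(congr1 (fun a : series R => a 0%N)) /= /eqP; rewrite oner_eq0.
Qed.

HB.instance Definition _ := GRing.Zmodule_isComNzRing.Build (series R)
  smulA smulC smul1 smulDl sone_neq0.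

Lemma coef_sD a b i : (a + b) i = a i + b i. Proof. by []. Qed.
Lemma coef_sN a i : (- a) i = - a i. Proof. by []. Qed.
Lemma coef_sB a b i : (a - b) i = a i - b i. Proof. by []. Qed.
Lemma coef_s0 i : (0 : series R) i = 0. Proof. by []. Qed.
Lemma coef_s1 i : (1 : series R) i = (i == 0%N)%:R. Proof. by []. Qed.
Lemma coef_sM a b i : (a * b) i = \sum_(j < i.+1) a j * b (i - j)%N.
Proof. by []. Qed.
Lemma coef_sMtr n a b i : (i < n)%N ->
  (a * b) i = (strunc n a * strunc n b)`_i.
Proof. exact: smul_strunc. Qed.

Lemma coef_s_sum (I : Type) (r : seq I) (P : pred I) (F : I -> series R) i :
  (\sum_(j <- r | P j) F j) i = \sum_(j <- r | P j) F j i.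
Proof. by elim/big_rec2: _ => // j y x _ <-. Qed.

Definition ps p := Series (fun i => p`_i).
Lemma coef_ps p i : ps p i = p`_i. Proof. by []. Qed.

Fact ps_is_zmod_morphism : zmod_morphism ps.
Proof. by move=> p q; apply/seriesP => i /=; rewrite coefB. Qed.
Fact ps_is_monoid_morphism : monoid_morphism ps.
Proof.
split; first by apply/seriesP => i; rewrite coef_ps coef1.
by move=> p q; apply/seriesP => i; rewrite coef_ps coefM.
Qed.
HB.instance Definition _ :=
  GRing.isZmodMorphism.Build {poly R} (series R) ps ps_is_zmod_morphism.
HB.instance Definition _ :=
  GRing.isMonoidMorphism.Build {poly R} (series R) ps ps_is_monoid_morphism.

Lemma ps_inj : injective ps.
Proof.
move=> p q /(congr1 (@scoef R)) e; apply/polyP => i.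
by have := congr1 (fun f => f i) e.
Qed.

Definition s0 a := a 0%N.
Fact s0_is_zmod_morphism : zmod_morphism s0. Proof. by []. Qed.
Fact s0_is_monoid_morphism : monoid_morphism s0.
Proof. by split=> // a b; rewrite /s0 coef_sM big_ord1. Qed.
HB.instance Definition _ :=
  GRing.isZmodMorphism.Build (series R) R s0 s0_is_zmod_morphism.
HB.instance Definition _ :=
  GRing.isMonoidMorphism.Build (series R) R s0 s0_is_monoid_morphism.

Definition sX k : series R := ps 'X^k.

Lemma sX0 : sX 0 = 1. Proof. by rewrite /sX expr0 rmorph1. Qed.
Lemma sXD k l : sX (k + l) = sX k * sX l.
Proof. by rewrite /sX exprD rmorphM. Qed.
Lemma sXX k l : sX k ^+ l = sX (k * l).
Proof. by rewrite /sX -rmorphXn -exprM. Qed.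

Lemma coef_sXM k a i : (sX k * a) i = if (i < k)%N then 0 else a (i - k)%N.
Proof.
rewrite (coef_sMtr _ _ (ltnSn i)).
transitivity (('X^k * strunc i.+1 a)`_i).
  by apply: coefM_eq => // j hj; rewrite coef_strunc.
rewrite coefXnM; case: ifP => // _; rewrite coef_strunc //.
by rewrite ltnS leq_subr.
Qed.

Lemma sX_inj k : injective ( *%R (sX k)).
Proof.
move=> a b e; apply/seriesP => i.
have : (sX k * a) (k + i)%N = (sX k * b) (k + i)%N by rewrite e.
by rewrite !coef_sXM ltnNge leq_addr /= addKn.
Qed.

Lemma sX_div k a : (forall i, (i < k)%N -> a i = 0) -> exists b, a = sX k * b.
Proof.
move=> h; exists (Series (fun i => a (k + i)%N)); apply/seriesP => i.
rewrite coef_sXM; case: ltnP => [/h//|hi]; by rewrite /= subnKC.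
Qed.

Lemma series_inv a r : a 0%N * r = 1 -> exists b, a * b = 1.
Proof.
move=> ar.
(* [g n] tabulates the coefficients up to index n, since each new one depends on all earlier ones;
   the diagonal [g i i] is the inverse. *)
pose g := fix g n : nat -> R := if n is m.+1 then
   fun i => if i == m.+1 then - r * \sum_(j < m.+1) a j.+1 * g m (m - j)%N
            else g m i
  else fun i => if i == 0%N then r else 0.
have gS n i : (i <= n)%N -> g n i = g i i.
  elim: n => [|n IH]; first by case: i.
  rewrite leq_eqVlt => /orP[/eqP ->//|hi].
  by rewrite /= [in LHS]ltn_eqF // IH.
exists (Series (fun i => g i i)); apply/seriesP => -[|n].
  by rewrite coef_sM big_ord1 /= ar.
rewrite coef_sM big_ord_recl /= subn0 eqxx.
rewrite mulrA mulrN ar mulN1r addrC; apply/eqP; rewrite subr_eq0.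
apply/eqP; apply: eq_bigr => j _; rewrite /bump /= add1n subSS.
by rewrite gS // leq_subr.
Qed.

End SeriesRing.

Lemma series_unit (R : comUnitRingType) (a : series R) :
  a 0%N \is a GRing.unit -> exists b, a * b = 1.
Proof.
by move=> h; apply: (@series_inv _ _ (a 0%N)^-1); rewrite mulrV.
Qed.

Section SeriesMaps.
Variables (R S : comNzRingType) (f : {rmorphism R -> S}).

Definition map_series (a : series R) : series S := Series (fun i => f (a i)).

Fact map_series_is_zmod_morphism : zmod_morphism map_series.
Proof. by move=> a b; apply/seriesP => i /=; rewrite rmorphB. Qed.
Fact map_series_is_monoid_morphism : monoid_morphism map_series.
Proof.
split; first by apply/seriesP => i /=; rewrite rmorph_nat.
move=> a b; apply/seriesP => i; rewrite [RHS]coef_sM /= rmorph_sum /=.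
by apply: eq_bigr => j _; rewrite rmorphM.
Qed.
HB.instance Definition _ := GRing.isZmodMorphism.Build (series R) (series S)
  map_series map_series_is_zmod_morphism.
HB.instance Definition _ := GRing.isMonoidMorphism.Build (series R) (series S)
  map_series map_series_is_monoid_morphism.

Lemma coef_map_series a i : map_series a i = f (a i). Proof. by []. Qed.

Lemma map_series_inj : injective f -> injective map_series.
Proof.
move=> hf a b /(congr1 (@scoef S)) e; apply/seriesP => i; apply: hf.
exact: (congr1 (fun g => g i) e).
Qed.

Lemma map_series_ps p : map_series (ps p) = ps (map_poly f p).
Proof. by apply/seriesP => i; rewrite coef_map_series !coef_ps coef_map. Qed.

Lemma map_series_sX k : map_series (sX R k) = sX S k.
Proof. by rewrite /sX map_series_ps map_polyXn. Qed.

End SeriesMaps.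

Section Subst.
Variables (R : comNzRingType) (N : nat).
Hypothesis N_gt0 : (0 < N)%N.

(** The substitution w -> w^N. The proof of 0 < N is an argument so that each [ssub h] carries a
    canonical ring morphism structure. *)
Definition ssub_of (_ : (0 < N)%N) (a : series R) : series R :=
  Series (fun i => if (N %| i)%N then a (i %/ N)%N else 0).
Local Notation ssub := (ssub_of N_gt0).

Lemma ssub_strunc n a i : (i < n)%N -> ssub a i = (strunc n a \Po 'X^N)`_i.
Proof.
move=> h; rewrite coef_comp_poly_Xn //=; case: ifP => // _.
by rewrite coef_strunc // (leq_ltn_trans (leq_div _ _)).
Qed.

Fact ssub_is_zmod_morphism : zmod_morphism ssub.
Proof.
by move=> a b; apply/seriesP => i /=; case: ifP; rewrite ?subr0.
Qed.
Fact ssub_is_monoid_morphism : monoid_morphism ssub.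
Proof.
split.
  apply/seriesP => i; rewrite coef_s1 /=; case: ifP => [/dvdnP[j ->]|].
    by rewrite mulnK // muln_eq0 (gtn_eqF N_gt0) orbF.
  by case: i => [|i] //; rewrite dvdn0.
move=> a b; apply/seriesP => i.
transitivity (((strunc i.+1 a * strunc i.+1 b) \Po 'X^N)`_i).
  rewrite coef_comp_poly_Xn //=; case: ifP => // _.
  by apply: coef_sMtr; rewrite ltnS leq_div.
rewrite comp_polyM (coef_sMtr _ _ (ltnSn i)).
by apply: coefM_eq => j hj; rewrite coef_strunc // (@ssub_strunc i.+1).
Qed.
HB.instance Definition _ := GRing.isZmodMorphism.Build (series R) (series R)
  ssub ssub_is_zmod_morphism.
HB.instance Definition _ := GRing.isMonoidMorphism.Build (series R) (series R)
  ssub ssub_is_monoid_morphism.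

Lemma coef_ssub (a : series R) i :
  ssub a i = if (N %| i)%N then a (i %/ N)%N else 0.
Proof. by []. Qed.

Lemma ssub_ps (p : {poly R}) : ssub (ps p) = ps (p \Po 'X^N).
Proof. by apply/seriesP => i; rewrite coef_ssub !coef_ps coef_comp_poly_Xn. Qed.

Lemma ssub_sX k : ssub (sX R k) = sX R (N * k).
Proof. by rewrite /sX ssub_ps comp_Xn_poly -exprM. Qed.

Lemma ssub_inj : injective ssub.
Proof.
move=> a b /(congr1 (@scoef R)) e; apply/seriesP => i.
have := congr1 (fun g => g (i * N)%N) e.
by rewrite /= dvdn_mull // mulnK.
Qed.

End Subst.
Notation ssub := ssub_of.

Lemma map_ssub (R S : comNzRingType) (f : {rmorphism R -> S}) N (h : (0 < N)%N) a :
  map_series f (ssub h a) = ssub h (map_series f a).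
Proof.
by apply/seriesP => i; rewrite /=; case: ifP => //; rewrite rmorph0.
Qed.

Lemma ssub_comp (R : comNzRingType) N M (hN : (0 < N)%N) (hM : (0 < M)%N)
  (hNM : (0 < N * M)%N) (a : series R) : ssub hM (ssub hN a) = ssub hNM a.
Proof.
apply/seriesP => i; rewrite !coef_ssub.
case: ifP => [/dvdnP[j ->]|h].
  rewrite mulnK // dvdn_pmul2r //; case: ifP => // /dvdnP[l ->].
  by rewrite mulnK // -mulnA mulnK // muln_gt0 hN hM.
by case: ifP => // /dvdnP[l e]; rewrite e mulnA dvdn_mull in h.
Qed.

Section SeriesDeriv.
Variable R : comNzRingType.
Implicit Types a b : series R.

Definition sderiv a : series R := Series (fun i => a i.+1 *+ i.+1).

Lemma sderiv_strunc n a i : (i.+1 < n)%N -> sderiv a i = (strunc n a)^`()`_i.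
Proof. by move=> h; rewrite coef_deriv coef_strunc. Qed.

Fact sderiv_is_zmod_morphism : zmod_morphism sderiv.
Proof. by move=> a b; apply/seriesP => i /=; rewrite mulrnBl. Qed.
HB.instance Definition _ := GRing.isZmodMorphism.Build (series R) (series R)
  sderiv sderiv_is_zmod_morphism.

Lemma sderivM a b : sderiv (a * b) = sderiv a * b + a * sderiv b.
Proof.
apply/seriesP => i; transitivity ((a * b) i.+1 *+ i.+1) => //.
rewrite (coef_sMtr a b (ltnSn i.+1)) -coef_deriv derivM.
rewrite coefD coef_sD !(coef_sMtr _ _ (ltnSn i)); congr (_ + _);
  apply: coefM_eq => j hj; rewrite ?coef_strunc ?ltnS //.
- by rewrite (@sderiv_strunc i.+2).
- exact: leqW.
- exact: leqW.
- by rewrite (@sderiv_strunc i.+2).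
Qed.

Lemma sderiv_ps p : sderiv (ps p) = ps p^`().
Proof. by apply/seriesP => i; rewrite /= coef_deriv. Qed.

End SeriesDeriv.

Section SeriesDomain.
Variable R : idomainType.
Implicit Types a b : series R.

Definition sunit a : bool := boolp.asbool (exists b, b * a = 1).
Definition sinv a : series R :=
  if boolp.pselect (exists b, b * a = 1) is left h
  then projT1 (boolp.cid h) else a.

Fact smulVr : {in sunit, left_inverse 1 sinv *%R}.
Proof.
move=> a /boolp.asboolP h; rewrite /sinv; case: boolp.pselect => // h'.
by case: boolp.cid.
Qed.
Fact sunitPl a b : b * a = 1 -> sunit a.
Proof. by move=> h; apply/boolp.asboolP; exists b. Qed.
Fact sinv_out : {in [predC sunit], sinv =1 id}.
Proof.
move=> a /negP h; rewrite /sinv; case: boolp.pselect => // h'.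
by case: h; have [b hb] := h'; apply: sunitPl hb.
Qed.
HB.instance Definition _ := GRing.ComNzRing_hasMulInverse.Build (series R)
  smulVr sunitPl sinv_out.

Lemma series_neq0 a : a != 0 -> exists2 k, a k != 0 & forall i, (i < k)%N -> a i = 0.
Proof.
move=> a0; have ex : exists k, a k != 0.
  apply: boolp.contrapT => h; move/eqP: a0; apply; apply/seriesP => i.
  apply/eqP; rewrite coef_s0; apply: boolp.contrapT => /negP hi.
  by apply: h; exists i.
exists (ex_minn ex); first by case: ex_minnP.
case: ex_minnP => k _ h i hi; apply/eqP; apply: contraTT hi => /h.
by rewrite -leqNgt.
Qed.

Fact smul_eq0 a b : a * b = 0 -> (a == 0) || (b == 0).
Proof.
move=> ab; apply/norP => -[/series_neq0[k ak hk] /series_neq0[l bl hl]].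
have [a' ea] := sX_div hk; have [b' eb] := sX_div hl.
have := congr1 (fun s : series R => s (k + l)%N) ab.
rewrite ea eb mulrACA -sXD coef_sXM ltnn subnn coef_sM big_ord1 subnn => /eqP.
rewrite mulf_eq0 => /orP[]/eqP h0.
  by rewrite ea coef_sXM ltnn subnn h0 eqxx in ak.
by rewrite eb coef_sXM ltnn subnn h0 eqxx in bl.
Qed.
HB.instance Definition _ :=
  GRing.ComUnitRing_isIntegral.Build (series R) smul_eq0.

Lemma sX_neq0 k : sX R k != 0.
Proof.
by apply/eqP => /(congr1 (fun s : series R => s k)) /eqP;
  rewrite coef_ps coefXn eqxx oner_eq0.
Qed.

End SeriesDomain.

(** * Hensel's lemma and Puiseux expansions *)

Section SliceCoef.
Variable R : comNzRingType.
Implicit Types P Q : {poly series R}.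

(** The coefficient of w^i when P in R[[w]][Y] is viewed as a power series in w over R[Y]; Hensel's
    lemma is solved slice by slice. *)
Definition slice i P : {poly R} := \poly_(j < size P) P`_j i.

Lemma coef_slice i P j : (slice i P)`_j = P`_j i.
Proof.
rewrite coef_poly; case: ltnP => // h.
by rewrite nth_default.
Qed.

Lemma slice_inj P Q : (forall i, slice i P = slice i Q) -> P = Q.
Proof.
move=> h; apply/polyP => j; apply/seriesP => i.
by rewrite -!coef_slice h.
Qed.

Lemma sliceM i P Q :
  slice i (P * Q) = \sum_(j < i.+1) slice j P * slice (i - j)%N Q.
Proof.
apply/polyP => l; rewrite coef_slice coefM coef_s_sum coef_sum.
transitivity (\sum_(a < l.+1) \sum_(j < i.+1) P`_a j * Q`_(l - a) (i - j)%N).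
  by apply: eq_bigr => a _; rewrite coef_sM.
rewrite exchange_big /=; apply: eq_bigr => j _; rewrite coefM.
by apply: eq_bigr => a _; rewrite !coef_slice.
Qed.

Lemma slice0 P : slice 0 P = map_poly (@s0 R) P.
Proof. by apply/polyP => j; rewrite coef_map. Qed.

Lemma size_slice_monic i P : P \is monic -> (0 < i)%N ->
  (size (slice i P) < size P)%N.
Proof.
move=> mP i0; have sP : (0 < size P)%N by rewrite size_poly_gt0 monic_neq0.
rewrite -(prednK sP) ltnS; apply/leq_sizeP => j hj; rewrite coef_slice.
move: hj; rewrite leq_eqVlt => /orP[/eqP <-|hj].
  by rewrite -lead_coefE (monicP mP) coef_s1; case: i i0.
by rewrite nth_default // -(prednK sP).
Qed.

End SliceCoef.

(** The linear correction in Hensel's lemma. Reducing one unknown modulo A bounds its degree; the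
    degree of E then bounds the other. *)
Lemma bezout_solve (K : fieldType) (A B E : {poly K}) :
  A \is monic -> B \is monic -> coprimep A B ->
  (size E < (size A + size B).-1)%N ->
  exists ab : {poly K} * {poly K},
    [/\ (size ab.1 < size A)%N, (size ab.2 < size B)%N
      & ab.1 * B + A * ab.2 = E].
Proof.
move=> mA mB cAB sE; have [[u v] /= huv] := Bezout_eq1_coprimepP _ _ cAB.
have A0 : A != 0 by exact: monic_neq0.
have B0 : B != 0 by exact: monic_neq0.
pose a := (E * v) %% A; pose b := (E * v) %/ A * B + E * u.
have e : a * B + A * b = E.
  rewrite /b mulrDr addrA (mulrC A (_ * B)) -mulrA (mulrC B A) mulrA -mulrDl.
  rewrite addrC [a + _]addrC -divp_eq.
  by rewrite -[RHS]mulr1 -huv mulrDr (mulrC A) !mulrA.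
have sa : (size a < size A)%N by rewrite ltn_modp.
exists (a, b); split => //=; have [->|b0] := eqVneq b 0.
  by rewrite size_poly0 size_poly_gt0.
have : (size (A * b)%R < (size A + size B).-1)%N.
  have -> : A * b = E - a * B by rewrite -e addrC addKr.
  apply: leq_ltn_trans (size_polyD _ _) _; rewrite gtn_max sE size_polyN /=.
  have [->|a0] := eqVneq a 0.
    rewrite mul0r size_poly0; move: A0 B0; rewrite -!size_poly_gt0.
    by case: (size A) (size B) => // i [] // j; rewrite addSn addnS.
  rewrite size_mul //; move: sa B0; rewrite -size_poly_gt0.
  move: (size B) => [//|sB] h _; rewrite !addnS /=.
  by rewrite ltn_add2r.
rewrite size_mul //; move: A0; rewrite -size_poly_gt0.
case: (size A) => // sA _; rewrite !addSn /=.
by rewrite ltn_add2l.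
Qed.

Section Hensel.
Variable K : fieldType.

Lemma hensel (P : {poly series K}) (A B : {poly K}) :
  P \is monic -> A \is monic -> B \is monic -> coprimep A B ->
  map_poly (@s0 K) P = A * B ->
  exists A' B' : {poly series K}, [/\ A' \is monic, B' \is monic,
    map_poly (@s0 K) A' = A, map_poly (@s0 K) B' = B & P = A' * B'].
Proof.
move=> mP mA mB cAB eP.
have A0 : A != 0 by exact: monic_neq0.
have B0 : B != 0 by exact: monic_neq0.
have sP : size P = (size A + size B).-1.
  by rewrite -(size_mul A0 B0) -eP size_map_poly_id0 // (monicP mP) rmorph1 oner_eq0.
(* The equation in w^(n+1) of P = A' B', linear in the unknown slices [ab] once the slices of index
   at most n are given by [f]. *)
pose good (f : nat -> {poly K} * {poly K}) n (ab : {poly K} * {poly K}) :=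
  [/\ (size ab.1 < size A)%N, (size ab.2 < size B)%N &
   ab.1 * B + A * ab.2 = slice n.+1 P - \sum_(j < n) (f j.+1).1 * (f (n - j)%N).2].
pose next f n := if boolp.pselect (exists ab, good f n ab) is left h
  then projT1 (boolp.cid h) else (0, 0).
pose st := fix st n : nat -> {poly K} * {poly K} := if n is m.+1 then
  fun i => if i == m.+1 then next (st m) m else st m i else fun=> (A, B).
pose f i := st i i.
have stE n i : (i <= n)%N -> st n i = f i.
  elim: n => [|n IH]; first by case: i.
  rewrite leq_eqVlt => /orP[/eqP ->//|hi].
  by rewrite /= [in LHS]ltn_eqF // IH.
have fS n : [/\ (size (f n.+1).1 < size A)%N, (size (f n.+1).2 < size B)%N &
   (f n.+1).1 * B + A * (f n.+1).2 =
   slice n.+1 P - \sum_(j < n) (f j.+1).1 * (f (n - j)%N).2].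
  elim/ltn_ind: n => n IH.
  have eS : \sum_(j < n) (st n j.+1).1 * (st n (n - j)%N).2 =
      \sum_(j < n) (f j.+1).1 * (f (n - j)%N).2.
    by apply: eq_bigr => j _; rewrite !stE // leq_subr.
  have -> : f n.+1 = next (st n) n by rewrite /f /= eqxx.
  rewrite /next; case: boolp.pselect => [h|[]].
    by case: boolp.cid => ab /= [h1 h2 h3]; split; rewrite // h3 eS.
  rewrite /good eS; apply: bezout_solve => //.
  rewrite -sP; apply: leq_ltn_trans (size_polyD _ _) _.
  rewrite gtn_max size_slice_monic //= size_polyN.
  apply: leq_ltn_trans (size_sum _ _ _) _; rewrite (@leq_ltn_trans (size P).-1) //.
    apply/bigmax_leqP => j _; apply: leq_trans (size_polyMleq _ _) _.
    have [h1 _ _] := IH j (ltn_ord j).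
    have : (n - j = (n - j.+1).+1)%N by rewrite subnSK.
    move=> ->; have [|_ h2 _] := IH (n - j.+1)%N.
      by rewrite ltn_subrL /= (leq_ltn_trans _ (ltn_ord j)).
    rewrite sP; move: h1 h2; move: (size _) (size _) (size A) (size B).
    move=> a b [//|c] [//|d]; rewrite !ltnS addSn addnS /= => h1 h2.
    by rewrite (leq_trans (leq_pred _)) // leq_add.
  by rewrite prednK // size_poly_gt0 monic_neq0.
pose A' := \poly_(j < size A) Series (fun i => (f i).1`_j).
pose B' := \poly_(j < size B) Series (fun i => (f i).2`_j).
have fz i : (size (f i).1 <= size A)%N /\ (size (f i).2 <= size B)%N.
  by case: i => [//|i]; have [/ltnW ? /ltnW ?] := fS i.
have sA' i : slice i A' = (f i).1.
  apply/polyP => j; rewrite coef_slice coef_poly; case: ltnP => // h.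
  by rewrite nth_default // (leq_trans _ h) // (fz i).1.
have sB' i : slice i B' = (f i).2.
  apply/polyP => j; rewrite coef_slice coef_poly; case: ltnP => // h.
  by rewrite nth_default // (leq_trans _ h) // (fz i).2.
(* Corrections of positive index have smaller degree, so the leading coefficient stays 1 as a
   series. *)
have lead (C : {poly K}) (g : nat -> {poly K}) : C \is monic -> g 0%N = C ->
    (forall i, size (g i.+1) < size C)%N ->
    \poly_(j < size C) Series (fun i => (g i)`_j) \is monic.
  move=> mC g0 gS; have C0 : (0 < size C)%N by rewrite size_poly_gt0 monic_neq0.
  have e1 : Series (fun i => (g i)`_(size C).-1) = 1.
    apply/seriesP => -[|i]; first by rewrite /= g0 -lead_coefE (monicP mC).
    by rewrite /= nth_default // -ltnS prednK.
  apply/monicP; rewrite -[size C]prednK // lead_coef_poly ?e1 ?oner_eq0 //.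
exists A', B'; split.
- by apply: (lead A (fun i => (f i).1)) => // i; case: (fS i).
- by apply: (lead B (fun i => (f i).2)) => // i; case: (fS i).
- by rewrite -slice0 sA'.
- by rewrite -slice0 sB'.
apply: slice_inj => -[|n]; rewrite sliceM.
  by rewrite big_ord1 sA' sB' slice0.
rewrite big_ord_recl big_ord_recr /= subn0 !sA' !sB' subnn.
have [_ _ h] := fS n; rewrite [X in _ * _ + (X + _)](_ : _ =
  \sum_(j < n) (f j.+1).1 * (f (n - j)%N).2); last first.
  by apply: eq_bigr => j _; rewrite sA' sB' /bump /= add1n subSS.
by rewrite /bump /= add1n addrCA [A * _ + _]addrC h addrC subrK.
Qed.

End Hensel.

Lemma coef_prod_scale (R : comNzRingType) (W : R) (ys : seq R) i :
  (i <= size ys)%N ->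
  (\prod_(y <- ys) ('X - (W * y)%:P))`_i =
    W ^+ (size ys - i) * (\prod_(y <- ys) ('X - y%:P))`_i.
Proof.
elim: ys i => [|y ys IH] i hi; first by rewrite !big_nil expr0 mul1r.
rewrite !big_cons !mulrBl !coefB !coefXM !coefCM.
case: i hi => [|i] hi.
  by rewrite eqxx !sub0r !IH //= !subn0 exprS mulrN !mulrA [W * y * _]mulrAC.
rewrite /= IH //= subSS mulrBr; congr (_ - _).
have [h|h] := leqP i.+1 (size ys).
  rewrite IH // -(subnSK h) exprS -!mulrA; congr (_ * _).
  by rewrite mulrCA.
by rewrite !nth_default ?size_prod_XsubC ?mulr0.
Qed.

Lemma map_prod_XsubC (R S : nzRingType) (f : {rmorphism R -> S}) (ys : seq R) :
  map_poly f (\prod_(y <- ys) ('X - y%:P)) = \prod_(y <- map f ys) ('X - y%:P).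
Proof.
rewrite rmorph_prod big_map; apply: eq_bigr => y _.
by rewrite rmorphB /= map_polyX map_polyC.
Qed.

(** * The Newton-Puiseux theorem in tame degree *)

Section Puiseux.
Variable L : closedFieldType.
Local Notation S := (series L).

Definition tame n := forall i, (0 < i <= n)%N -> i%:R != 0 :> L.

(** The ramification index is kept prime to the characteristic, so that d(w^N)/dw does not vanish in
    the proof of Ruppert's theorem. *)
Definition puiseux_split (P : {poly S}) := exists N (hN : (0 < N)%N) (ys : seq S),
  N%:R != 0 :> L /\ map_poly (ssub hN) P = \prod_(y <- ys) ('X - y%:P).

Lemma puiseux_splitM P Q :
  puiseux_split P -> puiseux_split Q -> puiseux_split (P * Q).
Proof.
move=> [N [hN [ys [N0 eP]]]] [M [hM [zs [M0 eQ]]]].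
have hNM : (0 < N * M)%N by rewrite muln_gt0 hN.
have hMN : (0 < M * N)%N by rewrite mulnC.
exists (N * M)%N, hNM, (map (ssub hM) ys ++ map (ssub hN) zs); split.
  by rewrite natrM mulf_neq0.
rewrite rmorphM big_cat /= -!map_prod_XsubC -eP -eQ -!map_poly_comp /=.
congr (_ * _); apply: eq_map_poly => a /=; rewrite ?(ssub_comp hN hM hNM) //.
rewrite (ssub_comp hM hN hMN); apply/seriesP => i.
by rewrite !coef_ssub mulnC.
Qed.

Lemma puiseux_split_ssub N (hN : (0 < N)%N) P : N%:R != 0 :> L ->
  puiseux_split (map_poly (ssub hN) P) -> puiseux_split P.
Proof.
move=> N0 [M [hM [ys [M0 eP]]]].
have hNM : (0 < N * M)%N by rewrite muln_gt0 hN.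
exists (N * M)%N, hNM, ys; split; first by rewrite natrM mulf_neq0.
rewrite -eP -map_poly_comp; apply: eq_map_poly => a.
by rewrite /= (ssub_comp hN hM hNM).
Qed.

Lemma puiseux_split_shift c P :
  puiseux_split (P \Po ('X + c%:P)) -> puiseux_split P.
Proof.
move=> [N [hN [ys [N0 eP]]]]; exists N, hN, (map (fun y => y + ssub hN c) ys).
split=> //; have -> : P = (P \Po ('X + c%:P)) \Po ('X - c%:P).
  by rewrite -comp_polyA comp_polyD comp_polyX comp_polyC subrK comp_polyXr.
rewrite map_comp_poly eP rmorphB /= map_polyX map_polyC /=.
rewrite big_map rmorph_prod; apply: eq_bigr => y _ /=.
by rewrite comp_polyB comp_polyX comp_polyC polyCD opprD addrA addrAC.
Qed.

(** The hypothesis on coefficients says P(Y) = w^(an) Q(Y / w^a), so the roots of P are those of Q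
    times w^a. *)
Lemma puiseux_split_scale (a n : nat) (P Q : {poly S}) :
  P \is monic -> Q \is monic -> size P = n.+1 -> size Q = n.+1 ->
  (forall i, (i <= n)%N -> P`_i = sX L (a * (n - i)) * Q`_i) ->
  puiseux_split Q -> puiseux_split P.
Proof.
move=> mP mQ sP sQ h [N [hN [ys [N0 eQ]]]].
exists N, hN, (map (fun y => sX L (N * a) * y) ys); split=> //.
rewrite big_map; have sy : size ys = n.
  apply/eqP; rewrite -eqSS -(size_prod_XsubC ys id) /= -eQ.
  by rewrite size_map_poly_id0 ?sQ // (monicP mQ) rmorph1 oner_eq0.
apply/polyP => i; have [hi|hi] := leqP i n.
  rewrite coef_prod_scale ?sy // -eQ !coef_map /= h // rmorphM /= ssub_sX.
  by rewrite sXX mulnA.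
rewrite !nth_default //.
  by rewrite size_prod_XsubC sy.
by rewrite (leq_trans (size_poly _ _)) // sP.
Qed.

(** With n invertible and no term in Y^(n-1), the only possible n-th power (Y - z)^n is Y^n. So P
    has two distinct roots, and one of them can be split off with its full multiplicity. *)
Lemma coprime_factor (P : {poly L}) i0 n : P \is monic -> size P = n.+1 ->
  (0 < n)%N -> n%:R != 0 :> L ->
  P`_n.-1 = 0 -> (i0 < n)%N -> P`_i0 != 0 ->
  exists A B : {poly L}, [/\ A \is monic, B \is monic, coprimep A B,
    (size A <= n)%N /\ (size B <= n)%N & P = A * B].
Proof.
move=> mP sP n0 nL Pn hi0 Pi0.
have [r] := closed_field_poly_normal P; rewrite (monicP mP) scale1r => eP.
have sr : size r = n.
  by apply/eqP; rewrite -eqSS -(size_prod_XsubC r id) /= -eP sP.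
case: r => [|z r] in eP sr *; first by rewrite -sr in n0.
pose c := count (pred1 z) (z :: r).
pose B := \prod_(x <- z :: r | x != z) ('X - x%:P).
have eAB : P = ('X - z%:P) ^+ c * B.
  rewrite eP (bigID (pred1 z)) /=; congr (_ * _).
  rewrite (eq_bigr (fun _ => 'X - z%:P)); last by move=> x /eqP ->.
  by rewrite big_const_seq iter_mulr_1.
have mB : B \is monic by exact: monic_prod_XsubC.
have mA : ('X - z%:P) ^+ c \is monic by rewrite monic_exp // monicXsubC.
have B0 : B != 0 by exact: monic_neq0.
have A0 : ('X - z%:P) ^+ c != 0 by exact: monic_neq0.
have sAB : ((size (('X - z%:P) ^+ c)) + size B)%N = n.+2.
  by move: (size_mul A0 B0); rewrite -eAB sP size_exp_XsubC /= => ->.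
exists (('X - z%:P) ^+ c), B; split=> //.
  apply: coprimep_expl; rewrite coprimep_sym coprimep_XsubC /B -big_filter.
  by rewrite root_prod_XsubC mem_filter eqxx.
have c0 : (0 < c)%N by rewrite /c /= eqxx.
have sB0 : (0 < size B)%N by rewrite size_poly_gt0.
rewrite size_exp_XsubC in sAB *.
have arith (b d : nat) : (0 < d -> 0 < b -> d.+1 + b = n.+2 ->
    (b <= n) /\ (n < d.+1 -> b = 1 /\ d = n))%N by lia.
have [hB hA] := arith _ _ c0 sB0 sAB; split=> //.
rewrite leqNgt; apply/negP => /hA[sB cn].
have B1 : B = 1.
  by rewrite [B]size1_polyC ?sB //; move/monicP: mB;
    rewrite lead_coefE sB => ->.
rewrite B1 mulr1 cn in eAB.
(* The coefficient of Y^(n-1) in (Y - z)^n is -nz. *)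
have z0 : z = 0.
  move: Pn; rewrite eAB.
  have -> : ('X - z%:P) ^+ n = \prod_(x <- nseq n z) ('X - x%:P).
    by rewrite big_nseq iter_mulr_1.
  have hs : size (nseq n z) != 0%N by rewrite size_nseq -lt0n.
  have := coefPn_prod_XsubC hs; rewrite size_nseq => ->.
    rewrite big_nseq => /eqP; rewrite oppr_eq0.
    have -> : iter n (+%R z) 0 = z *+ n by elim: (n) => //= j ->; rewrite mulrS.
    by rewrite -mulr_natl mulf_eq0 (negbTE nL) => /eqP.
by move: Pi0; rewrite eAB z0 subr0 coefXn ltn_eqF // eqxx.
Qed.

(** Minimizes k / (n - i), cross-multiplied: the slope of the side of the Newton polygon that starts
    at Y^n. [None] stands for a zero coefficient. *)
Lemma min_slope n (v : 'I_n -> option nat) : (exists i, v i != None) ->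
  exists i0 k0, v i0 = Some k0 /\
    forall i k, v i = Some k -> (k0 * (n - i) <= k * (n - i0))%N.
Proof.
move=> ex.
suff: forall s : seq 'I_n, (exists2 i, i \in s & v i != None) ->
  exists i0 k0, v i0 = Some k0 /\ forall i k, i \in s -> v i = Some k ->
    (k0 * (n - i) <= k * (n - i0))%N.
  case: ex => i hi /(_ (enum 'I_n))[]; first by exists i; rewrite ?mem_enum.
  move=> i0 [k0 [e h]]; exists i0, k0; split=> // j k; apply: h.
  by rewrite mem_enum.
elim=> [|j s IH] [i]; first by rewrite in_nil.
have [[i' hi' vi']|hs] := boolp.pselect (exists2 i, i \in s & v i != None); last first.
  move=> hi vi; have ij : i = j.
    move: hi; rewrite inE => /orP[/eqP//|hi]; case: hs; by exists i.
  case e : (v i) vi => [k0|] // _; exists i, k0; split=> // l k.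
  rewrite inE => /orP[/eqP ->|hl vl].
    by rewrite -ij e => -[->].
  by case: hs; exists l; rewrite // vl.
have [i0 [k0 [e0 h0]]] := IH (ex_intro2 _ _ i' hi' vi').
move=> _ _; case ej : (v j) => [kj|]; last first.
  exists i0, k0; split=> // l k; rewrite inE => /orP[/eqP -> |]; last exact: h0.
  by rewrite ej.
have [hc|hc] := leqP (k0 * (n - j)) (kj * (n - i0)).
  exists i0, k0; split=> // l k; rewrite inE => /orP[/eqP ->|]; last exact: h0.
  by rewrite ej => -[<-].
exists j, kj; split=> // l k; rewrite inE => /orP[/eqP ->|hl vl].
  by rewrite ej => -[<-].
have := h0 _ _ hl vl; move: (ltn_ord i0) (ltn_ord j) (ltn_ord l) => a b c hl'.
rewrite -(@leq_pmul2r (n - i0)) ?subn_gt0 //.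
apply: (@leq_trans ((k0 * (n - j)) * (n - l))).
  by rewrite mulnAC leq_mul2r (ltnW hc) orbT.
by rewrite mulnAC [X in (_ <= X)%N]mulnAC leq_mul2r hl' orbT.
Qed.

(** Induction on the degree: kill the term in Y^(n-1), ramify so that the minimal slope is an
    integer, rescale it to 0, and split by Hensel's lemma. Only n and n - i0, both at most n, have
    to be invertible. *)
Lemma puiseux n (P : {poly S}) : P \is monic -> size P = n.+1 -> tame n ->
  puiseux_split P.
Proof.
elim/ltn_ind: n P => n IH P mP sP tn.
have [n0|n0] := posnP n.
  exists 1%N, (ltnSn 0), [::]; split; first exact: oner_neq0.
  have -> : P = 1.
    by rewrite [P]size1_polyC ?sP ?n0 //; move/monicP: mP;
      rewrite lead_coefE sP n0 => ->.
  by rewrite big_nil rmorph1.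
have nL : n%:R != 0 :> L by apply: tn; rewrite n0 leqnn.
(* The Tschirnhaus shift, chosen so that the coefficient of Y^(n-1) vanishes. *)
pose c : S := - (P`_n.-1 * ps (n%:R^-1)%:P).
apply: (@puiseux_split_shift c); set Q := P \Po _.
have sXc : size ('X + c%:P) = 2%N by rewrite -[c]opprK polyCN size_XsubC.
have mXc : 'X + c%:P \is monic by rewrite -[c]opprK polyCN monicXsubC.
have sQ : size Q = n.+1.
  by rewrite /Q size_comp_poly2 // sP.
have mQ : Q \is monic.
  apply/monicP; rewrite /Q lead_coef_comp ?sXc // (monicP mP) (monicP mXc).
  by rewrite expr1n mulr1.
have Qn1 : Q`_n.-1 = 0.
  rewrite /Q coef_comp_poly sP -(prednK n0) !big_ord_recr /=.
  rewrite big1 ?add0r; last first.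
    move=> i _; rewrite [X in _ * X]nth_default ?mulr0 //.
    by apply: leq_trans (size_poly_exp_leq _ _) _; rewrite sXc mul1n.
    have e1 m : (('X + c%:P) ^+ m)`_m = 1.
    have := monicP (monic_exp m mXc); rewrite lead_coefE.
    by rewrite size_exp sXc mul1n.
  have e2 m : (('X + c%:P) ^+ m.+1)`_m = c *+ m.+1.
    elim: m => [|m IHm]; first by rewrite expr1 coefD coefX coefC add0r.
    rewrite exprS mulrDl coefD coefXM coefCM /= IHm e1 mulr1.
    by rewrite [in RHS]mulrSr.
  rewrite e2 e1 mulr1 prednK //.
  have -> : P`_n = 1 by move/monicP: mP; rewrite lead_coefE sP.
  have e3 : ps (n%:R^-1)%:P *+ n = 1 :> S.
    by rewrite -rmorphMn -polyCMn -(mulr_natr _^-1 n) mulVf // rmorph1.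
  by rewrite mul1r /c mulNrn -mulrnAr e3 mulr1 subrr.
have Qn : Q`_n = 1 by move/monicP: mQ; rewrite lead_coefE sQ.
have [h0|h0] := boolp.pselect (forall i : 'I_n, Q`_i = 0).
  exists 1%N, (ltnSn 0), (nseq n 0); split; first exact: oner_neq0.
  have -> : Q = 'X^n.
    apply/polyP => i; rewrite coefXn; have [->//|ni] := eqVneq i n.
    have [hi|hi] := ltnP i n; first exact: (h0 (Ordinal hi)).
    by rewrite nth_default // sQ ltn_neqAle eq_sym ni.
  by rewrite map_polyXn big_nseq iter_mulr_1 polyC0 subr0.
pose v (i : 'I_n) := if boolp.pselect (exists k, Q`_i k != 0) is left h
  then Some (ex_minn h) else None.
have vE (i : 'I_n) k : v i = Some k -> Q`_i k != 0 /\ forall j, (j < k)%N -> Q`_i j = 0.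
  rewrite /v; case: boolp.pselect => // h [<-]; case: ex_minnP => k' hk' min; split=> //.
  by move=> j hj; apply/eqP; apply: contraTT hj => /min; rewrite -leqNgt.
have vN (i : 'I_n) : v i = None -> Q`_i = 0.
  rewrite /v; case: boolp.pselect => // h _; apply/seriesP => k; apply/eqP.
  by apply: boolp.contrapT => /negP hk; apply: h; exists k.
have [|i0 [k0 [e0 hmin]]] := @min_slope n v.
  apply: boolp.contrapT => hv; apply: h0 => i; apply: vN; apply/eqP.
  by apply: boolp.contrapT => /negP hi; apply: hv; exists i.
have b0 : (0 < n - i0)%N by rewrite subn_gt0.
have bL : (n - i0)%:R != 0 :> L by apply: tn; rewrite b0 leq_subr.
apply: (@puiseux_split_ssub _ b0 _ bL).
(* After ramification by n - i0 the minimal slope is the integer k0, attained at i0. *)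
have div (i : 'I_n) : exists r : S, ssub b0 Q`_i = sX L (k0 * (n - i)) * r.
  case ei : (v i) => [k|]; last first.
    by exists 0; rewrite (vN _ ei) rmorph0 mulr0.
  apply: sX_div => j hj; rewrite coef_ssub; case: ifP => // /dvdnP[l el].
  rewrite el mulnK //; apply: (vE _ _ ei).2.
  have := hmin _ _ ei; rewrite el in hj => hk.
  have := leq_trans hj hk; by rewrite ltn_pmul2r.
pose r (i : 'I_n) := projT1 (boolp.cid (div i)).
have rE (i : 'I_n) : ssub b0 Q`_i = sX L (k0 * (n - i)) * r i.
  by rewrite /r; case: boolp.cid.
pose R := \poly_(i < n.+1) (if insub i is Some j then r j else 1).
have RE (i : 'I_n) : R`_i = r i by rewrite coef_poly ltnW ?ltnS // valK.
have Rn : R`_n = 1 by rewrite coef_poly ltnSn insubF // ltnn.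
have sR : size R = n.+1.
  by rewrite size_poly_eq // insubF ?ltnn // oner_neq0.
have mR : R \is monic by apply/monicP; rewrite lead_coefE sR.
apply: (@puiseux_split_scale k0 n _ R) => //.
- by rewrite monic_map.
- by rewrite size_map_poly_id0 ?sQ // (monicP mQ) rmorph1 oner_eq0.
- move=> i; rewrite leq_eqVlt coef_map /= => /orP[/eqP ->|hi].
    by rewrite Rn Qn rmorph1 subnn muln0 sX0 mul1r.
  by rewrite (rE (Ordinal hi)) -RE.
have i0n : (i0 < n.-1)%N.
  rewrite ltn_neqAle -ltnS prednK // ltn_ord andbT.
  apply: contraTneq (vE _ _ e0).1 => ->; by rewrite Qn1 eqxx.
have lift (B : {poly S}) : B \is monic -> map_poly (@s0 L) B \is monic /\
    size (map_poly (@s0 L) B) = size B.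
  move=> mB; split; first by rewrite monic_map.
  by rewrite size_map_poly_id0 // (monicP mB) rmorph1 oner_eq0.
have [] := @coprime_factor (map_poly (@s0 L) R) i0 n _ _ n0 nL.
- by rewrite monic_map.
- by rewrite (lift R mR).2.
- rewrite coef_map /=; have hn1 : (n.-1 < n)%N by rewrite ltn_predL.
  rewrite (RE (Ordinal hn1)); have := rE (Ordinal hn1); rewrite /= Qn1 rmorph0.
  by move/esym/eqP; rewrite mulf_eq0 (negbTE (sX_neq0 _ _)) => /eqP ->; rewrite rmorph0.
- by [].
- rewrite coef_map /= RE /s0.
  have := congr1 (fun s : S => s (k0 * (n - i0))%N) (rE i0).
  rewrite coef_sXM ltnn subnn => <-; rewrite coef_ssub dvdn_mull // mulnK //.
  exact: (vE _ _ e0).1.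
move=> A [B [mA mB cAB [sA sB] eAB]].
have [A' [B' [mA' mB' eA' eB' ->]]] := hensel mR mA mB cAB eAB.
have tle m : (m <= n)%N -> tame m.
  by move=> hm i /andP[i1 im]; apply: tn; rewrite i1 (leq_trans im).
have pos (C : {poly S}) : C \is monic -> size C = (size C).-1.+1.
  by move=> mC; rewrite prednK // size_poly_gt0 monic_neq0.
have sA' : ((size A').-1 < n)%N.
  by rewrite -(lift _ mA').2 eA' -[X in (_ < X)%N]prednK // ltnS -!subn1 leq_sub2r.
have sB' : ((size B').-1 < n)%N.
  by rewrite -(lift _ mB').2 eB' -[X in (_ < X)%N]prednK // ltnS -!subn1 leq_sub2r.
apply: puiseux_splitM; [apply: (IH _ sA') | apply: (IH _ sB')];
  rewrite -?pos //; exact/tle/ltnW.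
Qed.
End Puiseux.

(** * Resultants as products over roots *)

(** Resultants are compared with products over roots up to sign, which affects neither vanishing,
    nor unit orders, nor proportionality. *)
Definition pm_eq (R : nzRingType) (x y : R) := exists b : bool, x = (-1) ^+ b * y.

Lemma pm_refl (R : nzRingType) (x : R) : pm_eq x x.
Proof. by exists false; rewrite mul1r. Qed.

Lemma pm_opp (R : nzRingType) (x : R) : pm_eq (- x) x.
Proof. by exists true; rewrite expr1 mulN1r. Qed.

Lemma pm_sign (R : nzRingType) n (x : R) : pm_eq ((-1) ^+ n * x) x.
Proof. by exists (odd n); rewrite signr_odd. Qed.

Lemma pm_sym (R : nzRingType) (x y : R) : pm_eq x y -> pm_eq y x.
Proof. by move=> [b ->]; exists b; rewrite signrMK. Qed.

Lemma pm_trans (R : nzRingType) (y x z : R) : pm_eq x y -> pm_eq y z -> pm_eq x z.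
Proof. by move=> [b ->] [c ->]; exists (b (+) c); rewrite signr_addb mulrA. Qed.

Lemma pm_mul (R : comNzRingType) (x y x' y' : R) :
  pm_eq x x' -> pm_eq y y' -> pm_eq (x * y) (x' * y').
Proof. by move=> [b ->] [c ->]; exists (b (+) c); rewrite signr_addb mulrACA. Qed.

Lemma pm_prod (R : comNzRingType) (I : Type) (r : seq I) (P : pred I) (F G : I -> R) :
  (forall i, P i -> pm_eq (F i) (G i)) ->
  pm_eq (\prod_(i <- r | P i) F i) (\prod_(i <- r | P i) G i).
Proof.
move=> h; elim/big_rec2: _ => [|i x y Pi]; first exact: pm_refl.
by apply: pm_mul; apply: h.
Qed.

(* [map_resultant] only covers morphisms out of a polynomial ring. *)
Lemma map_resultant_gen (R R' : nzRingType) (f : {rmorphism R -> R'}) (p q : {poly R}) :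
  f (lead_coef p) != 0 -> f (lead_coef q) != 0 ->
  f (resultant p q) = resultant (map_poly f p) (map_poly f q).
Proof.
move=> p0 q0; rewrite /resultant /Sylvester_mx !size_map_poly_id0 //.
rewrite -det_map_mx /= map_col_mx; congr (\det (col_mx _ _));
  by apply: map_lin1_mx => v; rewrite map_poly_rV rmorphM /= map_rVpoly.
Qed.

Section VandermondeProducts.
Variables (R : idomainType) (n : nat) (y : 'I_n -> R).

Local Notation p := (\prod_(i < n) ('X - (y i)%:P)).
Local Notation V := (Vandermonde n (\row_i y i)).

Lemma size_prod_ord : size p = n.+1.
Proof. by rewrite size_prod_XsubC /index_enum -enumT size_enum_ord. Qed.

Lemma horner_prod_root i : p.[y i] = 0.
Proof.
by rewrite (bigD1 i) //= hornerM hornerXsubC subrr mul0r.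
Qed.

Lemma det_Vandermonde_neq0 : injective y -> \det V != 0.
Proof.
move=> yI; rewrite det_Vandermonde; apply/prodf_neq0 => i _.
apply/prodf_neq0 => j ij; rewrite !mxE subr_eq0; apply/eqP => /yI e.
by rewrite e ltnn in ij.
Qed.

Lemma deriv_prod_root i :
  p^`().[y i] = \prod_(j < n | j != i) (y i - y j).
Proof.
rewrite (bigD1 i) //= derivM derivXsubC mul1r hornerD hornerM hornerXsubC subrr.
rewrite mul0r addr0 horner_prod; apply: eq_bigr => j _.
by rewrite hornerXsubC.
Qed.

(** Of the two factors coming from a pair of roots, each copy of the Vandermonde determinant
    receives one. *)
Lemma prod_deriv_Vandermonde : pm_eq (\prod_(i < n) p^`().[y i]) (\det V ^+ 2).
Proof.
rewrite expr2 det_Vandermonde.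
have -> : \prod_(i < n) p^`().[y i] = (\prod_(i < n) \prod_(j < n | (i < j)%N) (y i - y j)) *
    (\prod_(i < n) \prod_(j < n | (j < i)%N) (y i - y j)).
  rewrite -big_split /=; apply: eq_bigr => i _; rewrite deriv_prod_root.
  rewrite (bigID (fun j : 'I_n => (i < j)%N)) /=; congr (_ * _); apply: eq_bigl => j.
    by rewrite -val_eqE /=; case: ltngtP.
  by rewrite -val_eqE /=; case: ltngtP.
apply: pm_mul.
  by do 2!(apply: pm_prod => ? _); rewrite !mxE -opprB; apply: pm_opp.
rewrite (exchange_big_dep xpredT) //=; do 2!(apply: pm_prod => ? _).
by rewrite !mxE; apply: pm_refl.
Qed.

(** Multiplying the Sylvester matrix by a matrix that evaluates rows at the roots kills the rows of
    p there and turns those of q into the Vandermonde matrix scaled by the q(y_i). Distinct roots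
    allow cancelling the Vandermonde determinant. *)
Lemma det_sylvester_prod (q : {poly R}) e m (Sy : 'M[R]_(e + m)) :
  injective y -> m = n -> (size q <= e.+1)%N ->
  (forall i j, Sy i j = match split i with
     inl k => ('X^k * p)`_j | inr k => ('X^k * q)`_j end) ->
  pm_eq (\det Sy) (\prod_(i < n) q.[y i]).
Proof.
move=> yI em sq SyE; subst m.
(* The last n columns evaluate at the roots; the first e columns extract the coefficients of index n
   + k, which makes the product block triangular. *)
pose C : 'M[R]_(e + n) := \matrix_(b, j) match split j with
  inl k => (b == n + k :> nat)%:R | inr l => y l ^+ b end.
pose T : 'M[R]_e := \matrix_(i, k) ('X^i * p)`_(n + k).
pose W : 'M[R]_(n, e) := \matrix_(i, k) ('X^i * q)`_(n + k).
pose D := diag_mx (\row_i q.[y i]).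
have szp : size p = n.+1 := size_prod_ord.
have sz (r : {poly R}) k : (k + size r <= e + n)%N -> (size ('X^k * r)%R <= e + n)%N.
  by apply: leq_trans; rewrite (leq_trans (size_polyMleq _ _)) // size_polyXn addSn.
have szs (i : 'I_(e + n)) : (size (match split i with
     inl k => 'X^k * p | inr k => 'X^k * q end)%R <= e + n)%N.
  case: split => k; apply: sz; first by rewrite szp addnS -addSn leq_add2r.
  rewrite (leq_trans (_ : _ <= k + e.+1)%N) ?leq_add2l //.
  by rewrite addnS -addSn addnC leq_add2l.
have hor (r : {poly R}) c : (size r <= e + n)%N -> \sum_(b < e + n) r`_b * c ^+ b = r.[c].
  by move=> h; rewrite (horner_coef_wide _ h).
have pick (r : {poly R}) (k : 'I_e) :
    \sum_(b < e + n) r`_b * (b == n + k :> nat)%:R = r`_(n + k).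
  have hk : (n + k < e + n)%N by rewrite addnC ltn_add2r.
  rewrite (bigD1 (Ordinal hk)) //= eqxx mulr1 big1 ?addr0 // => b.
  by rewrite -val_eqE /= => /negbTE ->; rewrite mulr0.
have eM : Sy *m C = block_mx T 0 W (Vandermonde n (\row_i y i) *m D).
  apply/matrixP => i j; rewrite mxE.
  transitivity (\sum_(b < e + n) (match split i with
     inl k => 'X^k * p | inr k => 'X^k * q end)%R`_b * C b j).
    by apply: eq_bigr => b _; rewrite SyE; case: split.
  move: (szs i); rewrite /block_mx [in RHS]mxE; case: (split i) => a sa; rewrite [in RHS]mxE.
    rewrite (eq_bigr (fun b : 'I_(e + n) => ('X^a * p)`_b * match split j with
      inl k => (b == n + k :> nat)%:R | inr l => y l ^+ b end)); last first.
      by move=> b _; rewrite [C _ _]mxE.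
    case: (split j) => l; first by rewrite pick mxE.
    by rewrite hor // hornerM horner_prod_root mulr0 mxE.
  rewrite (eq_bigr (fun b : 'I_(e + n) => ('X^a * q)`_b * match split j with
    inl k => (b == n + k :> nat)%:R | inr l => y l ^+ b end)); last first.
    by move=> b _; rewrite [C _ _]mxE.
  case: (split j) => l; first by rewrite pick mxE.
  rewrite hor // hornerM hornerXn mul_mx_diag !mxE.
  by [].
(* Moving the last e rows of [C] to the top makes it block triangular with an identity block, so its
   determinant is that of the Vandermonde matrix up to sign. *)
pose f (i : 'I_(e + n)) : 'I_(e + n) := match split i with
  inl k => cast_ord (addnC n e) (rshift n k) | inr l => cast_ord (addnC n e) (lshift e l) end.
have fI : injective f.
  move=> i j; rewrite /f -[i]splitK -[j]splitK; case: (split i) => a; case: (split j) => b;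
    rewrite !unsplitK => /(congr1 val) /=.
  - by move/addnI/ord_inj => ->.
  - by move=> h; have := ltn_ord b; rewrite -h ltnNge leq_addr.
  - by move=> h; have := ltn_ord a; rewrite h ltnNge leq_addr.
  - by move/ord_inj => ->.
have eC : row_perm (perm fI) C =
    block_mx 1%:M (\matrix_(i, l) y l ^+ (n + i)) 0 (Vandermonde n (\row_i y i)).
  apply/matrixP => i j; rewrite !mxE permE /f.
  case: (split i) => a; rewrite !mxE; case: (split j) => b; rewrite !mxE //=.
    by rewrite eqn_add2l.
  by rewrite ltn_eqF // (leq_trans (ltn_ord a)) ?leq_addr.
have dC : pm_eq (\det C) (\det (Vandermonde n (\row_i y i))).
  have := congr1 (fun A => \det A) eC; rewrite row_permE det_mulmx det_perm det_ublock det1 mul1r.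
  by move=> <-; apply/pm_sym/pm_sign.
have dT : \det T = 1.
  rewrite det_trig.
    rewrite big1 // => i _; rewrite mxE coefXnM ltnNge leq_addl /= addnK.
    by have := monic_prod_XsubC (index_enum 'I_n) xpredT y;
      move/monicP; rewrite lead_coefE szp.
  apply/is_trig_mxP => i j ij; rewrite mxE coefXnM; case: ltnP => // _.
  by rewrite nth_default // szp -addnBA ?(ltnW ij) // -addn1 leq_add2l subn_gt0.
have [b eb] := dC; have V0 := det_Vandermonde_neq0 yI.
have := congr1 (fun A => \det A) eM.
rewrite det_mulmx det_lblock dT mul1r det_mulmx det_diag eb => h.
exists b; apply: (mulIf V0); rewrite -(signrMK b (\det Sy)) -!mulrA; congr (_ * _).
rewrite mulrCA h mulrC; congr (_ * _).
by apply: eq_bigr => i _; rewrite mxE.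
Qed.

Lemma resultant_prod (q : {poly R}) : injective y ->
  pm_eq (resultant p q) (\prod_(i < n) q.[y i]).
Proof.
move=> yI; apply: (@det_sylvester_prod q) => //; first by rewrite size_prod_ord.
  exact: leqSpred.
move=> i j; rewrite Sylvester_mxE; case: (split i) => k /=;
  by rewrite coefXnM ltnNge; case: leqP.
Qed.

End VandermondeProducts.

Section TransportedProduct.
Variables (S S' : idomainType) (f : {rmorphism S -> S'}).
Variables (n : nat) (y : 'I_n -> S') (P : {poly S}).
Hypothesis yI : injective y.
Hypothesis mP : P \is monic.
Hypothesis eP : map_poly f P = \prod_(i < n) ('X - (y i)%:P).

(** [chi] is the characteristic polynomial of multiplication by q on S[Y]/(P) in the basis of powers
    of Y. Over S' the Vandermonde matrix diagonalizes it, with eigenvalues q(y_i). *)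
Lemma prod_horner_root (q : {poly S}) : exists2 chi : {poly S}, chi \is monic &
  map_poly f chi = \prod_(i < n) ('X - (map_poly f q).[y i]%:P).
Proof.
pose A : 'M[S]_n := \matrix_(a, b) (Pdiv.Ring.rmodp ('X^a * q) P)`_b.
have sP : size P = n.+1.
  rewrite -(size_prod_ord y) -eP size_map_poly_id0 // (monicP mP) rmorph1.
  exact: oner_neq0.
exists (char_poly A); first exact: char_poly_monic.
rewrite map_char_poly; set V := Vandermonde n (\row_i y i).
pose D := diag_mx (\row_i (map_poly f q).[y i]).
have eA : map_mx f A *m V = V *m D.
  apply/matrixP => a i; rewrite mul_mx_diag !mxE.
  transitivity ((map_poly f (Pdiv.Ring.rmodp ('X^a * q) P)).[y i]).
    rewrite (@horner_coef_wide _ n).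
      by apply: eq_bigr => b _; rewrite coef_map !mxE.
    rewrite (leq_trans (size_poly _ _)) // -ltnS -sP.
    by rewrite Pdiv.Ring.ltn_rmodpN0 // monic_neq0.
  have -> : y i ^+ a * (map_poly f q).[y i] = (map_poly f ('X^a * q)).[y i].
    by rewrite rmorphM hornerM /= map_polyXn hornerXn.
  rewrite [in RHS](Pdiv.RingMonic.rdivp_eq mP ('X^a * q)) rmorphD rmorphM /= eP.
  by rewrite hornerD hornerM horner_prod_root mulr0 add0r.
have eQ : char_poly_mx (map_mx f A) *m map_mx polyC V =
    map_mx polyC V *m diag_mx (\row_i ('X - (map_poly f q).[y i]%:P)).
  rewrite /char_poly_mx mulmxBl mul_scalar_mx -map_mxM eA map_mxM /=.
  apply/matrixP => a i; rewrite mul_mx_diag [LHS]mxE [X in _ + X]mxE.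
  by rewrite /D map_diag_mx mul_mx_diag !mxE mulrBr mulrC.
have := congr1 (fun B => \det B) eQ; rewrite !det_mulmx det_diag det_map_mx mulrC.
have V0 : (\det V)%:P != 0 by rewrite polyC_eq0 det_Vandermonde_neq0.
by move/(mulfI V0); rewrite /char_poly => ->; apply: eq_bigr => i _; rewrite mxE.
Qed.

Lemma sum_horner_root (q : {poly S}) : exists t : S,
  f t = \sum_(i < n) (map_poly f q).[y i].
Proof.
have [chi mchi echi] := prod_horner_root q.
have [n0|n0] := posnP n.
  exists 0; rewrite rmorph0 big1 // => i; by have := ltn_ord i; rewrite {2}n0.
exists (- chi`_n.-1); rewrite rmorphN -coef_map echi.
have := @coefPn_prod_XsubC _ (map (fun i => (map_poly f q).[y i]) (index_enum 'I_n)).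
have si : size (index_enum 'I_n) = n by rewrite /index_enum -enumT size_enum_ord.
rewrite size_map si !big_map.
by move=> /(_ (lt0n_neq0 n0)) ->; rewrite opprK.
Qed.

End TransportedProduct.

(** * Places and purity of the branch locus *)

(** A place of L with valuation ring V and values in k: the second field makes ker h the maximal
    ideal, and the third says that x is in V or its inverse is in ker h. No discreteness is
    imposed. *)
Record is_place (V : idomainType) (L k : fieldType)
    (i : {rmorphism V -> L}) (h : {rmorphism V -> k}) : Prop := IsPlace {
  place_inj : injective i;
  place_unit : forall v, h v != 0 -> v \is a GRing.unit;
  place_total : forall x : L,
    (exists v, i v = x) \/ exists2 v, h v = 0 & i v * x = 1 }.

Section Place.
Variables (V : idomainType) (L k : fieldType).
Variables (iV : {rmorphism V -> L}) (hV : {rmorphism V -> k}).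
Hypothesis plV : is_place iV hV.

Lemma place_unitE v : (v \is a GRing.unit) = (hV v != 0).
Proof.
apply/idP/idP; last exact: (place_unit plV).
by move/(rmorph_unit hV); rewrite unitfE.
Qed.

(** If x is not in V, its inverse v is; multiplying the equation of degree N by v^(N-1) expresses
    lead(P) x through nonnegative powers of v. *)
Lemma place_leading_root (P : {poly V}) x : root (map_poly iV P) x ->
  exists v, iV v = iV (lead_coef P) * x.
Proof.
case: (place_total plV x) => [[v <-] _|[v hv ev] rx].
  by exists (lead_coef P * v); rewrite rmorphM.
have [N sP] : exists N, (size P).-1 = N by exists (size P).-1.
exists (- \sum_(i < N) P`_i * v ^+ (N.-1 - i)).
have := rootP rx; rewrite (@horner_coef_wide _ N.+1); last first.
  by rewrite (leq_trans (size_poly _ _)) // -sP leqSpred.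
rewrite big_ord_recr /= coef_map /= [P`_N](_ : _ = lead_coef P); last by rewrite lead_coefE sP.
case: N sP => [|N] sP e.
  rewrite big_ord0 oppr0 rmorph0; move: e; rewrite big_ord0 add0r expr0 mulr1 => ->.
  by rewrite mul0r.
have vx i : iV v ^+ i * x ^+ i = 1 by rewrite -exprMn ev expr1n.
have := congr1 (fun z => iV v ^+ N * z) e; rewrite mulr0 mulrDr exprS.
have -> : iV v ^+ N * (iV (lead_coef P) * (x * x ^+ N)) = iV (lead_coef P) * x * (iV v ^+ N * x ^+ N) by ring.
rewrite vx mulr1 => /eqP; rewrite addrC addr_eq0 => /eqP ->.
rewrite rmorphN rmorph_sum mulr_sumr; congr (- _); apply: eq_bigr => i _ /=.
rewrite coef_map rmorphM rmorphXn /=.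
have iN : (i <= N)%N by rewrite -ltnS.
have -> : iV v ^+ N = iV v ^+ (N - i) * iV v ^+ i by rewrite -exprD subnK.
by rewrite mulrACA vx mulr1 mulrC.
Qed.

Lemma place_root (P : {poly V}) x : hV (lead_coef P) != 0 -> root (map_poly iV P) x ->
  exists v, iV v = x.
Proof.
move=> /(place_unit plV) u /place_leading_root[v ev]; exists ((lead_coef P)^-1 * v).
by rewrite rmorphM ev mulrA -rmorphM mulVr // rmorph1 mul1r.
Qed.

(** Values are totally ordered, so an entry of largest value exists and divides the others in V;
    this does the work of a uniformizer. *)
Lemma place_max (I : finType) (x : I -> L) : (exists i, x i != 0) ->
  exists i0 (c : I -> V), x i0 != 0 /\ forall i, x i = iV (c i) * x i0.
Proof.
move=> ex; suff [i0 [xi0 h]] : exists i0, x i0 != 0 /\ forall i, exists c, x i = iV c * x i0.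
  by exists i0, (fun i => projT1 (boolp.cid (h i))); split=> // i; case: boolp.cid.
suff: forall s : seq I, (exists2 i, i \in s & x i != 0) ->
    exists i0, x i0 != 0 /\ forall i, i \in s -> exists c, x i = iV c * x i0.
  case: ex => i hi /(_ (enum I))[|i0 [xi0 h]]; first by exists i; rewrite ?mem_enum.
  by exists i0; split=> // j; apply: h; rewrite mem_enum.
elim=> [|j s IH] [i]; first by rewrite in_nil.
have [xj|xj] := eqVneq (x j) 0.
  rewrite inE => /orP[/eqP ->|hi xi]; first by rewrite xj eqxx.
  have [i0 [xi0 h]] := IH (ex_intro2 _ _ i hi xi); exists i0; split=> // l.
  rewrite inE => /orP[/eqP ->|]; last exact: h.
  by exists 0; rewrite xj rmorph0 mul0r.
have [[i' hi' xi'] _ _|hs _ _] := boolp.pselect (exists2 i, i \in s & x i != 0); last first.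
  exists j; split=> // l; rewrite inE => /orP[/eqP ->|hl]; first by exists 1; rewrite rmorph1 mul1r.
  exists 0; rewrite rmorph0 mul0r; apply/eqP; apply: boolp.contrapT => /negP xl.
  by apply: hs; exists l.
have [i0 [xi0 h]] := IH (ex_intro2 _ _ i' hi' xi').
case: (place_total plV (x j / x i0)) => [[v ev]|[v _ ev]].
  exists i0; split=> // l; rewrite inE => /orP[/eqP ->|]; last exact: h.
  by exists v; rewrite ev mulfVK.
exists j; split=> // l; rewrite inE => /orP[/eqP ->|hl]; first by exists 1; rewrite rmorph1 mul1r.
have [c ec] := h _ hl; exists (c * v); rewrite ec rmorphM -mulrA; congr (_ * _).
by rewrite -[LHS]mul1r -ev -mulrA mulfVK.
Qed.

End Place.

(** Equivalently, s is w^c times a unit of V[[w]]: the leading coefficient must also survive in the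
    residue field. *)
Definition has_unit_order (V : comUnitRingType) (s : series V) (c : nat) :=
  (forall i, (i < c)%N -> s i = 0) /\ s c \is a GRing.unit.

Section Purity.
Variables (V : idomainType) (L k : fieldType).
Variables (iV : {rmorphism V -> L}) (hV : {rmorphism V -> k}).
Hypothesis plV : is_place iV hV.
Variables (n : nat) (y : 'I_n -> series L) (P : {poly series V}).
Hypothesis yI : injective y.
Hypothesis mP : P \is monic.
Local Notation S := (series V).
Local Notation S' := (series L).
Local Notation f := (map_series iV).
Hypothesis eP : map_poly f P = \prod_(i < n) ('X - (y i)%:P).
Variables (s : S) (c0 : nat).
Hypothesis os : has_unit_order s c0.
Hypothesis es : pm_eq (f s) (\prod_(i < n) (map_poly f P^`()).[y i]).

Let fI : injective f. Proof. exact/map_series_inj/(place_inj plV). Qed.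

(* [Lam z] says that [z] lies in the V((w))-span of the powers of [y]. *)
Definition Lam (z : 'I_n -> S') := exists e (q : {poly S}),
  forall i, sX L e * z i = (map_poly f q).[y i].

Lemma LamC (t : S) : Lam (fun=> f t).
Proof.
by exists 0%N, t%:P => i; rewrite sX0 mul1r map_polyC hornerC.
Qed.

Lemma LamXn a : Lam (fun i => y i ^+ a).
Proof.
by exists 0%N, 'X^a => i; rewrite sX0 mul1r map_polyXn hornerXn.
Qed.

Lemma LamD z1 z2 : Lam z1 -> Lam z2 -> Lam (fun i => z1 i + z2 i).
Proof.
move=> [e1 [q1 h1]] [e2 [q2 h2]].
exists (e1 + e2)%N, ((sX V e2)%:P * q1 + (sX V e1)%:P * q2) => i.
rewrite rmorphD !rmorphM hornerD !hornerM /= !map_polyC !hornerC /= !map_series_sX.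
by rewrite -h1 -h2 sXD; ring.
Qed.

Lemma LamM z1 z2 : Lam z1 -> Lam z2 -> Lam (fun i => z1 i * z2 i).
Proof.
move=> [e1 [q1 h1]] [e2 [q2 h2]].
exists (e1 + e2)%N, (q1 * q2) => i.
by rewrite rmorphM hornerM -h1 -h2 sXD; ring.
Qed.

Lemma Lam_eq z1 z2 : z1 =1 z2 -> Lam z1 -> Lam z2.
Proof. by move=> h [e [q hq]]; exists e, q => i; rewrite -h. Qed.

Lemma Lam_sum m (g : 'I_m -> 'I_n -> S') : (forall a, Lam (g a)) ->
  Lam (fun i => \sum_a g a i).
Proof.
elim: m g => [|m IH] g hg.
  apply: (@Lam_eq (fun=> f 0)); last exact: LamC.
  by move=> i; rewrite rmorph0 big_ord0.
apply: (@Lam_eq (fun i => g ord0 i + \sum_a g (lift ord0 a) i)).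
  by move=> i; rewrite big_ord_recl.
by apply: LamD => //; apply: IH.
Qed.

Lemma Lam_div a z : Lam (fun i => sX L a * z i) -> Lam z.
Proof. by move=> [e [q hq]]; exists (e + a)%N, q => i; rewrite sXD -mulrA. Qed.

Lemma divf (t : S) e z : f t = sX L e * z -> exists2 t', t = sX V e * t' & f t' = z.
Proof.
move=> h; have [t' et] : exists t', t = sX V e * t'.
  apply: sX_div => i hi; apply: (place_inj plV).
  by rewrite -(coef_map_series iV t) h coef_sXM hi rmorph0.
by exists t' => //; apply: (@sX_inj _ e); rewrite -h et rmorphM /= map_series_sX.
Qed.

(** The characteristic polynomial of w^e z lies over V[[w]], and its coefficients can be divided by
    the powers of w that turn it into that of z. At w = 0 this leaves a monic equation over V for
    z(0). *)
Lemma Lam_integral z i : Lam z -> exists v, iV v = z i 0%N.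
Proof.
move=> [e [q hq]]; have [chi mchi echi] := prod_horner_root yI mP eP q.
pose zs := map z (index_enum 'I_n).
have sz : size zs = n by rewrite size_map /index_enum -enumT size_enum_ord.
have chiE : map_poly f chi = \prod_(x <- zs) ('X - (sX L e * x)%:P).
  by rewrite echi big_map; apply: eq_bigr => j _; rewrite hq.
have ex (j : 'I_n.+1) : exists t : S, f t = (\prod_(x <- zs) ('X - x%:P))`_j.
  have := @coef_prod_scale _ (sX L e) zs j; rewrite sz -ltnS => /(_ (ltn_ord j)).
  rewrite -chiE coef_map /= sXX => /divf[t' _ ht]; by exists t'.
pose g (j : 'I_n.+1) := projT1 (boolp.cid (ex j)).
have gE (j : 'I_n.+1) : f (g j) = (\prod_(x <- zs) ('X - x%:P))`_j.
  by rewrite /g; case: boolp.cid.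
pose p : {poly V} := \poly_(j < n.+1) (if insub j is Some j' then g j' 0%N else 0).
have pE : map_poly iV p = \prod_(x <- map (fun x : S' => x 0%N) zs) ('X - x%:P).
  rewrite -(map_prod_XsubC (@s0 L)); apply/polyP => j; rewrite !coef_map coef_poly /=.
  have [hj|hj] := ltnP j n.+1; last first.
    by rewrite rmorph0 [X in s0 X]nth_default ?rmorph0 // size_prod_XsubC sz.
  by rewrite insubT /= -(gE (Sub j hj)).
have mp : p \is monic.
  have sp : size (map_poly iV p) = n.+1 by rewrite pE size_prod_XsubC size_map sz.
  rewrite (size_map_inj_poly (place_inj plV)) ?rmorph0 // in sp.
  apply/monicP; apply: (place_inj plV); rewrite rmorph1 lead_coefE -coef_map.
  have -> : (size p).-1 = (size (map_poly iV p)).-1.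
    by rewrite (size_map_inj_poly (place_inj plV)) ?rmorph0.
  by rewrite -lead_coefE pE; apply/monicP/monic_prod_XsubC.
apply: (place_root plV (P := p)); first by rewrite (monicP mp) rmorph1 oner_neq0.
rewrite pE root_prod_XsubC; apply/mapP.
by exists (z i) => //; apply/mapP; exists i; rewrite ?mem_index_enum.
Qed.

Lemma Lam_trace z : Lam z -> exists t, f t = \sum_i z i.
Proof.
move=> [e [q hq]]; have [t et] := sum_horner_root yI mP eP q.
have : f t = sX L e * \sum_i z i.
  by rewrite et mulr_sumr; apply: eq_bigr => i _; rewrite hq.
by case/divf => t' _ <-; exists t'.
Qed.

(** While det B vanishes at w = 0 the rows are dependent modulo w. Scaling a relation by its entry
    of largest value puts its coefficients in V, with one equal to 1; replacing that row by the
    combination divided by w lowers the order of det B by one. The index [m] bounds this order. *)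
Lemma Lam_reduce m (B : 'M[S']_n) : (forall a, Lam (fun i => B a i)) ->
  (\det B) m != 0 -> exists c (C : 'M[S']_n),
  [/\ forall a, Lam (fun i => C a i), \det B = sX L c * \det C & (\det C) 0%N != 0].
Proof.
elim/ltn_ind: m B => m IH B LB dB.
have [d0|d0] := eqVneq ((\det B) 0%N) 0; last first.
  by exists 0%N, B; rewrite sX0 mul1r.
have : \det (map_mx (@s0 L) B) == 0 by rewrite det_map_mx; apply/eqP.
case/det0P => v v0 vB.
have [i0 [c [vi0 hc]]] : exists i0 (c : 'I_n -> V), v 0 i0 != 0 /\
    forall i, v 0 i = iV (c i) * v 0 i0.
  apply: (place_max plV); apply: boolp.contrapT => h; move/eqP: v0; apply.
  apply/rowP => i; rewrite mxE; apply/eqP; apply: boolp.contrapT => /negP hi.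
  by apply: h; exists i.
have ci0 : c i0 = 1.
  apply: (place_inj plV); rewrite rmorph1; apply: (mulIf vi0).
  by rewrite -hc mul1r.
pose cs a : S' := f (ps (c a)%:P).
have ex i : exists r, \sum_a cs a * B a i = sX L 1 * r.
  apply: sX_div => -[|//] _; have := congr1 (fun w : 'rV_n => w 0 i) vB.
  rewrite !mxE -[in X in _ -> X](mulr0 (v 0 i0)^-1) => <-.
  rewrite -/(s0 _) rmorph_sum mulr_sumr; apply: eq_bigr => a _.
  rewrite rmorphM (hc a) [in RHS]mxE [in RHS]mulrA [X in _ = X * _]mulrCA mulVf // mulr1; congr (_ * _).
  by rewrite /= /s0 /= coefC.
pose r i := projT1 (boolp.cid (ex i)).
have rE i : \sum_a cs a * B a i = sX L 1 * r i by rewrite /r; case: boolp.cid.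
pose C : 'M[S']_n := \matrix_(a, i) if a == i0 then r i else B a i.
have LC a : Lam (fun i => C a i).
  have [->|ai] := eqVneq a i0; last first.
    by apply: (@Lam_eq (fun i => B a i)) => // i; rewrite mxE (negbTE ai).
  apply: (@Lam_div 1); apply: (@Lam_eq (fun i => \sum_a cs a * B a i)).
    by move=> i; rewrite rE mxE eqxx.
  by apply: Lam_sum => b; apply: LamM => //; apply: LamC.
have dC : \det B = sX L 1 * \det C.
  rewrite (expand_det_row C i0) mulr_sumr.
  transitivity (\sum_i \sum_a cs a * (B a i * cofactor B i0 i)).
    rewrite exchange_big /=.
    transitivity (\sum_a cs a * (B *m \adj B) a i0).
      rewrite mul_mx_adj (bigD1 i0) //= big1 ?addr0 => [|a ai].
        by rewrite mxE eqxx mulr1n /cs ci0 !rmorph1 mul1r.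
      by rewrite mxE (negbTE ai) mulr0.
    apply: eq_bigr => a _; rewrite mxE mulr_sumr; apply: eq_bigr => i _.
    by rewrite [\adj B _ _]mxE.
  apply: eq_bigr => i _; rewrite mxE eqxx mulrA -rE mulr_suml.
  have -> : cofactor C i0 i = cofactor B i0 i.
    rewrite /cofactor; congr (_ * \det _); apply/matrixP => a b.
    by rewrite !mxE eq_sym (negbTE (neq_lift _ _)).
  by apply: eq_bigr => a _; rewrite mulrA.
case: m => [|m] in IH dB *; first by rewrite d0 eqxx in dB.
have [|c' [D [LD eD D0]]] := IH m (ltnSn m) C LC.
  by move: dB; rewrite dC coef_sXM /= subn1.
by exists (1 + c')%N, D; split; rewrite // dC eD sXD mulrA.
Qed.

(** Starting from the powers of y, the reduction ends with a matrix whose squared determinant at w =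
    0 is, up to sign, the leading coefficient of the discriminant. This is a unit of V, so the
    matrix at w = 0 is invertible over V and not only over L. *)
Lemma Lam_basis : exists C : 'M[S']_n, (forall a, Lam (fun i => C a i)) /\
  exists2 D : 'M[V]_n, D \in unitmx & map_mx iV D = map_mx (@s0 L) C.
Proof.
pose W := Vandermonde n (\row_i y i).
have W0 := det_Vandermonde_neq0 yI; have [m hm _] := series_neq0 W0.
have [|c [C [LC eC C0]]] := Lam_reduce _ hm.
  by move=> a; apply: Lam_eq (LamXn a) => i; rewrite !mxE.
exists C; split=> //.
have ex a i : exists v, iV v = s0 (C a i) by apply: (Lam_integral i (LC a)).
pose D := \matrix_(a, i) projT1 (boolp.cid (ex a i)).
have eD : map_mx iV D = map_mx (@s0 L) C.
  by apply/matrixP => a i; rewrite !mxE; case: boolp.cid.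
exists D => //; rewrite unitmxE -(unitrX_pos _ (isT : (0 < 2)%N)).
have [b] : pm_eq (sX L (c * 2) * \det C ^+ 2) (f s).
  rewrite -sXX -exprMn -eC -/W; apply/pm_sym/(pm_trans es).
  by rewrite -deriv_map eP; apply: prod_deriv_Vandermonde.
have -> : (-1) ^+ b * f s = f ((-1) ^+ b * s) by rewrite rmorphM rmorph_sign.
set t := (-1) ^+ b * s => et.
have [t0 tu] : has_unit_order t c0.
  have [z0 zu] := os; rewrite /t; case: (b); rewrite ?mulN1r ?mul1r //; split.
    by move=> i /z0; rewrite coef_sN => ->; rewrite oppr0.
  by rewrite coef_sN unitrN.
have tE i : (sX L (c * 2) * \det C ^+ 2) i = iV (t i) by rewrite et.
(* Both sides of the identity have a definite w-order: 2c because det C does not vanish at w = 0,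
   and c0 because [t] has unit order. *)
have c2 : (c * 2)%N = c0.
  case: (ltngtP (c * 2)%N c0) => // h.
    have := tE (c * 2)%N; rewrite coef_sXM ltnn subnn t0 // rmorph0 => /eqP.
    by rewrite -/(s0 _) rmorphXn expf_eq0 (negbTE C0).
  have /eqP := tE c0; rewrite coef_sXM h eq_sym -(rmorph0 iV) => /eqP/(place_inj plV) tz.
  by rewrite tz unitr0 in tu.
suff -> : \det D ^+ 2 = t c0 by [].
apply: (place_inj plV); rewrite -tE c2 coef_sXM ltnn subnn.
by rewrite rmorphXn -det_map_mx eD det_map_mx -rmorphXn.
Qed.

(** Inverting the basis matrix at w = 0 gives the idempotent of the i-th component modulo w; then e
    -> 3e^2 - 2e^3 squares the error. *)
Lemma Lam_idempotent (i : 'I_n) m : exists e, Lam e /\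
  forall j t, (t < m.+1)%N -> e j t = ((i == j) && (t == 0%N))%:R.
Proof.
elim: m => [|m [e [Le he]]].
  have [C [LC [D uD eD]]] := Lam_basis.
  pose r := delta_mx 0 i *m invmx D : 'rV_n.
  have rD : r *m D = delta_mx 0 i by rewrite mulmxKV.
  exists (fun j => \sum_a f (ps (r 0 a)%:P) * C a j); split.
    by apply: Lam_sum => a; apply: LamM => //; apply: LamC.
  move=> j [|//] _; have := congr1 (fun w : 'rV_n => iV (w 0 j)) rD.
  rewrite !mxE rmorph_sum !eqxx andbT /= rmorph_nat eq_sym => <-.
  rewrite -/(s0 _) rmorph_sum; apply: eq_bigr => a _; rewrite !rmorphM; congr (_ * _).
    by rewrite /= /s0 /= coefC.
  by have := congr1 (fun M : 'M_n => M a j) eD; rewrite !mxE => ->.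
exists (fun j => f 3%:R * (e j * e j) + f (- 2%:R) * (e j * (e j * e j))); split.
  by apply: LamD; apply: LamM (LamC _) _; do 2?apply: LamM.
move=> j t tm; have [ij|ij] := eqVneq i j; last first.
  have [a ea] : exists a, e j = sX L m.+1 * a.
    by apply: sX_div => l hl; rewrite he // (negbTE ij).
  have -> : f 3%:R * (e j * e j) + f (- 2%:R) * (e j * (e j * e j)) =
     sX L m.+2 * (sX L m * (a * a * (f 3%:R + f (- 2%:R) * e j))).
    by rewrite [in RHS]mulrA -sXD addSnnS sXD ea; ring.
  by rewrite coef_sXM tm.
have [a ea] : exists a, e j - 1 = sX L m.+1 * a.
  apply: sX_div => l hl; rewrite coef_sB he // ij eqxx coef_s1.
  by case: l {hl} => //=; rewrite subrr.
have {}ea : e j = 1 + sX L m.+1 * a by rewrite -ea addrC subrK.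
have -> : f 3%:R * (e j * e j) + f (- 2%:R) * (e j * (e j * e j)) =
   1 + sX L m.+2 * (sX L m * (a * a * (- 3%:R - 2%:R * sX L m.+1 * a))).
  rewrite [in RHS]mulrA -sXD addSnnS sXD ea rmorphN !rmorph_nat; ring.
by rewrite coef_sD coef_sXM tm addr0 coef_s1.
Qed.

(* Purity of the branch locus for a cover of Spec V[[w]] that splits over
   L[[w]] and is etale over V((w)). *)
Lemma purity : exists z : 'I_n -> S, forall i, f (z i) = y i.
Proof.
have ex i t : exists v, iV v = y i t.
  have [e [Le he]] := Lam_idempotent i t.
  have Ly : Lam y by apply: Lam_eq (LamXn 1) => j; rewrite expr1.
  (* In the trace of y e only the i-th component contributes up to w^t, and traces have coefficients
     in V. *)
  have [u hu] := Lam_trace (LamM Ly Le).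
  exists (u t); rewrite -coef_map_series hu coef_s_sum (bigD1 i) // big1 => [|j ji].
    rewrite [LHS]addr0 coef_sM big_ord_recr /= subnn he // !eqxx mulr1 big1 ?add0r // => j _.
    by rewrite he ?ltnS ?leq_subr // subn_eq0 leqNgt ltn_ord andbF mulr0.
  rewrite coef_sM big1 // => l _.
  by rewrite he ?ltnS ?leq_subr // eq_sym (negbTE ji) mulr0.
exists (fun i => Series (fun t => projT1 (boolp.cid (ex i t)))) => i.
by apply/seriesP => t; rewrite coef_map_series /=; case: boolp.cid.
Qed.

End Purity.

(** * Uniqueness and existence of local factors *)

Section OrderedPolyCoef.
Variable V : idomainType.
Local Notation S := (series V).

Lemma has_unit_orderM (s t : S) c d : has_unit_order s c -> has_unit_order t d ->
  has_unit_order (s * t) (c + d).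
Proof.
move=> [s1 s2] [t1 t2].
have [s' es] := sX_div s1; have [t' et] := sX_div t1.
have -> : s * t = sX V (c + d) * (s' * t') by rewrite es et sXD; ring.
split=> [i hi|]; first by rewrite coef_sXM hi.
rewrite coef_sXM ltnn subnn coef_sM big_ord1 /=.
move: s2 t2; rewrite es et !coef_sXM !ltnn !subnn => s2 t2.
by rewrite unitrM s2.
Qed.

Lemma has_unit_order_factor (s : S) c : has_unit_order s c ->
  exists u w : S, s = sX V c * u /\ w * u = 1.
Proof.
move=> [s1 s2]; have [u es] := sX_div s1; move: s2; rewrite es coef_sXM ltnn subnn => uu.
by have [w hw] := series_unit uu; exists u, w; rewrite (mulrC w).
Qed.

Lemma has_unit_order_ssub N (hN : (0 < N)%N) (s : S) c : has_unit_order s c ->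
  has_unit_order (ssub hN s) (N * c).
Proof.
move=> [s1 s2]; split=> [i hi|]; rewrite coef_ssub.
  case: ifP => // /dvdnP[j ej]; rewrite ej mulnK // s1 //.
  by rewrite ej mulnC ltn_pmul2l in hi.
by rewrite dvdn_mulr // mulKn.
Qed.

Lemma has_unit_order_neq0 (s : S) c : has_unit_order s c -> s != 0.
Proof. by move=> [_ h]; apply: contraTneq h => ->; rewrite coef_s0 unitr0. Qed.

End OrderedPolyCoef.

(** * Uniqueness of lifted factorizations over a valuation ring *)

Section Nakayama.
Variables (V : idomainType) (L k : fieldType).
Variables (iV : {rmorphism V -> L}) (hV : {rmorphism V -> k}).
Hypothesis plV : is_place iV hV.
Local Notation S := (series V).
Variable pi : V.

(** Membership of x in m mu + pi V, with m the maximal ideal. If mu itself belongs to it, then pi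
    divides mu, as in Nakayama's lemma. *)
Definition nak mu x := exists a b, hV a = 0 /\ x = a * mu + b * pi.

Lemma nak0 mu : nak mu 0.
Proof. by exists 0, 0; rewrite rmorph0 !mul0r addr0. Qed.
Lemma nakD mu x y : nak mu x -> nak mu y -> nak mu (x + y).
Proof.
move=> [a [b [ha ->]]] [c [d [hc ->]]]; exists (a + c), (b + d).
by rewrite rmorphD ha hc addr0; split=> //; ring.
Qed.
Lemma nakM mu z x : nak mu x -> nak mu (z * x).
Proof.
move=> [a [b [ha ->]]]; exists (z * a), (z * b).
by rewrite rmorphM ha mulr0; split=> //; ring.
Qed.
Lemma nak_sum mu (I : Type) (r : seq I) (P : pred I) (F : I -> V) :
  (forall i, P i -> nak mu (F i)) -> nak mu (\sum_(i <- r | P i) F i).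
Proof.
move=> h; elim/big_rec: _ => [|i x Pi]; first exact: nak0.
by apply: nakD; apply: h.
Qed.

Definition naks mu (N : nat) (s : S) := forall t, (t < N)%N -> nak mu (s t).

Lemma naksM mu N z s : naks mu N s -> naks mu N (z * s).
Proof.
move=> h t ht; rewrite coef_sM; apply: nak_sum => j _; apply/nakM/h.
by rewrite (leq_ltn_trans (leq_subr _ _)).
Qed.

Lemma naks_sum mu N (I : Type) (r : seq I) (P : pred I) (F : I -> S) :
  (forall i, P i -> naks mu N (F i)) -> naks mu N (\sum_(i <- r | P i) F i).
Proof. by move=> h t ht; rewrite coef_s_sum; apply: nak_sum => i /h; apply. Qed.

Lemma naks_coefM mu N (X Y : {poly S}) : (forall l, naks mu N X`_l) ->
  forall l, naks mu N (Y * X)`_l.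
Proof. by move=> h l; rewrite coefM; apply: naks_sum => j _; apply: naksM. Qed.

Lemma naks_modp mu N (X Y g : {poly S}) : g \is monic -> (size Y < size g)%N ->
  (exists Z, X = Y + g * Z) ->
  (forall l, naks mu N X`_l) -> forall l, naks mu N Y`_l.
Proof.
move=> mg sY [Z eX] hX l.
have -> : Y = \sum_(i < size X) X`_i *: Pdiv.Ring.rmodp 'X^i g.
  transitivity (Pdiv.Ring.rmodp X g).
    rewrite eX mulrC addrC Pdiv.RingMonic.rmodp_addl_mul_small //.
  by rewrite -[X in LHS]coefK poly_def Pdiv.RingMonic.rmodp_sum //;
    apply: eq_bigr => i _; rewrite Pdiv.RingMonic.rmodpZ.
rewrite coef_sum; apply: naks_sum => i _; rewrite coefZ mulrC; apply: naksM; exact: hX.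
Qed.

Section OneSided.
Variables (g h gam eta al be xi : {poly S}) (s q : S) (c d r : nat) (mu : V).
Hypothesis mg : g \is monic.
Hypothesis sg : (size gam < size g)%N.
Hypothesis bez : al * g + be * h = s%:P.
Hypothesis os : has_unit_order s c.
Hypothesis oq : has_unit_order q d.
Hypothesis eqn : q%:P * (gam * h + g * eta) = gam * eta + (ps pi%:P)%:P * xi.
Hypothesis gm : forall l t, hV (gam`_l t) = 0.
Hypothesis em : forall l t, hV (eta`_l t) = 0.
Hypothesis gr : forall l t, (t < r)%N -> exists a, gam`_l t = a * mu.
Hypothesis er : forall l t, (t < r)%N -> exists a, eta`_l t = a * mu.
Hypothesis cr : (c + d <= r)%N.

(** Multiplying the equation by [be] and using Bezout gives s q gam congruent to be (gam eta + pi
    xi) modulo the monic g, and deg gam < deg g. Dividing by s q, a unit times w^(c+d), costs c + d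
    coefficients of precision. *)
Lemma nak_step l t : (t < r)%N -> nak mu (gam`_l t).
Proof.
pose E := gam * eta + (ps pi%:P)%:P * xi.
(* Since c + d <= r, in each product of coefficients of total index below r + c + d one of the two
   indices is below r. That factor is in V mu and the other one is in m, so the quadratic term pays
   for the lost precision. *)
have hE i : naks mu (r + (c + d)) E`_i.
  move=> j hj; rewrite /E coefD coef_sD; apply: nakD; last first.
    rewrite coefCM coef_sM; apply: nak_sum => -[[|l'] /= hl'] _; rewrite coefC /=.
      by exists 0, (xi`_i (j - 0)%N); rewrite rmorph0; split=> //; ring.
    by rewrite mul0r; apply: nak0.
  rewrite coefM coef_s_sum; apply: nak_sum => l' _; rewrite coef_sM; apply: nak_sum => a _.
  have [ar|ar] := ltnP a r.
    have [b ->] := gr l' ar; exists (b * eta`_(i - l') (j - a)%N), 0.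
    by rewrite rmorphM em mulr0; split=> //; ring.
  have : (j - a < r)%N.
    rewrite (leq_trans _ cr) // ltn_subLR; last by rewrite -ltnS.
    by rewrite (leq_trans hj) // leq_add2r.
  move/(er (i - l')) => [b ->]; exists (gam`_l' a * b), 0.
  by rewrite rmorphM gm mul0r; split=> //; ring.
have os' := has_unit_orderM os oq.
have [u [w [eu wu]]] := has_unit_order_factor os'.
have hk : forall i, naks mu (r + (c + d)) (((s * q)%:P * gam)`_i).
  apply: (@naks_modp mu _ (be * E) _ g mg).
  - by apply: leq_ltn_trans sg; rewrite mul_polyC size_scale_leq.
  - exists (q%:P * (be * eta - al * gam)).
    by rewrite /E -eqn polyCM -bez; ring.
  - exact: naks_coefM.
move=> tr; have : naks mu r (u * gam`_l).
  move=> j hj; have := hk l (c + d + j)%N; rewrite addnC ltn_add2r => /(_ hj).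
  by rewrite coefCM eu -mulrA coef_sXM ltnNge leq_addl /= addnK.
move/(naksM w); rewrite mulrA wu mul1r; exact.
Qed.

End OneSided.

(** Two factorizations that agree modulo m and have equal products modulo pi agree modulo pi, even
    though the factors are coprime only up to powers of w. [gam] and [eta] are the differences of
    the factors, up to the scaling by q. *)
Lemma hensel_unique (g h gam eta al be xi : {poly S}) (s q : S) (c d : nat) :
  g \is monic -> h \is monic -> (size gam < size g)%N -> (size eta < size h)%N ->
  al * g + be * h = s%:P -> has_unit_order s c -> has_unit_order q d ->
  q%:P * (gam * h + g * eta) = gam * eta + (ps pi%:P)%:P * xi ->
  (forall l t, hV (gam`_l t) = 0) -> (forall l t, hV (eta`_l t) = 0) ->
  forall l t, (exists v, gam`_l t = pi * v) /\ (exists v, eta`_l t = pi * v).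
Proof.
move=> mg mh sg sh bez os oq eqn gm em l t.
(* At least c + d for [nak_step], and beyond t so that the coefficient in question is covered. *)
pose r := maxn (c + d) t.+1; pose M := maxn (size gam) (size eta).
pose x (i : 'I_M * 'I_r * bool) : V :=
  let: (a, j, b) := i in if b then gam`_a j else eta`_a j.
(* [mu] is an error coefficient of largest value below w^r, or 0 if all of them vanish. *)
have [mu [hmu hx]] : exists mu, (mu = 0 \/ exists i, mu = x i) /\
    forall i, exists a, x i = a * mu.
  have [ex|ex] := boolp.pselect (exists i, iV (x i) != 0); last first.
    exists 0; split=> [|i]; first by left.
    exists 0; rewrite mulr0; apply: (place_inj plV); rewrite rmorph0; apply/eqP.
    by apply: boolp.contrapT => /negP hi; apply: ex; exists i.
  have [i0 [c' [_ hc']]] := place_max plV ex.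
  exists (x i0); split=> [|i]; first by right; exists i0.
  by exists (c' i); apply: (place_inj plV); rewrite hc' rmorphM.
have hgr a j : (j < r)%N -> exists b, gam`_a j = b * mu.
  move=> jr; have [ha|ha] := ltnP a M.
    by have := hx (Ordinal ha, Ordinal jr, true).
  exists 0; rewrite nth_default ?coef_s0 ?mul0r //.
  by rewrite (leq_trans _ ha) // leq_maxl.
have her a j : (j < r)%N -> exists b, eta`_a j = b * mu.
  move=> jr; have [ha|ha] := ltnP a M.
    by have := hx (Ordinal ha, Ordinal jr, false).
  exists 0; rewrite nth_default ?coef_s0 ?mul0r //.
  by rewrite (leq_trans _ ha) // leq_maxr.
have cr : (c + d <= r)%N by rewrite leq_maxl.
have ng : forall a j, (j < r)%N -> nak mu (gam`_a j).
  by move=> a j; apply: (nak_step mg sg bez os oq eqn).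
have ne : forall a j, (j < r)%N -> nak mu (eta`_a j).
  move=> a j; apply: (@nak_step h g eta gam be al xi s q c d r mu mh sh) => //.
    by rewrite addrC.
  by rewrite mulrC [eta * gam]mulrC -eqn mulrC; ring.
have [v ev] : exists v, mu = pi * v.
  case: hmu => [->|[[[a j] b] hab]]; first by exists 0; rewrite mulr0.
  have [a' [b' [ha' hb']]] : nak mu mu.
    by rewrite {2}hab; case: b {hab}; [apply: ng | apply: ne]; apply: ltn_ord.
  (* Nakayama: mu = a' mu + b' pi with a' in m. *)
  have u1 : 1 - a' \is a GRing.unit.
    by apply: (place_unit plV); rewrite rmorphB rmorph1 ha' subr0 oner_neq0.
  exists (b' / (1 - a')); apply: (mulIr u1); rewrite -mulrA mulrVK //.
  by rewrite mulrBr mulr1 {1}hb'; ring.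
have tr : (t < r)%N by rewrite leq_max ltnSn orbT.
have [a ea] := hgr l t tr; have [b eb] := her l t tr.
by split; [exists (v * a) | exists (v * b)]; rewrite ?ea ?eb ev; ring.
Qed.
End Nakayama.

Lemma prod_XsubC_factor (R : idomainType) (I : finType) (F : I -> R) (p q : {poly R}) :
  p \is monic -> p * q = \prod_i ('X - (F i)%:P) ->
  exists A : {set I}, p = \prod_(i in A) ('X - (F i)%:P) /\
    q = \prod_(i | i \notin A) ('X - (F i)%:P).
Proof.
move=> mp e; have : p %| \prod_(i <- index_enum I) ('X - (F i)%:P) by rewrite -e dvdp_mulIl.
case/dvdp_prod_XsubC => m; rewrite eqp_monic ?monic_prod_XsubC // => /eqP ep.
pose A := [set i in mask m (index_enum I)].
have ep' : p = \prod_(i in A) ('X - (F i)%:P).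
  rewrite ep [in LHS]mask_filter ?index_enum_uniq // big_filter.
  by apply: eq_bigl => i; rewrite inE.
exists A; split=> //; apply: (mulfI (monic_neq0 mp)); rewrite e [in RHS]ep'.
by rewrite (bigID (mem A)).
Qed.

(** * Existence of local factors after ramification *)

Section LocalFactor.
Variables (V : idomainType) (L : closedFieldType) (k : fieldType).
Variables (iV : {rmorphism V -> L}) (hV : {rmorphism V -> k}).
Hypothesis plV : is_place iV hV.
Local Notation S := (series V).

(** After ramification P splits over L[[w]]; by purity its roots lie in V[[w]]. The factor [gb] of
    the reduction then selects a subset of the roots, whose product is g. *)
Lemma local_factor (P : {poly S}) n c (gb hb : {poly series k}) :
  P \is monic -> size P = n.+1 -> (1 < n)%N -> tame L n ->
  has_unit_order (resultant P P^`()) c -> gb \is monic ->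
  map_poly (map_series hV) P = gb * hb ->
  exists N (hN : (0 < N)%N) (g h al be : {poly S}) (s : S) (c' : nat),
    [/\ g \is monic, h \is monic & map_poly (ssub hN) P = g * h] /\
    [/\ map_poly (map_series hV) g = map_poly (ssub hN) gb,
        map_poly (map_series hV) h = map_poly (ssub hN) hb,
        al * g + be * h = s%:P & has_unit_order s c'].
Proof.
move=> mP sP n1 tn oR mgb eP.
have fI := map_series_inj (place_inj plV).
have sz (R R' : nzRingType) (f : {rmorphism R -> R'}) (Q : {poly R}) :
    Q \is monic -> size (map_poly f Q) = size Q.
  by move=> mQ; rewrite size_map_poly_id0 // (monicP mQ) rmorph1 oner_neq0.
have [||N [hN [ys [_ ePL]]]] := @puiseux L n (map_poly (map_series iV) P) _ _ tn.
- by rewrite monic_map.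
- by rewrite sz.
exists N, hN; set P1 := map_poly (ssub hN) P.
have mP1 : P1 \is monic by rewrite monic_map.
have sP1 : size P1 = n.+1 by rewrite sz.
have eP1 : map_poly (map_series iV) P1 = \prod_(y <- ys) ('X - y%:P).
  rewrite -ePL -!map_poly_comp; apply: eq_map_poly => a /=.
  exact: map_ssub.
have sys : size ys = n.
  by apply/eqP; rewrite -eqSS -(size_prod_XsubC ys id) /= -eP1 sz ?sP1.
pose y (i : 'I_n) := nth 0 ys i.
have {}eP1 : map_poly (map_series iV) P1 = \prod_(i < n) ('X - (y i)%:P).
  by rewrite eP1 (big_nth 0) big_mkord sys.
have nL : n%:R != 0 :> L by apply: tn; rewrite leqnn ltnW.
have nV : n%:R != 0 :> V.
  by apply: contraNneq nL => e; rewrite -(rmorph_nat iV) e rmorph0.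
have nS : n%:R != 0 :> S.
  rewrite -(rmorph_nat (@ps V)) -(rmorph_nat (@polyC V)).
  by rewrite -(rmorph0 (@ps V)) (inj_eq (@ps_inj V)) polyC_eq0.
have ldP (Q : {poly S}) : Q \is monic -> size Q = n.+1 ->
    lead_coef Q^`() = n%:R /\ size Q^`() = n.
  move=> mQ sQ; have cn : Q^`()`_n.-1 = n%:R.
    rewrite coef_deriv prednK; last by rewrite ltnW.
    by move/monicP: mQ; rewrite lead_coefE sQ => ->.
  have sQ' : size Q^`() = n.
    apply/eqP; rewrite eqn_leq -ltnS -sQ lt_size_deriv ?monic_neq0 //=.
    rewrite leqNgt; apply/negP => h; have := cn; rewrite nth_default.
      by move/esym/eqP; rewrite (negbTE nS).
    by rewrite -ltnS (ltn_predK n1).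
  by rewrite lead_coefE sQ' cn.
set s := resultant P1 P1^`().
have es : s = ssub hN (resultant P P^`()).
  rewrite /s /P1 deriv_map -map_resultant_gen //.
    by rewrite (monicP mP) rmorph1 oner_neq0.
  by rewrite (ldP P mP sP).1 rmorph_nat.
have os : has_unit_order s (N * c) by rewrite es; apply: has_unit_order_ssub.
have [uv _ euv] : {uv : {poly S} * {poly S} | (size uv.1 < size P1^`())%N /\
    (size uv.2 < size P1)%N & s%:P = uv.1 * P1 + uv.2 * P1^`()}.
  by apply: resultant_in_ideal; rewrite ?(ldP P1 mP1 sP1).2 ?sP1 // ltnW.
have yI : injective y.
  move=> i j eij; apply/eqP; apply: boolp.contrapT => /negP nij.
  have /eqP := has_unit_order_neq0 os; apply; apply: fI; rewrite rmorph0.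
  have := congr1 (fun Q => (map_poly (map_series iV) Q).[y i]) euv.
  rewrite map_polyC hornerC rmorphD !rmorphM hornerD !hornerM /= eP1 horner_prod_root.
  rewrite -deriv_map eP1 deriv_prod_root (bigD1 j) 1?eq_sym //= eij subrr.
  by rewrite !(mul0r, mulr0) addr0.
have eres : pm_eq (map_series iV s) (\prod_(i < n) (map_poly (map_series iV) P1^`()).[y i]).
  rewrite /s map_resultant_gen.
  - by rewrite eP1; apply: resultant_prod.
  - by rewrite (monicP mP1) rmorph1 oner_neq0.
  - by rewrite (ldP P1 mP1 sP1).1 -(rmorph0 (map_series iV)) (inj_eq fI).
have [z ez] := purity plV yI mP1 eP1 os eres.
have eP1z : P1 = \prod_(i < n) ('X - (z i)%:P).
  apply: (map_inj_poly fI); rewrite ?rmorph0 // eP1 rmorph_prod.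
  by apply: eq_bigr => i _; rewrite rmorphB /= map_polyX map_polyC /= ez.
have eP1k : map_poly (ssub hN) gb * map_poly (ssub hN) hb =
    \prod_(i < n) ('X - (map_series hV (z i))%:P).
  rewrite -rmorphM -eP.
  transitivity (map_poly (map_series hV) P1).
    rewrite /P1 /= -!map_poly_comp; apply: eq_map_poly => a /=.
    by rewrite map_ssub.
  rewrite eP1z rmorph_prod; apply: eq_bigr => i _.
  by rewrite rmorphB /= map_polyX map_polyC.
have [|A [eg eh]] := prod_XsubC_factor _ eP1k; first by rewrite monic_map.
pose g := \prod_(i in A) ('X - (z i)%:P); pose h := \prod_(i | i \notin A) ('X - (z i)%:P).
have eP1gh : P1 = g * h by rewrite eP1z (bigID (mem A)).
(* With P = g h, the relation u P + v P' = s rewrites as (u h + v h') g + (v g') h = s. *)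
exists g, h, (uv.1 * h + uv.2 * h^`()), (uv.2 * g^`()), s, (N * c)%N.
split; split=> //; try exact: monic_prod_XsubC.
- by rewrite eg rmorph_prod; apply: eq_bigr => i _; rewrite rmorphB /= map_polyX map_polyC.
- by rewrite eh rmorph_prod; apply: eq_bigr => i _; rewrite rmorphB /= map_polyX map_polyC.
- by rewrite euv eP1gh derivM; ring.
Qed.

End LocalFactor.

(** * Extension of places *)

(* Rewriting with the generic [rmorphB] leaves a merely additive [map_poly f]
   behind, on which [rmorphM] does not fire. *)
Lemma map_polyB (R S : nzRingType) (f : {rmorphism R -> S}) (p q : {poly R}) :
  map_poly f (p - q) = map_poly f p - map_poly f q.
Proof. exact: rmorphB. Qed.

Lemma map_polyD (R S : nzRingType) (f : {rmorphism R -> S}) (p q : {poly R}) :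
  map_poly f (p + q) = map_poly f p + map_poly f q.
Proof. exact: rmorphD. Qed.

Lemma map_polyM (R S : nzRingType) (f : {rmorphism R -> S}) (p q : {poly R}) :
  map_poly f (p * q) = map_poly f p * map_poly f q.
Proof. exact: rmorphM. Qed.

Record subring_of (L : fieldType) := SubringOf {
  sr_mem : {pred L}; sr_closed : subring_closed sr_mem }.

Section SubringType.
Variables (L : fieldType) (S : subring_of L).

HB.instance Definition _ := GRing.isSubringClosed.Build L (sr_mem S) (sr_closed S).

Record sr_type := SRType { sr_val : L; _ : sr_val \in sr_mem S }.

HB.instance Definition _ := [isSub for sr_val].
HB.instance Definition _ := [Choice of sr_type by <:].
HB.instance Definition _ := [SubChoice_isSubComNzRing of sr_type by <:].

Definition sr_incl : sr_type -> L := sr_val.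
HB.instance Definition _ := GRing.RMorphism.copy sr_incl (val : sr_type -> L).

Lemma sr_incl_inj : injective sr_incl. Proof. exact: val_inj. Qed.

Definition sr_unit (x : sr_type) := (sr_val x != 0) && ((sr_val x)^-1 \in sr_mem S).
Definition sr_inv (x : sr_type) : sr_type :=
  if sr_val x != 0 then insubd x (sr_val x)^-1 else x.

Fact sr_mulVr : {in sr_unit, left_inverse 1 sr_inv *%R}.
Proof.
move=> x /andP[x0 xi]; apply: sr_incl_inj; rewrite rmorphM rmorph1 /=.
have -> : sr_incl (sr_inv x) = (sr_val x)^-1 by rewrite /sr_inv x0; apply: insubdK.
by rewrite mulVf.
Qed.
Fact sr_unitPl x y : y * x = 1 -> sr_unit x.
Proof.
move=> /(congr1 sr_incl); rewrite rmorphM rmorph1 /= => e.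
have x0 : sr_incl x != 0.
  by apply/eqP => x0; move/eqP: e; rewrite x0 mulr0 eq_sym oner_eq0.
rewrite /sr_unit x0 /= -[X in X \in _]mul1r -e mulfK //; exact: valP.
Qed.
Fact sr_inv_out : {in [predC sr_unit], sr_inv =1 id}.
Proof.
move=> x; rewrite inE negb_and negbK => h; rewrite /sr_inv.
case: eqP => //= x0; apply: val_inj; rewrite val_insubd.
by case/orP: h => [/eqP//|/negbTE ->].
Qed.
HB.instance Definition _ := GRing.ComNzRing_hasMulInverse.Build sr_type
  sr_mulVr sr_unitPl sr_inv_out.

Fact sr_mulf_eq0 (x y : sr_type) : x * y = 0 -> (x == 0) || (y == 0).
Proof.
move=> /(congr1 sr_incl); rewrite rmorphM rmorph0 /= => /eqP.
by rewrite mulf_eq0 -!(rmorph0 sr_incl) !(inj_eq sr_incl_inj).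
Qed.
HB.instance Definition _ := GRing.ComUnitRing_isIntegral.Build sr_type sr_mulf_eq0.

End SubringType.

Section PartialHom.
Variables (L : fieldType) (k : fieldType) (G : L -> k -> Prop).

(** A ring morphism from a subring of L to k, given by its graph: extension becomes inclusion, and
    the union of a chain is an upper bound for Zorn's lemma. *)
Record partial_hom : Prop := PartialHom {
  ph_fun : forall x c d, G x c -> G x d -> c = d;
  ph_one : G 1 1;
  ph_sub : forall x y c d, G x c -> G y d -> G (x - y) (c - d);
  ph_mul : forall x y c d, G x c -> G y d -> G (x * y) (c * d) }.

Hypothesis hG : partial_hom.

Definition ph_dom : {pred L} := fun x => boolp.asbool (exists c, G x c).
Fact ph_closed : subring_closed ph_dom.
Proof.
split; first by apply/boolp.asboolP; exists 1; apply: (ph_one hG).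
- move=> x y /boolp.asboolP[c xc] /boolp.asboolP[d yd].
  by apply/boolp.asboolP; exists (c - d); apply: (ph_sub hG).
- move=> x y /boolp.asboolP[c xc] /boolp.asboolP[d yd].
  by apply/boolp.asboolP; exists (c * d); apply: (ph_mul hG).
Qed.
Definition ph_ring := SubringOf ph_closed.

Lemma ph_ex (v : sr_type ph_ring) : exists c, G (sr_incl v) c.
Proof. by case: v => x /= h; apply/boolp.asboolP. Qed.
Definition ph_map (v : sr_type ph_ring) : k := projT1 (boolp.cid (ph_ex v)).
Lemma ph_mapP v : G (sr_incl v) (ph_map v).
Proof. by rewrite /ph_map; case: boolp.cid. Qed.

Lemma ph_mapE v c : G (sr_incl v) c -> ph_map v = c.
Proof. exact/(ph_fun hG)/ph_mapP. Qed.

Lemma partial_hom_type : exists (V : idomainType) (i : {rmorphism V -> L})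
    (h : {rmorphism V -> k}), injective i /\
  (forall x c, G x c <-> exists v, i v = x /\ h v = c).
Proof.
have hB : zmod_morphism ph_map.
  by move=> v w; apply: ph_mapE; rewrite rmorphB; apply: (ph_sub hG); apply: ph_mapP.
have hM : monoid_morphism ph_map.
  split; first by apply: ph_mapE; rewrite rmorph1; apply: (ph_one hG).
  by move=> v w; apply: ph_mapE; rewrite rmorphM; apply: (ph_mul hG); apply: ph_mapP.
pose hA := GRing.isZmodMorphism.Build _ _ ph_map hB.
pose hA2 := GRing.isMonoidMorphism.Build _ _ ph_map hM.
pose h : {rmorphism sr_type ph_ring -> k} := HB.pack ph_map hA hA2.
exists (sr_type ph_ring), (@sr_incl L ph_ring), h; split; first exact: sr_incl_inj.
move=> x c; split=> [xc|[v [<- <-]]]; last exact: ph_mapP.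
have xd : x \in sr_mem ph_ring by apply/boolp.asboolP; exists c.
by exists (SRType xd); split=> //; apply: ph_mapE.
Qed.

End PartialHom.

(** * Chevalley's extension theorem with values in an algebraically closed field *)

Section PlaceExtension.
Variables (A : comNzRingType) (L : fieldType) (k : closedFieldType).
Variables (i : {rmorphism A -> L}) (phi : {rmorphism A -> k}).
Hypothesis iI : injective i.

Definition extends (G : L -> k -> Prop) := forall a, G (i a) (phi a).

Lemma maximal_partial_hom : exists G : L -> k -> Prop, [/\ partial_hom G, extends G &
  forall G' : L -> k -> Prop, partial_hom G' -> (forall x c, G x c -> G' x c) ->
    forall x c, G' x c -> G x c].
Proof.
pose T := {G : L -> k -> Prop | partial_hom G /\ extends G}.
pose R (s t : T) := boolp.asbool (forall x c, sval s x c -> sval t x c).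
have h0 : partial_hom (fun x c => exists a, x = i a /\ c = phi a).
  split.
  - by move=> x c d [a [-> ->]] [b [/iI -> ->]].
  - by exists 1; rewrite !rmorph1.
  - by move=> x y c d [a [-> ->]] [b [-> ->]]; exists (a - b); rewrite !rmorphB.
  - by move=> x y c d [a [-> ->]] [b [-> ->]]; exists (a * b); rewrite !rmorphM.
have e0 : extends (fun x c => exists a, x = i a /\ c = phi a) by move=> a; exists a.
pose t0 : T := exist _ _ (conj h0 e0).
have [|r s t|C hC|t ht] := @classical_sets.ZL_preorder T t0 R.
- by move=> t; apply/boolp.asboolP.
- by move=> /boolp.asboolP rs /boolp.asboolP st; apply/boolp.asboolP => x c /rs /st.
- have [[s0 Cs0]|nC] := boolp.pselect (exists s, C s); last first.
    by exists t0 => s Cs; case: nC; exists s.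
  pose G x c := exists2 s, C s & sval s x c.
  have two x c y d : G x c -> G y d -> exists2 s, C s & sval s x c /\ sval s y d.
    move=> [s Cs xs] [t Ct yt]; case: (hC _ _ Cs Ct) => /boolp.asboolP h.
      by exists t => //; split=> //; apply: h.
    by exists s => //; split=> //; apply: h.
  have hG : partial_hom G.
    split.
    - by move=> x c d xc xd; have [s _ [h1 h2]] := two _ _ _ _ xc xd;
        apply: (ph_fun (svalP s).1) h1 h2.
    - by exists s0 => //; apply: (ph_one (svalP s0).1).
    - move=> x y c d xc yd; have [s Cs [h1 h2]] := two _ _ _ _ xc yd.
      by exists s => //; apply: (ph_sub (svalP s).1).
    - move=> x y c d xc yd; have [s Cs [h1 h2]] := two _ _ _ _ xc yd.
      by exists s => //; apply: (ph_mul (svalP s).1).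
  have eG : extends G by move=> a; exists s0 => //; apply: (svalP s0).2.
  exists (exist _ G (conj hG eG)) => s Cs; apply/boolp.asboolP => x c xc /=.
  by exists s.
exists (sval t); split; [exact: (svalP t).1|exact: (svalP t).2|].
move=> G' hG' sG; have eG' : extends G' by move=> a; apply/sG/(svalP t).2.
have := ht (exist _ G' (conj hG' eG')); rewrite /R /= => h.
have /h/boolp.asboolP // : boolp.asbool (forall x c, sval t x c -> G' x c).
exact/boolp.asboolP.
Qed.

Section Maximal.
Variables (V : idomainType) (iV : {rmorphism V -> L}) (hV : {rmorphism V -> k}).
Hypothesis iVI : injective iV.
Hypothesis maxV : forall G' : L -> k -> Prop, partial_hom G' ->
  (forall v, G' (iV v) (hV v)) -> forall x c, G' x c -> exists v, iV v = x /\ hV v = c.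

(** The morphism extends to all fractions a / b with hV b nonzero; by maximality these already lie
    in V. *)
Lemma maximal_unit v : hV v != 0 -> v \is a GRing.unit.
Proof.
move=> v0; have nz b : hV b != 0 -> iV b != 0.
  by apply: contraNneq => e; rewrite (iVI (etrans e (esym (rmorph0 iV)))) rmorph0.
pose G x c := exists a b, [/\ hV b != 0, x = iV a / iV b & c = hV a / hV b].
have hG : partial_hom G.
  split.
  - move=> x c d [a [b [b0 ex ->]]] [a' [b' [b0' ex' ->]]].
    have /eqP : iV a / iV b = iV a' / iV b' by rewrite -ex.
    rewrite eqr_div ?nz // -!rmorphM => /eqP/iVI e.
    by apply/eqP; rewrite eqr_div // -!rmorphM e.
  - by exists 1, 1; rewrite !rmorph1 oner_neq0 !divr1.
  - move=> x y c d [a [b [b0 -> ->]]] [a' [b' [b0' -> ->]]].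
    exists (a * b' - a' * b), (b * b'); rewrite !rmorphB !rmorphM mulf_neq0 //.
    by split=> //; rewrite -[- (_ / _)]mulNr addf_div ?nz // mulNr.
  - move=> x y c d [a [b [b0 -> ->]]] [a' [b' [b0' -> ->]]].
    exists (a * a'), (b * b'); rewrite !rmorphM mulf_neq0 //.
    by split=> //; rewrite mulf_div.
have sG w : G (iV w) (hV w) by exists w, 1; rewrite !rmorph1 oner_neq0 !divr1.
have xG : G (iV 1 / iV v) (hV 1 / hV v) by exists 1, v.
have [w [ew _]] := maxV hG sG xG.
apply/unitrPr; exists w; apply: iVI.
by rewrite rmorphM ew rmorph1 mulrC mulfVK ?nz.
Qed.

(** Otherwise the reductions of all polynomials vanishing at x have a common root [al] in k, and x
    -> al extends the morphism to V[x]. Taking [al] in the closed field k keeps the values in k. *)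
Lemma maximal_relation x : (forall v, iV v <> x) ->
  exists p : {poly V}, (map_poly iV p).[x] = 0 /\ map_poly hV p = 1.
Proof.
move=> xV; apply: boolp.contrapT => hn.
pose J (p : {poly V}) := (map_poly iV p).[x] = 0.
have [al hal] : exists al, forall p, J p -> root (map_poly hV p) al.
  have [ex|ex] := boolp.pselect (exists p, J p /\ map_poly hV p != 0); last first.
    exists 0 => p Jp; suff -> : map_poly hV p = 0 by rewrite root0.
    apply/eqP; apply: boolp.contrapT => /negP h; apply: ex; by exists p.
  pose Q d := boolp.asbool (exists p, [/\ J p, map_poly hV p != 0 & size (map_poly hV p) = d]).
  have exQ : exists d, Q d.
    case: ex => p [h1 h2]; exists (size (map_poly hV p)); apply/boolp.asboolP.
    by exists p.
  have [p [Jp p0 sp] mind] : exists2 p, [/\ J p, map_poly hV p != 0 &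
      size (map_poly hV p) = ex_minn exQ] &
      forall p', J p' -> map_poly hV p' != 0 -> (size (map_poly hV p) <= size (map_poly hV p'))%N.
    case: ex_minnP => d /boolp.asboolP[p [h1 h2 h3]] hd; exists p => // p' h1' h2'.
    by rewrite h3; apply: hd; apply/boolp.asboolP; exists p'.
  set q := map_poly hV p in p0 sp mind.
  have lq : hV p`_(size q).-1 != 0 by rewrite -coef_map -/q -lead_coefE lead_coef_eq0.
  have vu := maximal_unit lq; set v := p`_(size q).-1 in lq vu.
  have dvd : forall d p', J p' -> (size (map_poly hV p') <= d)%N -> q %| map_poly hV p'.
    elim=> [|d IH] p' Jp' sp'.
      by move: sp'; rewrite leqn0 size_poly_eq0 => /eqP ->; rewrite dvdp0.
    have [->|p'0] := eqVneq (map_poly hV p') 0; first by rewrite dvdp0.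
    have sqp := mind _ Jp' p'0; set q' := map_poly hV p' in p'0 sp' sqp *.
    pose e := (size q' - size q)%N; pose v' := p'`_(size q').-1.
    (* Euclidean division by the reduction of least degree, carried out upstairs; its leading
       coefficient lifts to a unit of V. *)
    pose r := p' - (v' * v^-1)%:P * 'X^e * p.
    have Jr : J r.
      by rewrite /J /r map_polyB !map_polyM !hornerE Jp' Jp !mulr0 subrr.
    have er : map_poly hV r = q' - (hV v' / hV v)%:P * 'X^e * q.
      by rewrite /r map_polyB !map_polyM map_polyC map_polyXn /= rmorphM rmorphV.
    have sr : (size (map_poly hV r) <= d)%N.
      rewrite -ltnS (leq_trans _ sp') // er.
      have s1 : (0 < size q)%N by rewrite size_poly_gt0.
      have s2 : (0 < size q')%N by rewrite size_poly_gt0.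
      have hs : (size ((hV v' / hV v)%:P * 'X^e * q)%R <= size q')%N.
        rewrite -mulrA mul_polyC (leq_trans (size_scale_leq _ _)) //.
        rewrite (leq_trans (size_polyMleq _ _)) // size_polyXn addSn /=.
        by rewrite subnK.
      rewrite -(prednK s2) ltnS; apply/leq_sizeP => j hj.
      rewrite coefB; move: hj; rewrite leq_eqVlt => /orP[/eqP <-|hj]; last first.
        have hj' : (size q' <= j)%N by rewrite -(prednK s2).
        by rewrite !nth_default ?subrr // (leq_trans hs).
      rewrite -mulrA coefCM coefXnM.
      have -> : ((size q').-1 < e)%N = false.
        by apply/negbTE; rewrite -leqNgt -ltnS prednK // ltn_subrL s1 s2.
      have -> : ((size q').-1 - e = (size q).-1)%N.
        by rewrite /e -!subn1 subnAC subKn // .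
      by rewrite /q /q' !coef_map -/q -/q' -/v -/v' mulfVK // subrr.
    have -> : q' = map_poly hV r + (hV v' / hV v)%:P * 'X^e * q by rewrite er subrK.
    by rewrite dvdp_addl ?dvdp_mull // IH.
  have sq1 : size q != 1%N.
    apply/negP => /eqP sq; apply: hn; exists (v^-1%:P * p); split.
      by rewrite /J map_polyM hornerM Jp mulr0.
    rewrite map_polyM map_polyC /= -/q [q]size1_polyC ?sq // -polyCM.
    have -> : q`_0 = hV v by rewrite /v sq /q coef_map.
    by rewrite -rmorphM mulVr // rmorph1.
  have [al ral] := closed_rootP q sq1; exists al => p' Jp'.
  move: ral; rewrite -!dvdp_XsubCl => /dvdp_trans; apply.
  exact: (dvd _ _ Jp' (leqnn _)).
pose G y c := exists p, y = (map_poly iV p).[x] /\ c = (map_poly hV p).[al].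
have hG : partial_hom G.
  split.
  - move=> y c d [p [-> ->]] [q [e ->]]; apply/eqP; rewrite -subr_eq0 -hornerN -hornerD.
    by rewrite -map_polyB; apply: hal; rewrite /J map_polyB hornerD hornerN e subrr.
  - by exists 1; rewrite !rmorph1 !hornerC.
  - move=> y z c d [p [-> ->]] [q [-> ->]]; exists (p - q).
    by rewrite !map_polyB !hornerD !hornerN.
  - move=> y z c d [p [-> ->]] [q [-> ->]]; exists (p * q).
    by rewrite !map_polyM !hornerM.
have sG v : G (iV v) (hV v) by exists v%:P; rewrite !map_polyC !hornerC.
have xG : G x al by exists 'X; rewrite !map_polyX !hornerX.
have [v [ev _]] := maxV hG sG xG.
exact: xV ev.
Qed.

(** Of two relations congruent to 1, for x and for its inverse, the longer one can be shortened by
    the reciprocal of the other, until a constant relation gives a contradiction. *)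
Lemma no_two_relations d : forall x (p q : {poly V}), x != 0 ->
  (size p + size q <= d)%N -> (map_poly iV p).[x] = 0 -> (map_poly iV q).[x^-1] = 0 ->
  map_poly hV p = 1 -> map_poly hV q = 1 -> False.
Proof.
elim: d => [|d IH] x p q x0 s px qx p1 q1.
  move: s; rewrite leqn0 addn_eq0 size_poly_eq0 => /andP[/eqP p0 _].
  by move/eqP: p1; rewrite p0 rmorph0 eq_sym oner_eq0.
wlog sqp : x p q x0 s px qx p1 q1 / (size q <= size p)%N => [hw|].
  have [h|/ltnW h] := leqP (size q) (size p); first exact: (hw x p q).
  by apply: (hw x^-1 q p) => //; rewrite ?invr_neq0 ?invrK // addnC.
have coef1 (r : {poly V}) j : map_poly hV r = 1 -> hV r`_j = (j == 0%N)%:R.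
  by move=> e; rewrite -coef_map e coef1.
have sp0 : (0 < size p)%N.
  by rewrite size_poly_gt0; apply: contra_eq_neq p1 => ->; rewrite rmorph0 eq_sym oner_neq0.
have qu : q`_0 \is a GRing.unit by apply: maximal_unit; rewrite coef1 //= oner_neq0.
have [sp1|sp1] := eqVneq (size p) 1%N.
  have ep : p = (p`_0)%:P by rewrite -size1_polyC ?sp1.
  move: px; rewrite ep map_polyC hornerC => e.
  have := coef1 p 0%N p1; rewrite (iVI (etrans e (esym (rmorph0 iV)))) rmorph0 => /eqP.
  by rewrite eq_sym oner_eq0.
pose n := (size p).-1; have en : size p = n.+1 by rewrite prednK.
(* [Q] is X^n q(1/X), so it vanishes at x and its coefficient of X^n is the unit q(0). The
   multiplier [c] below is in the maximal ideal, so the reduction of p is unchanged. *)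
pose Q := \poly_(j < n.+1) q`_(n - j).
have Qx : (map_poly iV Q).[x] = 0.
  rewrite -[RHS](mulr0 (x ^+ n)) -qx.
  rewrite !(@horner_coef_wide _ n.+1) ?mulr_sumr; first last.
  - by rewrite (leq_trans (size_poly _ _)) // size_poly.
  - by rewrite (leq_trans (size_poly _ _)) // -en.
  rewrite (reindex_inj rev_ord_inj) /=; apply: eq_bigr => j _.
  have jn : (j <= n)%N by rewrite -ltnS.
  rewrite !coef_map coef_poly subSS ltnS leq_subr subKn //= mulrCA; congr (_ * _).
  by rewrite -[X in _ = x ^+ X * _](subnK jn) exprD -mulrA -exprMn mulfV // expr1n mulr1.
pose c := p`_n / q`_0; pose p' := p - c%:P * Q.
have p'x : (map_poly iV p').[x] = 0.
  by rewrite /p' map_polyB map_polyM hornerD hornerN hornerM px Qx mulr0 subrr.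
have n0 : (0 < n)%N by rewrite -ltnS -en ltn_neqAle eq_sym sp1.
have hc : hV c = 0 by rewrite rmorphM coef1 // (gtn_eqF n0) mul0r.
have p'1 : map_poly hV p' = 1.
  by rewrite /p' map_polyB map_polyM map_polyC /= hc mul0r subr0.
have sp' : (size p' < size p)%N.
  rewrite en ltnS; apply/leq_sizeP => j; rewrite leq_eqVlt => /orP[/eqP <-|hj].
    by rewrite coefB coefCM coef_poly ltnSn subnn /c mulrVK // subrr.
  by rewrite coefB coefCM !nth_default ?mulr0 ?subrr ?en // (leq_trans (size_poly _ _)).
apply: (IH x p' q) => //; rewrite -ltnS (leq_trans _ s) //.
by rewrite ltn_add2r.
Qed.

Lemma maximal_place : is_place iV hV.
Proof.
split=> // [v|x]; first exact: maximal_unit.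
have [|hx] := boolp.pselect (exists v, iV v = x); first by left.
right; have xV v : iV v <> x by move=> e; apply: hx; exists v.
have x0 : x != 0 by apply/eqP => e; apply: hx; exists 0; rewrite rmorph0.
have [[v ev]|hx'] := boolp.pselect (exists v, iV v = x^-1).
  exists v; last by rewrite ev mulVf.
  apply/eqP; apply: boolp.contrapT => /negP /maximal_unit vu.
  by apply: hx; exists v^-1; rewrite rmorphV // ev invrK.
have xV' v : iV v <> x^-1 by move=> e; apply: hx'; exists v.
have [p [px p1]] := maximal_relation xV; have [q [qx q1]] := maximal_relation xV'.
by case: (@no_two_relations _ x p q x0 (leqnn _) px qx p1 q1).
Qed.

End Maximal.

Lemma place_extension : exists (V : idomainType) (iV : {rmorphism V -> L})
    (hV : {rmorphism V -> k}), is_place iV hV /\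
  forall a, exists v, iV v = i a /\ hV v = phi a.
Proof.
have [G [hG eG maxG]] := maximal_partial_hom.
have [V [iV [hV [iVI GE]]]] := partial_hom_type hG.
exists V, iV, hV; split; last by move=> a; apply/GE/eG.
apply: maximal_place => // G' hG' sG' x c /(maxG _ hG') h; apply/GE/h.
by move=> y d /GE[v [<- <-]].
Qed.

End PlaceExtension.

(** * Ruppert's differential equation *)

Lemma size_det_leq (R : comNzRingType) d m (A : 'M[{poly R}]_d) :
  (forall i j, (size (A i j) <= m.+1)%N) -> (size (\det A) <= (d * m).+1)%N.
Proof.
move=> h; apply: leq_trans (size_sum _ _ _) _; apply/bigmax_leqP => s _.
rewrite mulr_sign (fun_if (fun p : {poly R} => size p)) size_polyN if_same.
apply: leq_trans (size_prod_leq _ _) _; rewrite cardT size_enum_ord.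
rewrite leq_subLR addnS ltnS -mulnS -[X in (_ <= X * _)%N]card_ord -sum_nat_const.
exact: leq_sum.
Qed.

(** The Sylvester matrix has at most n + (n - 1) rows, and its entries have T-degree at most m; this
    is the origin of (2n-1)m. *)
Lemma size_resultant_leq (R : comNzRingType) n m (F S : {poly {poly R}}) :
  (size F <= n.+1)%N -> (size S <= n)%N -> (forall i, (size (F`_i)%R <= m.+1)%N) ->
  (forall i, (size (S`_i)%R <= m.+1)%N) -> (size (resultant F S) <= ((2 * n - 1) * m).+1)%N.
Proof.
move=> sF sS hF hS; apply: leq_trans (@size_det_leq _ _ m _ _) _.
  move=> i j; rewrite Sylvester_mxE; case: split => k /=; rewrite mulrb; case: ifP => _;
    by rewrite ?size_poly0 ?hF ?hS.
rewrite ltnS leq_mul2r; apply/orP; right.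
have h1 : ((size F).-1 <= n)%N by rewrite -subn1 leq_subLR add1n.
have h2 : ((size S).-1 <= n.-1)%N by rewrite -!subn1 leq_sub2r.
apply: leq_trans (leq_add h2 h1) _; lia.
Qed.

Lemma coefM_top (R : nzRingType) (p q : {poly R}) a b :
  (size p <= a.+1)%N -> (size q <= b.+1)%N -> (p * q)`_(a + b) = p`_a * q`_b.
Proof.
move=> sp sq; have ha : (a < (a + b).+1)%N by rewrite ltnS leq_addr.
rewrite coefM (bigD1 (Ordinal ha)) //= addKn big1 ?addr0 // => j.
rewrite -val_eqE /= neq_ltn => /orP[h|h].
  by rewrite [q`_ _]nth_default ?mulr0 // (leq_trans sq) // ltn_subRL ltn_add2r.
by rewrite [p`_ _]nth_default ?mul0r // (leq_trans sp).
Qed.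

(** Subtracting a multiple of q makes the degrees a of r and b of q differ. The top coefficient of X
    r' q = X r q' then reads (a - b) lead(r) lead(q) = 0, with 0 < |a - b| <= D. *)
Lemma wronskian_eq0 (K : fieldType) (D : nat) (p q : {poly K}) :
  (forall i, (0 < i <= D)%N -> i%:R != 0 :> K) ->
  (size p <= D.+1)%N -> (size q <= D.+1)%N -> q != 0 ->
  p^`() * q = p * q^`() -> exists c, p = c *: q.
Proof.
move=> hD sp sq q0 e; pose b := (size q).-1; pose c := p`_b / lead_coef q.
exists c; apply/eqP; rewrite -subr_eq0; apply/negP => /negP r0.
set r := p - c *: q in r0.
have lq0 : lead_coef q != 0 by rewrite lead_coef_eq0.
have er : r^`() * q = r * q^`().
  by rewrite /r derivB derivZ !mulrBl e -!scalerAl [q^`() * q]mulrC.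
have rb : r`_b = 0 by rewrite coefB coefZ -/(lead_coef q) mulfVK // subrr.
pose a := (size r).-1.
have sr1 : size r = a.+1 by rewrite prednK // size_poly_gt0.
have sq1 : size q = b.+1 by rewrite prednK // size_poly_gt0.
have ab : a != b.
  apply: contraNneq r0 => eab; rewrite -lead_coef_eq0 lead_coefE -/a eab rb.
  exact: eqxx.
have sr : (size r <= D.+1)%N.
  rewrite (leq_trans (size_polyD _ _)) // geq_max sp size_polyN.
  by rewrite (leq_trans (size_scale_leq _ _)).
have coefXd (f : {poly K}) i : ('X * f^`())`_i = f`_i *+ i.
  by rewrite coefXM; case: i => [|i]; rewrite ?mulr0n ?coef_deriv.
have sXd (f : {poly K}) i : size f = i.+1 -> (size ('X * f^`())%R <= i.+1)%N.
  move=> sf; apply/leq_sizeP => j hj; rewrite coefXd nth_default ?mul0rn //.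
  by rewrite sf.
have := congr1 (fun f : {poly K} => ('X * f)`_(a + b)) er.
rewrite mulrA mulrCA !coefM_top ?sr1 ?sq1 ?sXd // !coefXd.
have la : r`_a != 0 by rewrite -[a]/(size r).-1 -lead_coefE lead_coef_eq0.
rewrite mulrnAl mulrnAr => /eqP; rewrite -subr_eq0.
have lb : q`_b != 0 by rewrite -lead_coefE.
have [ha hb] : (a <= D)%N /\ (b <= D)%N by split; rewrite -ltnS -?sr1 -?sq1.
move: ab; rewrite neq_ltn => /orP[h|h].
  rewrite -opprB oppr_eq0 -mulrnBr ?(ltnW h) // -mulr_natr !mulf_eq0.
  rewrite (negbTE la) (negbTE lb) /=; apply/negP/hD.
  by rewrite subn_gt0 h (leq_trans (leq_subr _ _)).
rewrite -mulrnBr ?(ltnW h) // -mulr_natr !mulf_eq0.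
rewrite (negbTE la) (negbTE lb) /=; apply/negP/hD.
by rewrite subn_gt0 h (leq_trans (leq_subr _ _)).
Qed.

(* Gauss's lemma, removing the roots of [c] one at a time. *)
Lemma gauss_monic (L : closedFieldType) (F q g : {poly {poly L}}) (c : {poly L}) :
  c != 0 -> c *: F = q * g -> exists q' g',
  [/\ F = q' * g', size q' = size q & size g' = size g].
Proof.
have [d] := ubnP (size c); elim: d c q g => // d IH c q g sc c0 e.
have [c1|c1] := eqVneq (size c) 1%N.
  have cc : c = (c`_0)%:P by rewrite -size1_polyC ?c1.
  have c00 : c`_0 != 0 by apply: contraNneq c0; rewrite cc coefC /= => ->.
  exists ((c`_0)^-1%:P *: q), g; split=> //.
    rewrite -scalerAl -e scalerA cc coefC /= -polyCM mulVf // scale1r //.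
  by rewrite size_scale // polyC_eq0 invr_eq0.
have [al ral] := closed_rootP c c1; case/factor_theorem: ral => c' ec.
have c'0 : c' != 0 by apply: contraNneq c0; rewrite ec => ->; rewrite mul0r.
have X0 : 'X - al%:P != 0 :> {poly L} by rewrite polyXsubC_eq0.
have SI : injective ( *:%R ('X - al%:P) : {poly {poly L}} -> {poly {poly L}}).
  by move=> f1 f2; rewrite -!mul_polyC; apply: mulfI; rewrite polyC_eq0.
have sc' : (size c' < d)%N by move: sc; rewrite ec size_Mmonic ?monicXsubC // size_XsubC addn2.
have dv (f : {poly {poly L}}) : map_poly (horner_eval al) f = 0 ->
    exists f1, f = ('X - al%:P) *: f1.
  move=> f0; have ex i : exists h, f`_i = ('X - al%:P) * h.
    have : root f`_i al by rewrite /root -/(horner_eval al _) -coef_map f0 coef0.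
    by case/factor_theorem => h ->; exists h; rewrite mulrC.
  exists (\poly_(i < size f) projT1 (boolp.cid (ex i))); apply/polyP => i.
  rewrite coefZ coef_poly; case: ltnP => hi; last by rewrite nth_default ?mulr0.
  by case: boolp.cid.
have : map_poly (horner_eval al) q * map_poly (horner_eval al) g = 0.
  rewrite -rmorphM -e; apply/polyP => i; rewrite coef_map coefZ coef0 /= ec.
  by rewrite /horner_eval !hornerM hornerXsubC subrr mulr0 mul0r.
move/eqP; rewrite mulf_eq0 => /orP[/eqP/dv[f ef]|/eqP/dv[f ef]].
  have [|q' [g' [eF s1 s2]]] := IH c' f g sc' c'0.
    by apply: SI; rewrite scalerA mulrC -ec e ef -scalerAl.
  by exists q', g'; rewrite -eF s1 s2 ef size_scale.
have [|q' [g' [eF s1 s2]]] := IH c' q f sc' c'0.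
  by apply: SI; rewrite scalerA mulrC -ec e ef -scalerAr.
by exists q', g'; rewrite -eF s1 s2 ef size_scale.
Qed.

Definition derivT (R : nzRingType) (F : {poly {poly R}}) : {poly {poly R}} :=
  map_poly (@deriv R) F.

Lemma coef_derivT (R : nzRingType) (F : {poly {poly R}}) i :
  (derivT F)`_i = (F`_i)^`().
Proof. by rewrite coef_map_id0 ?deriv0. Qed.

Section RootDerivation.
Variables (L : idomainType) (e : {rmorphism {poly L} -> series L}) (kap : series L).
Hypothesis eD : forall p, sderiv (e p) = kap * e p^`().
Local Notation ev G z := (map_poly e G).[z].

Lemma sderiv_horner (G : {poly {poly L}}) z :
  sderiv (ev G z) = kap * ev (derivT G) z + sderiv z * ev G^`() z.
Proof.
elim/poly_ind: G => [|G c IH].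
  have d0 : derivT (0 : {poly {poly L}}) = 0 by apply/polyP => i; rewrite coef_derivT !coef0 deriv0.
  by rewrite d0 deriv0 !rmorph0 !horner0 raddf0 !mulr0 addr0.
have dT : derivT (G * 'X + c%:P) = derivT G * 'X + (c^`())%:P.
  apply/polyP => i; rewrite coef_derivT !coefD derivD !coefMX !coefC.
  by case: i => [|i]; rewrite /= ?deriv0 ?coef_derivT.
rewrite dT derivMXaddC !map_polyD !map_polyM !map_polyX !map_polyC /= !hornerE /=.
by rewrite raddfD /= sderivM IH eD; ring.
Qed.

(** The equation says that the form (Q / F) dY + (H / F) dT is closed; its residue along the branch
    Y = z is Q / F_Y, which is therefore constant, and so is S / F_Y. *)
Lemma rigid_at_root (F Q H : {poly {poly L}}) (lam : L) z :
  ev F z = 0 -> ev F^`() z != 0 ->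
  F * derivT Q - Q * derivT F - F * H^`() + H * F^`() = 0 ->
  forall S, S = Q - lam%:P%:P * F^`() ->
  sderiv (ev S z) * ev F^`() z = ev S z * sderiv (ev F^`() z).
Proof.
move=> F0 b0 eQH S defS.
have dTM (G1 : {poly {poly L}}) : (derivT G1)^`() = derivT G1^`().
  by apply/polyP => i; rewrite coef_derivT !coef_deriv coef_derivT derivMn.
have e1 := congr1 (fun G => ev G z) eQH.
have e2 := congr1 (fun G => ev G^`() z) eQH.
move: e1 e2; rewrite !derivD !derivN !derivM !dTM // !map_polyD !rmorphN /= !map_polyM.
rewrite !map_polyD !map_polyM deriv0 rmorph0 horner0 !hornerE F0 => e1 e2.
have := sderiv_horner F z; rewrite F0 raddf0 => e3.
have eS : ev S z = ev Q z - e lam%:P * ev F^`() z.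
  by rewrite defS map_polyB map_polyM map_polyC hornerD hornerN hornerM hornerC.
have dl : sderiv (e lam%:P) = 0 by rewrite eD derivC rmorph0 mulr0.
rewrite eS raddfB /= sderivM dl mul0r add0r !sderiv_horner.
apply: (mulIf b0).
move: e1 e2 e3.
set b := ev F^`() z; set q := ev Q z; set fT := ev (derivT F) z; set h := ev H z.
set fTY := ev (derivT F^`()) z; set fYY := ev F^`()^`() z; set qT := ev (derivT Q) z.
set qY := ev Q^`() z; set hY := ev H^`() z; move=> e1 e2 e3.
have {}e1 : q * fT - h * b = 0 by rewrite -[RHS]oppr0 -e1; ring.
have {}e2 : b * qT - (qY * fT + q * fTY) + h * fYY = 0 by rewrite -[RHS]e2 /=; ring.
have {}e3 : kap * fT + sderiv z * b = 0 by rewrite -e3.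
apply/eqP; rewrite -subr_eq0; apply/eqP.
(* The goal is a combination of the Y-derivative of the equation, the equation itself, and the
   derivative of F(z) = 0 along the branch. *)
transitivity (kap * b * (b * qT - (qY * fT + q * fTY) + h * fYY) +
  kap * fYY * (q * fT - h * b) + (kap * fT + sderiv z * b) * (qY * b - q * fYY)); first by ring.
by rewrite e1 e2 e3 !mulr0 mul0r !addr0.
Qed.

(** If each a_i / b_i is constant, so is the quotient of the products. *)
Lemma rigid_prod (I : finType) (a b : I -> series L) :
  (forall i, sderiv (a i) * b i = a i * sderiv (b i)) ->
  sderiv (\prod_i a i) * (\prod_i b i) = (\prod_i a i) * sderiv (\prod_i b i).
Proof.
move=> h; elim: (index_enum I) => [|i r IH].
  by rewrite !big_nil mulr1 mul1r.
rewrite !big_cons !sderivM.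
transitivity ((sderiv (a i) * b i) * (\prod_(j <- r) a j * \prod_(j <- r) b j) +
  a i * b i * (sderiv (\prod_(j <- r) a j) * \prod_(j <- r) b j)); first by ring.
by rewrite h IH; ring.
Qed.
Lemma pm_rigid (x d A B : series L) : pm_eq x A -> pm_eq d B ->
  sderiv A * B = A * sderiv B -> sderiv x * d = x * sderiv d.
Proof.
move=> [b ->] [c ->] h; rewrite !mulr_sign.
by case: b; case: c; rewrite ?raddfN ?mulrNN ?mulrN ?mulNr h.
Qed.
End RootDerivation.

(** * Solutions of Ruppert's equation for irreducible F *)

Section Ruppert.
Variables (L : closedFieldType) (F : {poly {poly L}}) (n m : nat).
Hypothesis mF : F \is monic.
Hypothesis sF : size F = n.+1.
Hypothesis n_gt0 : (0 < n)%N.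
Hypothesis m_gt0 : (0 < m)%N.
Hypothesis bF : forall i, (size (F`_i)%R <= m.+1)%N.
Hypothesis irrF : irreducible_elt F.
Hypothesis charL : forall i, (0 < i <= (2 * n - 1) * m)%N -> i%:R != 0 :> L.
Hypothesis D0 : resultant F F^`() != 0.

Variables (Q H : {poly {poly L}}).
Hypothesis sQ : (size Q <= n)%N.
Hypothesis sH : (size H <= n)%N.
Hypothesis bQ : forall i, (size (Q`_i)%R <= m.+1)%N.
Hypothesis eQH : F * derivT Q - Q * derivT F - F * H^`() + H * F^`() = 0.

Lemma ruppert_tame : tame L n.
Proof.
move=> i /andP[i0 i_n]; apply: charL; rewrite i0 (leq_trans i_n) //.
rewrite -[n in (n <= _)%N]muln1 leq_mul //; lia.
Qed.

Lemma deriv_bezout : exists u v, u * F + v * F^`() = (resultant F F^`())%:P.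
Proof.
(* In degree 1, F_Y is the constant 1 and the relation is immediate. *)
have [n1|n1] := leqP n 1.
  have en : n = 1%N by lia.
  have sF' : (size F^`() <= 1)%N.
    by rewrite -ltnS (leq_trans (lt_size_deriv (monic_neq0 mF))) // sF en.
  exists 0, (resultant F F^`())%:P; rewrite mul0r add0r [F^`()]size1_polyC //.
  rewrite coef_deriv; have -> : F`_1 = 1 by move/monicP: mF; rewrite lead_coefE sF en.
  by rewrite mulr1.
have nL : n%:R != 0 :> L by apply: ruppert_tame; rewrite n_gt0 leqnn.
have sF' : (1 < size F^`())%N.
  rewrite ltnNge; apply/negP => h; have : F^`()`_n.-1 = 0.
    by rewrite nth_default // (leq_trans h) // -ltnS prednK.
  rewrite coef_deriv prednK //.
  have -> : F`_n = 1 by move/monicP: mF; rewrite lead_coefE sF.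
  rewrite -(rmorph_nat (@polyC L)) => /eqP; by rewrite polyC_eq0 (negbTE nL).
have sF1 : (1 < size F)%N by rewrite sF.
have [uv _ ->] := resultant_in_ideal sF1 sF'.
by exists uv.1, uv.2.
Qed.

Lemma ruppert_root_rigid : exists (N : nat) (hN : (0 < N)%N) (y : 'I_n -> series L),
  [/\ N%:R != 0 :> L, injective y &
   map_poly (ssub hN \o @ps L) F = \prod_(i < n) ('X - (y i)%:P)].
Proof.
have [||N [hN [ys [N0 e]]]] := @puiseux L n (map_poly (@ps L) F) _ _ ruppert_tame.
- by rewrite monic_map.
- by rewrite size_map_poly_id0 // (monicP mF) rmorph1 oner_neq0.
have {}e : map_poly (ssub hN \o @ps L) F = \prod_(y <- ys) ('X - y%:P).
  by rewrite map_poly_comp.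
have sys : size ys = n.
  apply/eqP; rewrite -eqSS -(size_prod_XsubC ys id) /= -e -sF.
  by rewrite size_map_poly_id0 // (monicP mF) rmorph1 oner_neq0.
pose y (i : 'I_n) := nth 0 ys i.
have {}e : map_poly (ssub hN \o @ps L) F = \prod_(i < n) ('X - (y i)%:P).
  by rewrite e (big_nth 0) big_mkord sys.
exists N, hN, y; split=> // i j eij; apply/eqP; apply: boolp.contrapT => /negP nij.
have [u [v euv]] := deriv_bezout.
have := congr1 (fun G => (map_poly (ssub hN \o @ps L) G).[y i]) euv.
rewrite map_polyD !map_polyM hornerD !hornerM e horner_prod_root -deriv_map e.
rewrite deriv_prod_root (bigD1 j) 1?eq_sym //= eij subrr !(mul0r, mulr0) addr0.
rewrite map_polyC hornerC /= => /esym/eqP.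
by rewrite -(rmorph0 (ssub hN)) (inj_eq (@ssub_inj _ _ hN)) -(rmorph0 (@ps L)) (inj_eq (@ps_inj L)) (negbTE D0).
Qed.

(** N is, up to sign, the norm of S = Q - lam F_Y, that is the product of the values of S on the
    branches. As S / F_Y is constant on each branch, N and the discriminant have zero Wronskian. *)
Lemma ruppert_norm (lam : L) : exists N : {poly L},
  [/\ (size N <= ((2 * n - 1) * m).+1)%N,
      N^`() * resultant F F^`() = N * (resultant F F^`())^`(),
      N = 0 -> Q = lam%:P%:P * F^`() &
      forall a eta, (map_poly (horner_eval a) F).[eta] = 0 ->
        (map_poly (horner_eval a) (Q - lam%:P%:P * F^`())).[eta] = 0 -> N.[a] = 0].
Proof.
pose S := Q - lam%:P%:P * F^`().
have sS : (size S <= n)%N.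
  rewrite (leq_trans (size_polyD _ _)) // geq_max sQ size_polyN mul_polyC.
  by rewrite (leq_trans (size_scale_leq _ _)) // -ltnS -sF lt_size_deriv ?monic_neq0.
have bS i : (size (S`_i)%R <= m.+1)%N.
  rewrite coefB (leq_trans (size_polyD _ _)) // geq_max bQ size_polyN coefCM mul_polyC.
  rewrite (leq_trans (size_scale_leq _ _)) // coef_deriv -mulr_natr.
  by rewrite -(rmorph_nat (@polyC L)) mulrC mul_polyC (leq_trans (size_scale_leq _ _)) ?bF.
have [N0 [hN [y [N0L yI eF]]]] := ruppert_root_rigid.
pose kap : series L := ps ('X^N0)^`().
have kap0 : kap != 0.
  rewrite /kap -(rmorph0 (@ps L)) (inj_eq (@ps_inj L)) derivXn -mulr_natr.
  by rewrite -(rmorph_nat (@polyC L)) mulf_neq0 ?polyC_eq0 // monic_neq0 ?monicXn.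
have [e [{}eF eI eD]] : exists e : {rmorphism {poly L} -> series L},
    [/\ map_poly e F = \prod_(i < n) ('X - (y i)%:P), injective e &
        forall p, sderiv (e p) = kap * e p^`()].
  exists (GRing.RMorphism.clone _ _ (ssub hN \o @ps L) _); split=> //.
    by move=> p q h; apply/(@ps_inj L)/(@ssub_inj _ _ hN).
  by move=> p; rewrite /= !ssub_ps sderiv_ps deriv_comp mulrC rmorphM.
have F'0 i : (map_poly e F^`()).[y i] != 0.
  rewrite -deriv_map eF deriv_prod_root; apply/prodf_neq0 => j ji.
  by rewrite subr_eq0; apply: contraNneq ji => /yI ->.
have Fy i : (map_poly e F).[y i] = 0 by rewrite eF horner_prod_root.
have rig := rigid_prod (fun i => rigid_at_root eD (Fy i) (F'0 i) eQH (erefl S)).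
have lead G : (e (lead_coef G) != 0) = (G != 0).
  by rewrite -(rmorph0 e) (inj_eq eI) lead_coef_eq0.
have n1F' : F^`() != 0.
  apply: contraNneq (F'0 (Ordinal n_gt0)) => ->; by rewrite rmorph0 horner0.
have eDel : pm_eq (e (resultant F F^`())) (\prod_(i < n) (map_poly e F^`()).[y i]).
  by rewrite map_resultant_gen ?lead ?(monic_neq0 mF) // eF; apply: resultant_prod.
suff [N [sN eN Na]] : exists N : {poly L}, [/\ (size N <= ((2 * n - 1) * m).+1)%N,
    pm_eq (e N) (\prod_(i < n) (map_poly e S).[y i]) &
    forall a eta, (map_poly (horner_eval a) F).[eta] = 0 ->
        (map_poly (horner_eval a) S).[eta] = 0 -> N.[a] = 0].
  exists N; split=> //.
    apply: eI; apply: (mulfI kap0); rewrite !rmorphM /= mulrA -eD [in RHS]mulrCA -eD.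
    exact: pm_rigid eN eDel rig.
  move=> N0'; apply/eqP; rewrite -subr_eq0 -/S; apply/eqP.
  have [b eb] := eN; move: eb; rewrite N0' rmorph0 => /esym/eqP; rewrite mulr_sign.
  have -> : (if b then - \prod_(i < n) (map_poly e S).[y i] else \prod_(i < n) (map_poly e S).[y i]) == 0
     = (\prod_(i < n) (map_poly e S).[y i] == 0) by case: (b); rewrite ?oppr_eq0.
  case/prodf_eq0 => i _ /eqP Si; apply/eqP; apply: boolp.contrapT => /negP S0.
  (* A common root of F and S gives a nontrivial gcd of Y-degree below n; Gauss's lemma makes it a
     factor of F over L[T], against irreducibility. *)
  pose g := gcdp F S.
  have g0 : g != 0 by rewrite gcdp_eq0 negb_and S0 orbT.
  have [cFS|ncFS] := boolP (coprimep F S).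
    have [[u v] huv] := Pdiv.Idomain.Bezout_coprimepP _ _ cFS.
    move: huv; rewrite /= Pdiv.Idomain.eqp_sym => /Pdiv.Idomain.eqpP[[c1 c2] /= /andP[c10 c20]] huv.
    have := congr1 (fun G => (map_poly e G).[y i]) huv.
    rewrite -!mul_polyC mulr1 !map_polyM map_polyD !map_polyM !map_polyC /= hornerC.
    rewrite hornerM hornerD !hornerM Fy Si !mulr0 addr0 mulr0 => /eqP.
    by rewrite -(rmorph0 e) (inj_eq eI) (negbTE c10).
  have /Pdiv.Idomain.dvdpP[[c q] /= c0 ecq] : g %| F by exact: dvdp_gcdl.
  have [q' [g' [eFqg sq sg]]] := gauss_monic c0 ecq.
  have sg1 : (1 < size g)%N.
    move: ncFS; rewrite /coprimep -/g; move: g0; rewrite -size_poly_gt0.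
    by case: (size g) => [|[|]].
  have sgn : (size g <= n)%N by rewrite (leq_trans _ sS) // dvdp_leq // dvdp_gcdr.
  have q'0 : q' != 0 by apply: contraNneq (monic_neq0 mF); rewrite eFqg => ->; rewrite mul0r.
  have g'0 : g' != 0 by rewrite -size_poly_gt0 sg ltnW.
  have sqg : (size q' + size g)%N = n.+2.
    move: (size_mul q'0 g'0); rewrite -eFqg sF sg => h.
    by move: g0; rewrite -size_poly_gt0 => hg; rewrite -[(_ + _)%N]prednK ?addn_gt0 ?hg ?orbT // -h.
  have [_ _ irr] := irrF; have [] := irr _ _ eFqg; rewrite poly_unitE => /andP[/eqP h _].
    by move: sqg sgn; rewrite h add1n => -[->]; rewrite ltnn.
  by move: sg1; rewrite -sg h.
have [sS1|sS1] := ltnP 1 (size S).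
  exists (resultant F S); split.
  - by apply: size_resultant_leq => //; rewrite sF.
  - rewrite map_resultant_gen ?lead ?(monic_neq0 mF) // ?eF; first exact: resultant_prod.
    by rewrite -size_poly_gt0 ltnW.
  move=> a eta h1 h2; have sF1 : (1 < size F)%N by rewrite sF.
  have [uv _ euv] := resultant_in_ideal sF1 sS1.
  have := congr1 (fun G => (map_poly (horner_eval a) G).[eta]) euv.
  rewrite map_polyC hornerC map_polyD !map_polyM hornerD !hornerM h1 h2 !mulr0 addr0.
  by [].
(* For S constant in Y the norm is a power of S. *)
have eS : S = (S`_0)%:P by rewrite -size1_polyC.
exists (S`_0 ^+ n); split.
- rewrite (leq_trans (size_poly_exp_leq _ _)) // ltnS mulnC leq_mul //; first lia.
  by have := bS 0%N; case: (size _).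
- rewrite eS map_polyC (eq_bigr (fun=> e S`_0)) => [|i _]; last by rewrite hornerC.
  by rewrite prodr_const card_ord coefC /= rmorphXn; apply: pm_refl.
move=> a eta _; rewrite eS map_polyC hornerC /= /horner_eval coefC /= horner_exp => ->.
by rewrite expr0n gtn_eqF.
Qed.

(** At a point (a, eta) of the curve where the discriminant D is nonzero, take lam = Q / F_Y. Then N
    vanishes at a, while N is a multiple c D with D(a) nonzero; hence N = 0. *)
Lemma ruppert : exists lam : L, Q = lam%:P%:P * F^`().
Proof.
set D := resultant F F^`().
have [a Da] : exists a, ~~ root D a by apply/closed_nonrootP.
have mFa : map_poly (horner_eval a) F \is monic by rewrite monic_map.
have sFa : size (map_poly (horner_eval a) F) != 1%N.
  rewrite size_map_poly_id0 ?sF ?eqSS -?lt0n // (monicP mF) /= /horner_eval hornerC.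
  exact: oner_neq0.
have [eta reta] := closed_rootP _ sFa.
have F'0 : (map_poly (horner_eval a) F^`()).[eta] != 0.
  have [u [v euv]] := deriv_bezout; apply: contraNneq Da => h.
  have := congr1 (fun G => (map_poly (horner_eval a) G).[eta]) euv.
  rewrite map_polyD !map_polyM hornerD !hornerM (rootP reta) h !mulr0 addr0.
  by rewrite map_polyC hornerC /= => /esym e; apply/rootP.
pose lam := (map_poly (horner_eval a) Q).[eta] / (map_poly (horner_eval a) F^`()).[eta].
have [N [sN eN N0 Na]] := ruppert_norm lam.
exists lam; apply: N0.
have sD : (size D <= ((2 * n - 1) * m).+1)%N.
  apply: size_resultant_leq => //; first by rewrite sF.
    by rewrite -ltnS -sF lt_size_deriv ?monic_neq0.
  by move=> i; rewrite coef_deriv (leq_trans _ (bF i.+1)) // -mulr_natr;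
    rewrite -(rmorph_nat (@polyC L)) mulrC mul_polyC size_scale_leq.
have [c ec] := wronskian_eq0 charL sN sD D0 eN.
have := Na a eta (rootP reta).
rewrite map_polyB map_polyM !map_polyC /= hornerD hornerN hornerM hornerC.
rewrite /horner_eval hornerC mulfVK // subrr => /(_ erefl).
rewrite ec hornerZ => /eqP; rewrite mulf_eq0 -[X in _ || X]/(root D a) (negbTE Da) orbF.
by move=> /eqP ->; rewrite scale0r.
Qed.

(** With Q = 0 the equation is F H_Y = H F_Y, so F divides D H by the Bezout relation; the degree of
    H excludes this unless H = 0. *)
Lemma ruppert_rigid : Q = 0 -> H = 0.
Proof.
move=> Q0; have dT0 : derivT (0 : {poly {poly L}}) = 0.
  by apply/polyP => i; rewrite coef_derivT !coef0 deriv0.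
have e : F * H^`() = H * F^`() by rewrite -[LHS]addr0 -eQH Q0 dT0; ring.
have [u [v euv]] := deriv_bezout.
have eD : (resultant F F^`())%:P * H = F * (u * H + v * H^`()).
  transitivity (F * (u * H) + v * (H * F^`())); first by rewrite -euv; ring.
  by rewrite -e; ring.
have [h|h] := eqVneq (u * H + v * H^`()) 0.
  move/eqP: eD; rewrite h mulr0 mulf_eq0 polyC_eq0 (negbTE D0) /=.
  by move/eqP.
have := congr1 (fun G : {poly {poly L}} => size G) eD; rewrite size_monicM //.
rewrite mul_polyC => e1; have := size_scale_leq (resultant F F^`()) H.
rewrite e1 sF addSn /= => e2.
move: (leq_trans e2 sH); rewrite -[X in (_ <= X)%N]addn0 leq_add2l leqn0 size_poly_eq0.
by rewrite (negbTE h).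
Qed.

End Ruppert.

(** * Lifting a factorization modulo powers of epsilon *)

Lemma size_map_monic (R R' : nzRingType) (f : {rmorphism R -> R'}) (Q : {poly R}) :
  Q \is monic -> size (map_poly f Q) = size Q.
Proof.
by move=> mQ; rewrite size_map_poly_id0 // (monicP mQ) rmorph1 oner_neq0.
Qed.

Lemma size_sub_monic (R : nzRingType) (p q : {poly R}) :
  p \is monic -> q \is monic -> size p = size q -> (size (p - q)%R < size p)%N.
Proof.
move=> mp mq spq; have s0 : (0 < size p)%N by rewrite size_poly_gt0 monic_neq0.
rewrite -(prednK s0) ltnS; apply/leq_sizeP => j; rewrite leq_eqVlt => /orP[/eqP <-|hj].
  rewrite coefB -lead_coefE {1}spq -lead_coefE (monicP mp) (monicP mq) subrr //.
by rewrite coefB !nth_default ?subrr // -?spq -(prednK s0).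
Qed.

Lemma poly_div_const (R : comNzRingType) (c : R) (p : {poly R}) :
  (forall i, exists r, p`_i = c * r) -> exists q, p = c%:P * q.
Proof.
move=> h; exists (\poly_(i < size p) projT1 (boolp.cid (h i))); apply/polyP => i.
rewrite coefCM coef_poly; case: ltnP => hi; last by rewrite nth_default ?mulr0.
by case: boolp.cid.
Qed.

Lemma monic_eq0_small (R : idomainType) (c : R) (p g X : {poly R}) : c != 0 ->
  g \is monic -> (size p < size g)%N -> c%:P * p = g * X -> p = 0.
Proof.
move=> c0 mg sp e; have [X0|X0] := eqVneq X 0.
  by move/eqP: e; rewrite X0 mulr0 mulf_eq0 polyC_eq0 (negbTE c0) => /eqP.
have := congr1 (fun f : {poly R} => size f) e; rewrite (size_monicM mg X0) mul_polyC => e1.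
have := size_scale_leq c p; rewrite e1; move: X0; rewrite -size_poly_gt0.
case: (size X) => // d _; rewrite addnS /= => h.
by have := leq_ltn_trans (leq_trans (leq_addr _ _) h) sp; rewrite ltnn.
Qed.

Section Lifting.
Variables (k L : closedFieldType) (V : idomainType).
Variables (iV : {rmorphism V -> L}) (hV : {rmorphism V -> k}).
Hypothesis plV : is_place iV hV.
Variable jV : {rmorphism {poly k} -> V}.
Hypothesis hjV : forall p, hV (jV p) = p.[0].
Hypothesis jV_X : jV 'X != 0.

Local Notation red := (map_poly (horner_eval (0 : k))).
Local Notation Red := (map_poly red).
Local Notation eps j := (('X^j : {poly k})%:P%:P : {poly {poly {poly k}}}).

Definition lift2 (G : {poly {poly k}}) : {poly {poly {poly k}}} :=
  map_poly (map_poly (@polyC k)) G.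

Lemma red_lift2 G : Red (lift2 G) = G.
Proof.
apply/polyP => i; apply/polyP => j.
by rewrite coef_map /= coef_map /= coef_map /= coef_map /= /horner_eval hornerC.
Qed.

Lemma red_div X : Red X = 0 -> exists X', X = eps 1 * X'.
Proof.
move=> X0; apply: poly_div_const => i; apply: poly_div_const => j.
have : root X`_i`_j 0.
  have := congr1 (fun p : {poly {poly k}} => p`_i`_j) X0.
  by rewrite coef_map /= coef_map !coef0 => h; apply/rootP.
by case/factor_theorem => q ->; exists q; rewrite subr0 expr1 mulrC.
Qed.

Lemma red_eps j : (0 < j)%N -> Red (eps j) = 0.
Proof.
by case: j => // j _; rewrite map_polyC /= map_polyC /= /horner_eval hornerXn expr0n.
Qed.

Variables (F : {poly {poly {poly k}}}) (n : nat).
Hypothesis mF : F \is monic.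
Hypothesis sF : size F = n.+1.
Hypothesis n_gt1 : (1 < n)%N.
Hypothesis tameL : tame L n.
Variables Gb Hb : {poly {poly k}}.
Hypothesis mGb : Gb \is monic.
Hypothesis mHb : Hb \is monic.
Hypothesis eF : Red F = Gb * Hb.

Lemma deg_split r s : size Gb = r.+1 -> size Hb = s.+1 -> (r + s)%N = n.
Proof.
move=> sGb sHb; have := size_mul (monic_neq0 mGb) (monic_neq0 mHb).
by rewrite -eF size_map_monic // sF sGb sHb addnS /= addSn => -[].
Qed.

(* A local chart: an evaluation of k[eps][T] in V[[w]] reducing to one of k[T]
   in k[[w]], in which the factorization Gb * Hb lifts. *)
Record chart (ev : {rmorphism {poly {poly k}} -> series V})
    (evb : {rmorphism {poly k} -> series k}) (g h : {poly series V}) : Prop := Chart {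
  chart_red : forall p, map_series hV (ev p) = evb (red p);
  chart_const : forall c, ev c%:P = ps (jV c)%:P;
  chart_mg : g \is monic;
  chart_mh : h \is monic;
  chart_F : map_poly ev F = g * h;
  chart_g : map_poly (map_series hV) g = map_poly evb Gb;
  chart_h : map_poly (map_series hV) h = map_poly evb Hb;
  chart_bez : exists al be s c, al * g + be * h = s%:P /\ has_unit_order s c }.

(** A chart centred at T = a, possibly ramified; injectivity of [evb] lets identities over k[T] be
    cancelled inside the chart. *)
Definition finite_chart a ev evb g h := [/\ @chart ev evb g h,
  injective evb & forall p, evb p 0%N = p.[a]].

(** G H and g h agree modulo eps^j and have the same reductions, so uniqueness of the lifting makes
    the factors agree modulo eps^j. *)
Lemma chart_compare ev evb g h j G H E : @chart ev evb g h ->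
  G \is monic -> H \is monic -> Red G = Gb -> Red H = Hb -> F = G * H + eps j * E ->
  exists gam eta, [/\ g = map_poly ev G + (ps (jV 'X^j)%:P)%:P * gam,
    h = map_poly ev H + (ps (jV 'X^j)%:P)%:P * eta,
    (size gam < size g)%N & (size eta < size h)%N].
Proof.
move=> ch mG mH rG rH e; have [al [be [s [c [bez os]]]]] := chart_bez ch.
have sz (g0 : {poly series V}) G0 Gb0 : g0 \is monic -> G0 \is monic -> Red G0 = Gb0 ->
    map_poly (map_series hV) g0 = map_poly evb Gb0 ->
    (size (g0 - map_poly ev G0)%R < size g0)%N.
  move=> mg mG0 rG0 eg; apply: size_sub_monic => //; first by rewrite monic_map.
  have mGb0 : Gb0 \is monic by rewrite -rG0 monic_map.
  rewrite size_map_monic // -(size_map_monic (map_series hV)) // eg size_map_monic //.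
  by rewrite -rG0 size_map_monic.
have cm (g0 : {poly series V}) G0 Gb0 : Red G0 = Gb0 ->
    map_poly (map_series hV) g0 = map_poly evb Gb0 ->
    forall l t, hV ((g0 - map_poly ev G0)`_l t) = 0.
  move=> rG0 eg l t.
  transitivity ((map_series hV g0`_l - map_series hV (ev G0`_l)) t).
    by rewrite coefB coef_map coef_sB rmorphB.
  have := congr1 (fun p : {poly series k} => p`_l) eg.
  rewrite coef_map -rG0 !coef_map => h1; rewrite (chart_red ch).
  have -> : map_series hV g0`_l = evb (red G0`_l) by exact: h1.
  by rewrite subrr.
have sg := sz _ _ _ (chart_mg ch) mG rG (chart_g ch).
have sh := sz _ _ _ (chart_mh ch) mH rH (chart_h ch).
have o1 : has_unit_order (1 : series V) 0 by split=> //; rewrite coef_s1 unitr1.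
have eqn : (1 : series V)%:P * ((g - map_poly ev G) * h + g * (h - map_poly ev H)) =
   (g - map_poly ev G) * (h - map_poly ev H) + (ps (jV 'X^j)%:P)%:P * map_poly ev E.
  have := chart_F ch; rewrite e map_polyD !map_polyM map_polyC /= (chart_const ch) => e1.
  rewrite mul1r; apply/eqP; rewrite -subr_eq0; apply/eqP.
  transitivity (g * h - (map_poly ev G * map_poly ev H +
    (ps (jV 'X^j)%:P)%:P * map_poly ev E)); first by ring.
  by rewrite e1 subrr.
have key := hensel_unique plV (chart_mg ch) (chart_mh ch) sg sh bez os o1 eqn
  (cm _ _ _ rG (chart_g ch)) (cm _ _ _ rH (chart_h ch)).
have dv (X : {poly series V}) : (forall l t, exists v, X`_l t = jV 'X^j * v) ->
    exists Y, X = (ps (jV 'X^j)%:P)%:P * Y /\ size X = size Y.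
  move=> hX; have [|Y eY] := @poly_div_const _ (ps (jV 'X^j)%:P) X.
    move=> l; exists (Series (fun t => projT1 (boolp.cid (hX l t)))); apply/seriesP => t.
    rewrite coef_sM big_ord_recl big1 ?addr0 /=; last by move=> i _; rewrite coefC mul0r.
    by rewrite subn0 coefC /=; case: boolp.cid.
  exists Y; split=> //; rewrite eY mul_polyC size_scale //.
  rewrite -(rmorph0 (@ps V)) (inj_eq (@ps_inj V)) polyC_eq0 rmorphXn.
  by rewrite expf_neq0.
have [gam [egam sgam]] := dv _ (fun l t => (key l t).1).
have [eta [eeta seta]] := dv _ (fun l t => (key l t).2).
exists gam, eta; rewrite -sgam -seta -egam -eeta; split=> //.
  by rewrite addrC subrK.
by rewrite addrC subrK.
Qed.

(** Divisibility in k[T] is local: at a root of c the chart forces p to vanish, and the roots of c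
    are removed one at a time. *)
Lemma divisible_by_charts (c p : {poly k}) : c != 0 ->
  (forall a, exists (evb : {rmorphism {poly k} -> series k}) s,
     [/\ injective evb, forall f, evb f 0%N = f.[a] & evb p = evb c * s]) ->
  exists q, p = c * q.
Proof.
have [d] := ubnP (size c); elim: d c p => // d IH c p sc c0 hp.
have [c1|c1] := eqVneq (size c) 1%N.
  have cc : c = (c`_0)%:P by rewrite -size1_polyC ?c1.
  have c00 : c`_0 != 0 by apply: contraNneq c0; rewrite cc coefC /= => ->.
  by exists ((c`_0)^-1%:P * p); rewrite {1}cc mulrA -polyCM mulfV // mul1r.
have [al ral] := closed_rootP c c1; have [c' ec] := factor_theorem _ _ ral.
have c'0 : c' != 0 by apply: contraNneq c0; rewrite ec => ->; rewrite mul0r.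
have X0 : 'X - al%:P != 0 :> {poly k} by rewrite polyXsubC_eq0.
have sc' : (size c' < d)%N.
  by move: sc; rewrite ec size_Mmonic ?monicXsubC // size_XsubC addn2.
have [p' ep] : exists p', p = p' * ('X - al%:P).
  apply/factor_theorem; have [evb [s [_ h1 h3]]] := hp al.
  by apply/rootP; rewrite -h1 h3 coef_sM big_ord1 h1 (rootP ral) mul0r.
have [|q eq] := IH c' p' sc' c'0; last by exists q; rewrite ep ec eq; ring.
move=> a; have [evb [s [evI h1 h3]]] := hp a; exists evb, s; split=> //.
have e0 : evb ('X - al%:P) != 0 by rewrite -(rmorph0 evb) (inj_eq evI).
by apply: (mulIf e0); rewrite -rmorphM -ep h3 ec rmorphM mulrAC.
Qed.

Hypothesis charts : forall a, exists ev evb g h, @finite_chart a ev evb g h.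

(** The correction modulo eps has to solve Eb = G2 Hb + Gb H2 over k[T], but Bezout only solves it
    with denominator Db. In each chart the local lifts provide a solution without denominator, and
    the degree bound makes the solution unique; so Db divides G1 and H1. *)
Lemma lift_step j G H E Db a0 b0 : (0 < j)%N -> Db != 0 ->
  a0 * Gb + b0 * Hb = Db%:P ->
  G \is monic -> H \is monic -> Red G = Gb -> Red H = Hb -> F = G * H + eps j * E ->
  exists G' H' E', [/\ G' \is monic, H' \is monic, Red G' = Gb, Red H' = Hb &
    F = G' * H' + eps j.+1 * E'].
Proof.
move=> j0 D0 bez mG mH rG rH e.
have sG : size G = size Gb by rewrite -rG size_map_monic.
have sH : size H = size Hb by rewrite -rH size_map_monic.
have Gb0 := monic_neq0 mGb; have Hb0 := monic_neq0 mHb.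
have sGH : (size Gb + size Hb)%N = n.+2.
  have := size_mul Gb0 Hb0; rewrite -eF size_map_monic // sF.
  by move: Gb0; rewrite -size_poly_gt0; case: (size Gb) => // d _ ->; rewrite addSn.
have epsn0 : ('X^j : {poly k})%:P != 0 :> {poly {poly k}} by rewrite polyC_eq0 monic_neq0 ?monicXn.
have sE : (size E <= n)%N.
  have <- : size (eps j * E) = size E by rewrite mul_polyC size_scale.
  have -> : eps j * E = F - G * H by rewrite e addrC addKr.
  rewrite -ltnS -sF; apply: size_sub_monic => //; first by rewrite monicMl.
  by rewrite size_monicM ?monic_neq0 // sG sH sGH sF.
set Eb := Red E; have sEb : (size Eb <= n)%N by rewrite (leq_trans (size_poly _ _)).
(* The Bezout solution of Db Eb = G1 Hb + Gb H1, normalized by deg G1 < deg Gb. *)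
pose G1 := Pdiv.Ring.rmodp (b0 * Eb) Gb.
pose H1 := a0 * Eb + Pdiv.Ring.rdivp (b0 * Eb) Gb * Hb.
have sG1 : (size G1 < size Gb)%N by rewrite Pdiv.Ring.ltn_rmodpN0.
have eD : Db%:P * Eb = G1 * Hb + Gb * H1.
  rewrite -bez /H1; have := Pdiv.RingMonic.rdivp_eq mGb (b0 * Eb); rewrite -/G1 => h.
  transitivity (Gb * (a0 * Eb) + (b0 * Eb) * Hb); first by ring.
  by rewrite [X in _ + X * _]h; ring.
have sH1 : (size H1 < size Hb)%N.
  have [->|H10] := eqVneq H1 0; first by rewrite size_poly0 size_poly_gt0.
  have h1 : (size (Gb * H1)%R <= n)%N.
    have -> : Gb * H1 = Db%:P * Eb - G1 * Hb by rewrite eD addrC addKr.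
    rewrite (leq_trans (size_polyD _ _)) // geq_max size_polyN.
    rewrite mul_polyC (leq_trans (size_scale_leq _ _)) //=.
    rewrite (leq_trans (size_polyMleq _ _)) //.
    by move: sG1 sGH; move: (size G1) (size Gb) (size Hb) => *; lia.
  move: h1; rewrite (size_monicM mGb H10).
  move: sGH Gb0; rewrite -size_poly_gt0; move: (size H1) (size Gb) (size Hb) => *; lia.
have local a : exists (evb : {rmorphism {poly k} -> series k}) (gam eta : {poly series k}),
    [/\ injective evb, forall f, evb f 0%N = f.[a],
      map_poly evb G1 = (evb Db)%:P * gam & map_poly evb H1 = (evb Db)%:P * eta].
  have [ev [evb [g [h [ch evI ev0]]]]] := charts a.
  have [gam [eta [eg eh sg sh]]] := chart_compare ch mG mH rG rH e.
  set gb := map_poly (map_series hV) gam; set hb := map_poly (map_series hV) eta.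
  set pi := (ps (jV 'X^j)%:P)%:P in eg eh.
  have pi0 : pi != 0.
    rewrite /pi polyC_eq0 -(rmorph0 (@ps V)) (inj_eq (@ps_inj V)) polyC_eq0 rmorphXn.
    by rewrite expf_neq0.
  have hpi : map_poly (map_series hV) pi = 0.
    rewrite /pi map_polyC /= map_series_ps map_polyC /= hjV hornerXn expr0n gtn_eqF //.
    by rewrite rmorph0 polyC0.
  (* The first-order part of g h = G H + eps^j E, after division by eps^j. *)
  have eE : map_poly ev E = gam * map_poly ev H + map_poly ev G * eta + pi * (gam * eta).
    apply: (mulfI pi0); have := chart_F ch.
    rewrite e map_polyD !map_polyM map_polyC /= (chart_const ch) -/pi eg eh => e1.
    apply: (addrI (map_poly ev G * map_poly ev H)); rewrite e1; ring.
  have sig (X : {poly {poly {poly k}}}) :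
      map_poly (map_series hV) (map_poly ev X) = map_poly evb (Red X).
    rewrite -!map_poly_comp; apply: eq_map_poly => p /=; exact: (chart_red ch).
  have := congr1 (map_poly (map_series hV)) eE.
  rewrite !map_polyD !map_polyM hpi mul0r addr0 !sig rG rH -/Eb -/gb -/hb => eEb.
  set Gc := map_poly evb Gb in eEb; set Hc := map_poly evb Hb in eEb.
  have bez' : map_poly evb a0 * Gc + map_poly evb b0 * Hc = (evb Db)%:P.
    by rewrite -!map_polyM -map_polyD bez map_polyC.
  have eD' : (evb Db)%:P * map_poly evb Eb = map_poly evb G1 * Hc + Gc * map_poly evb H1.
    by rewrite -map_polyC -map_polyM eD map_polyD !map_polyM.
  (* The difference of the two solutions solves the homogeneous equation, so Gb divides Db X in the
     chart, where deg X < deg Gb. *)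
  pose X := map_poly evb G1 - (evb Db)%:P * gb; pose Y := map_poly evb H1 - (evb Db)%:P * hb.
  have XY : X * Hc + Gc * Y = 0.
    rewrite /X /Y; transitivity ((map_poly evb G1 * Hc + Gc * map_poly evb H1) -
      (evb Db)%:P * (gb * Hc + Gc * hb)); first by ring.
    by rewrite -eD' -eEb subrr.
  have D'0 : evb Db != 0 by rewrite -(rmorph0 evb) (inj_eq evI).
  have mGc : Gc \is monic by rewrite monic_map.
  have sgc : size g = size Gc.
    by rewrite -(size_map_monic (map_series hV) (chart_mg ch)) (chart_g ch).
  have X0 : X = 0.
    apply: (monic_eq0_small D'0 mGc (X := map_poly evb a0 * X - map_poly evb b0 * Y)).
      rewrite (leq_ltn_trans (size_polyD _ _)) // gtn_max size_polyN.
      rewrite (leq_ltn_trans (size_poly _ _)) /=; last by rewrite size_map_monic.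
      rewrite mul_polyC (leq_ltn_trans (size_scale_leq _ _)) //.
      by rewrite (leq_ltn_trans (size_poly _ _)) // -sgc.
    rewrite -bez'; apply/eqP; rewrite -subr_eq0; apply/eqP.
    transitivity (map_poly evb b0 * (X * Hc + Gc * Y)); first by ring.
    by rewrite XY mulr0.
  have Y0 : Y = 0.
    by move: XY => /eqP; rewrite X0 mul0r add0r mulf_eq0 (negbTE (monic_neq0 mGc)) => /eqP.
  exists evb, gb, hb; split=> //; apply/eqP; rewrite -subr_eq0; apply/eqP.
    exact: X0.
  exact: Y0.
have [G2 eG2] : exists G2, G1 = Db%:P * G2.
  apply: poly_div_const => i; apply: (divisible_by_charts D0) => a.
  have [evb [gam [eta [evI h0 hG hH]]]] := local a; exists evb, gam`_i; split=> //.
  by have := congr1 (fun p : {poly series k} => p`_i) hG; rewrite coef_map coefCM.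
have [H2 eH2] : exists H2, H1 = Db%:P * H2.
  apply: poly_div_const => i; apply: (divisible_by_charts D0) => a.
  have [evb [gam [eta [evI h0 hG hH]]]] := local a; exists evb, eta`_i; split=> //.
  by have := congr1 (fun p : {poly series k} => p`_i) hH; rewrite coef_map coefCM.
have DP0 : Db%:P != 0 :> {poly {poly k}} by rewrite polyC_eq0.
have eEb : Eb = G2 * Hb + Gb * H2.
  by apply: (mulfI DP0); rewrite eD eG2 eH2; ring.
have szl (X : {poly {poly k}}) : size (lift2 X) = size X.
  by rewrite size_map_inj_poly ?rmorph0 //; apply: map_inj_poly; rewrite ?polyC0 //; apply: polyC_inj.
have monicD (G0 : {poly {poly {poly k}}}) X (Gb' : {poly {poly k}}) : G0 \is monic -> size G0 = size Gb' ->
    (size (Db%:P * X)%R < size Gb')%N -> G0 + eps j * lift2 X \is monic.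
  move=> mG0 s0; rewrite mul_polyC size_scale // => sX.
  apply/monicP; rewrite lead_coefDl ?(monicP mG0) // mul_polyC size_scale // szl s0.
  exact: sX.
have [|E' eE'] := @red_div (E - lift2 G2 * H - G * lift2 H2).
  by rewrite !map_polyB !map_polyM !red_lift2 rG rH -/Eb eEb; ring.
exists (G + eps j * lift2 G2), (H + eps j * lift2 H2), (E' - eps j.-1 * (lift2 G2 * lift2 H2)).
split.
- by apply: (monicD G G2 Gb mG sG); rewrite -eG2.
- by apply: (monicD H H2 Hb mH sH); rewrite -eH2.
- by rewrite map_polyD map_polyM red_eps // mul0r addr0.
- by rewrite map_polyD map_polyM red_eps // mul0r addr0.
have epsD a b : eps (a + b) = eps a * eps b by rewrite exprD !polyCM.
have -> : eps j.+1 = eps j * eps 1 by rewrite -epsD addn1.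
have e2 : eps j = eps 1 * eps j.-1 by rewrite -epsD add1n prednK.
rewrite e; transitivity (G * H + eps j * (E - lift2 G2 * H - G * lift2 H2) +
  eps j * (lift2 G2 * H + G * lift2 H2)); first by ring.
rewrite eE' e2; ring.
Qed.

Lemma lift_all j Db a0 b0 : (0 < j)%N -> Db != 0 -> a0 * Gb + b0 * Hb = Db%:P ->
  exists G H E, [/\ G \is monic, H \is monic, Red G = Gb, Red H = Hb &
    F = G * H + eps j * E].
Proof.
move=> j0 D0 bez; elim: j j0 => // -[_ _|j IH _]; last first.
  have [//|G [H [E [mG mH rG rH e]]]] := IH.
  have [|G' [H' [E' [*]]]] := lift_step _ D0 bez mG mH rG rH e; first by [].
  by exists G', H', E'.
have ml (X : {poly {poly k}}) : X \is monic -> lift2 X \is monic by move=> mX; rewrite monic_map.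
have [|E eE] := @red_div (F - lift2 Gb * lift2 Hb).
  by rewrite map_polyB map_polyM !red_lift2 eF subrr.
exists (lift2 Gb), (lift2 Hb), E; split; rewrite ?ml ?red_lift2 //.
by rewrite -eE addrC subrK.
Qed.
End Lifting.

(** * Degrees in T: the chart at infinity *)

Section Reversal.
Variable R : comNzRingType.
Implicit Types (p q : {poly R}) (G H : {poly {poly R}}).

(* [rv K p] is x^K p(1/x) when p has degree at most K. *)
Definition rv K p : {poly R} := \poly_(e < K.+1) p`_(K - e).

Lemma size_rv K p : (size (rv K p) <= K.+1)%N. Proof. exact: size_poly. Qed.

Lemma coef_rv K p e : (e <= K)%N -> (rv K p)`_e = p`_(K - e).
Proof. by move=> h; rewrite coef_poly ltnS h. Qed.

Lemma rvE K p : rv K p = \sum_(e < K.+1) p`_e *: 'X^(K - e).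
Proof.
rewrite /rv poly_def (reindex_inj rev_ord_inj) /=; apply: eq_bigr => e _.
by rewrite subSS subKn // -ltnS.
Qed.

Lemma rvD K p q : rv K (p + q) = rv K p + rv K q.
Proof. by apply/polyP => e; rewrite coefD !coef_poly coefD; case: ifP; rewrite ?addr0. Qed.

Lemma rv0 K : rv K 0 = 0.
Proof. by apply/polyP => e; rewrite coef_poly !coef0 if_same. Qed.

Lemma rv_sum K (I : Type) (r : seq I) (P : pred I) (p : I -> {poly R}) :
  rv K (\sum_(i <- r | P i) p i) = \sum_(i <- r | P i) rv K (p i).
Proof. by elim/big_rec2: _ => [|i x y _ <-]; rewrite ?rv0 ?rvD. Qed.

Lemma rvZ K c p : rv K (c *: p) = c *: rv K p.
Proof. by apply/polyP => e; rewrite coefZ !coef_poly coefZ; case: ifP; rewrite ?mulr0. Qed.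

Lemma rvXn K e : (e <= K)%N -> rv K 'X^e = 'X^(K - e).
Proof.
move=> h; apply/polyP => i; rewrite coef_poly !coefXn; case: ltnP => hi.
  by have -> : ((K - i)%N == e) = (i == (K - e)%N) by apply/eqP/eqP; lia.
rewrite gtn_eqF //; exact: leq_ltn_trans (leq_subr _ _) hi.
Qed.

Lemma rvM K K' p q : (size p <= K.+1)%N -> (size q <= K'.+1)%N ->
  rv (K + K') (p * q) = rv K p * rv K' q.
Proof.
move=> sp sq.
have wide (f : {poly R}) d : (size f <= d)%N -> f = \sum_(e < d) f`_e *: 'X^e.
  move=> h; rewrite -poly_def; apply/polyP => i; rewrite coef_poly.
  by case: ltnP => // hi; rewrite nth_default // (leq_trans h).
rewrite [X in rv _ (X * _)](wide _ _ sp) [X in rv _ (_ * X)](wide _ _ sq).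
rewrite mulr_suml rv_sum !rvE mulr_suml; apply: eq_bigr => a _.
rewrite mulr_sumr rv_sum mulr_sumr; apply: eq_bigr => b _.
have ha : (a <= K)%N by rewrite -ltnS.
have hb : (b <= K')%N by rewrite -ltnS.
rewrite -!scalerAl -!scalerAr -!exprD !scalerA rvZ rvXn ?leq_add //.
by congr (_ *: 'X^_); lia.
Qed.

Variable m : nat.

(* x^(D + m r) G(1/x, Y / x^m) *)
Definition st D r G : {poly series R} := \poly_(i < r.+1) ps (rv (D + m * (r - i)) G`_i).

(** With weight 1 for T and m for Y, G has weight at most D + mr; then the reversal [st] loses no
    coefficient. D measures the excess over the natural weight of a monic factor. *)
Definition st_ok D r G := (size G <= r.+1)%N /\
  forall i, (i <= r)%N -> (size (G`_i)%R <= (D + m * (r - i)).+1)%N.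

Lemma size_st D r G : (size (st D r G) <= r.+1)%N. Proof. exact: size_poly. Qed.

Lemma coef_st D r G i : (i <= r)%N -> (st D r G)`_i = ps (rv (D + m * (r - i)) G`_i).
Proof. by move=> h; rewrite coef_poly ltnS h. Qed.

Lemma stM D D' r r' G H : st_ok D r G -> st_ok D' r' H ->
  st (D + D') (r + r') (G * H) = st D r G * st D' r' H.
Proof.
move=> [sG bG] [sH bH]; apply/polyP => l; rewrite coefM coef_poly.
have [hl|hl] := ltnP l (r + r').+1; last first.
  rewrite big1 // => i _; have [hi|hi] := leqP i r.
    by rewrite [X in _ * X]coef_poly ltnS leqNgt ltn_subRL (leq_ltn_trans _ hl) ?leq_add2r //= mulr0.
  by rewrite coef_poly ltnS leqNgt hi /= mul0r.
rewrite coefM rv_sum rmorph_sum; apply: eq_bigr => i _.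
have [hi|hi] := leqP i r; last first.
  rewrite [G`_i]nth_default ?(leq_trans sG) // mul0r rv0 rmorph0.
  by rewrite coef_poly ltnS leqNgt hi /= mul0r.
have [hi'|hi'] := leqP (l - i) r'; last first.
  rewrite [H`_(l - i)]nth_default ?(leq_trans sH) // mulr0 rv0 rmorph0.
  by rewrite [X in _ * X]coef_poly ltnS leqNgt hi' /= mulr0.
rewrite !coef_st // -rmorphM; congr (ps _); rewrite -rvM ?bG ?bH //; congr (rv _ _).
have il : (i <= l)%N by rewrite -ltnS.
rewrite addnACA -mulnDr; congr (_ + m * _)%N; lia.
Qed.

Lemma st_okM D D' r r' G H : st_ok D r G -> st_ok D' r' H ->
  st_ok (D + D') (r + r') (G * H).
Proof.
move=> [sG bG] [sH bH]; split=> [|l hl].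
  rewrite (leq_trans (size_polyMleq _ _)) //; move: sG sH; move: (size G) (size H) => *; lia.
rewrite coefM (leq_trans (size_sum _ _ _)) //; apply/bigmax_leqP => i _.
have [hi|hi] := leqP i r; last by rewrite [G`_i]nth_default ?mul0r ?size_poly0 ?(leq_trans sG).
have [hi'|hi'] := leqP (l - i) r'; last first.
  by rewrite [H`_(l - i)]nth_default ?mulr0 ?size_poly0 ?(leq_trans sH).
rewrite (leq_trans (size_polyMleq _ _)) //; have il : (i <= l)%N by rewrite -ltnS.
have -> : (m * (r + r' - l) = m * (r - i) + m * (r' - (l - i)))%N.
  by rewrite -mulnDr; congr (m * _)%N; lia.
have hx := bG i hi; have hy := bH _ hi'.
move: hx hy; move: (size (G`_i)%R) (size (H`_(l - i))%R) (m * _)%N (m * _)%N => *; lia.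
Qed.

Lemma stD D r G H : st D r (G + H) = st D r G + st D r H.
Proof.
apply/polyP => i; rewrite coefD !coef_poly coefD rvD rmorphD.
by case: ifP; rewrite ?addr0.
Qed.

Lemma st_const D r (c : R) G : st D r (c%:P%:P * G) = (ps c%:P)%:P * st D r G.
Proof.
apply/polyP => i; rewrite coefCM !coef_poly coefCM; case: ifP => _; last by rewrite mulr0.
by rewrite mul_polyC rvZ -mul_polyC rmorphM.
Qed.

Lemma st_deriv D r G : (st D r.+1 G)^`() = st D r G^`().
Proof.
apply/polyP => i; rewrite coef_deriv; have [hi|hi] := leqP i r; last first.
  by rewrite !nth_default ?mul0rn // (leq_trans (size_st _ _ _)).
rewrite !coef_st // subSS coef_deriv -rmorphMn; congr (ps _); apply/polyP => e.
by rewrite coefMn !coef_poly coefMn; case: ifP; rewrite ?mul0rn.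
Qed.

Lemma st_shift D D' r G : st_ok D r G -> st (D' + D) r G = (sX R D')%:P * st D r G.
Proof.
move=> [sG bG]; apply/polyP => i; rewrite coefCM !coef_poly; case: ifP => hi; last by rewrite mulr0.
rewrite /sX -rmorphM; congr (ps _).
have -> : (D' + D + m * (r - i) = D' + (D + m * (r - i)))%N by rewrite addnA.
rewrite -[X in rv _ X]mul1r rvM ?bG ?size_poly1 //.
by congr (_ * _); rewrite -(expr0 'X) rvXn // subn0.
Qed.

Lemma st_monic r G : G \is monic -> size G = r.+1 -> st 0 r G \is monic /\ size (st 0 r G) = r.+1.
Proof.
move=> mG sG; have h : (st 0 r G)`_r = 1.
  rewrite coef_st // subnn muln0; have -> : G`_r = 1 by move/monicP: mG; rewrite lead_coefE sG.
  by rewrite -(expr0 'X) rvXn // expr0 rmorph1.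
have s : size (st 0 r G) = r.+1.
  by rewrite size_poly_eq // -coef_st // h oner_neq0.
by split=> //; apply/monicP; rewrite lead_coefE s.
Qed.

End Reversal.

Lemma map_st (R S : comNzRingType) (f : {rmorphism R -> S}) m D r (G : {poly {poly R}}) :
  map_poly (map_series f) (st m D r G) = st m D r (map_poly (map_poly f) G).
Proof.
have map_rv K p : map_poly f (rv K p) = rv K (map_poly f p).
  apply/polyP => e; rewrite coef_map; have [he|he] := leqP e K.
    by rewrite !coef_rv // coef_map.
  by rewrite !nth_default ?(leq_trans (size_rv _ _)) //; exact: rmorph0.
apply/polyP => i; rewrite coef_map; have [hi|hi] := leqP i r.
  by rewrite !coef_st //= map_series_ps map_rv coef_map.
by rewrite !nth_default ?(leq_trans (size_st _ _ _ _)) //; exact: rmorph0.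
Qed.

Lemma det_scale_rows_cols (R : comNzRingType) d (A B : 'M[R]_d) (r c : 'I_d -> R) :
  (forall i j, A i j * c j = r i * B i j) ->
  \det A * \prod_j c j = \prod_i r i * \det B.
Proof.
move=> h.
have dE (v : 'I_d -> R) : \prod_j v j = \det (diag_mx (\row_j v j)).
  by rewrite det_diag; apply: eq_bigr => j _; rewrite mxE.
rewrite !dE -!det_mulmx; congr (\det _); apply/matrixP => i j.
by rewrite mul_mx_diag mul_diag_mx !mxE.
Qed.

(** The roots are multiplied by X, and rows and columns of the Sylvester matrix scale by powers of
    X. Only the fact that the ratio is a power of X matters, so the exponents stay unspecified. *)
Lemma resultant_scale (K : fieldType) (X : K) (p q p' q' : {poly K}) n e : X != 0 ->
  size p = n.+1 -> size q = e.+1 -> size p' = n.+1 -> size q' = e.+1 ->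
  (forall i, (i <= n)%N -> p'`_i = X ^+ (n - i) * p`_i) ->
  (forall i, (i <= e)%N -> q'`_i = X ^+ (e - i) * q`_i) ->
  exists a b, resultant p' q' * X ^+ a = X ^+ b * resultant p q.
Proof.
move=> X0 sp sq sp' sq' hp hq.
have gen d1 d2 d1' d2' (Sy : 'M[K]_(d1 + d2)) (Sy' : 'M[K]_(d1' + d2')) :
    d1 = d1' -> d2 = d2' ->
    (forall i j, Sy i j = match split i with
       inl k => ('X^k * p)`_j | inr k => ('X^k * q)`_j end) ->
    (forall i j, Sy' i j = match split i with
       inl k => ('X^k * p')`_j | inr k => ('X^k * q')`_j end) ->
    exists a b, \det Sy' * X ^+ a = X ^+ b * \det Sy.
  move=> e1 e2; subst d1' d2' => h h'.
  pose r (i : 'I_(d1 + d2)) := match split i with inl k => (n + k)%N | inr k => (e + k)%N end.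
  exists (\sum_(j < d1 + d2) j)%N, (\sum_i r i)%N.
  rewrite -!prodrXr; apply: (@det_scale_rows_cols _ _ _ _ (fun i => X ^+ r i) (fun j => X ^+ j)) => i j.
  have aux (f f' : {poly K}) d k : size f = d.+1 -> size f' = d.+1 ->
      (forall i, (i <= d)%N -> f'`_i = X ^+ (d - i) * f`_i) ->
      ('X^k * f')`_j * X ^+ j = X ^+ (d + k) * ('X^k * f)`_j.
    move=> sf sf' hf; rewrite !coefXnM; case: ltnP => hk; first by rewrite mul0r mulr0.
    have [hd|hd] := leqP (j - k) d; last by rewrite !nth_default ?mul0r ?mulr0 ?sf ?sf'.
    by rewrite hf // mulrAC -exprD; congr (X ^+ _ * _); lia.
  rewrite h h' /r; case: split => k; exact: aux.
apply: gen; rewrite ?sp ?sq ?sp' ?sq' // => i j.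
  by rewrite Sylvester_mxE; case: (split i) => a; rewrite coefXnM ltnNge; case: leqP.
by rewrite Sylvester_mxE; case: (split i) => a; rewrite coefXnM ltnNge; case: leqP.
Qed.

Lemma lead_deriv_monic (R : idomainType) (F : {poly R}) n : F \is monic -> size F = n.+1 ->
  (0 < n)%N -> n%:R != 0 :> R -> lead_coef F^`() = n%:R /\ size F^`() = n.
Proof.
move=> mF sF n0 nR; have cn : F^`()`_n.-1 = n%:R.
  by rewrite coef_deriv prednK //; move/monicP: mF; rewrite lead_coefE sF => ->.
have sF' : size F^`() = n.
  apply/eqP; rewrite eqn_leq -ltnS -sF lt_size_deriv ?monic_neq0 //=.
  rewrite leqNgt; apply/negP => h; have := cn; rewrite nth_default.
    by move/esym/eqP; rewrite (negbTE nR).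
  by rewrite -ltnS (prednK n0).
by rewrite lead_coefE sF' cn.
Qed.

Lemma map_discriminant (R S : idomainType) (f : {rmorphism R -> S}) (F : {poly R}) n :
  F \is monic -> size F = n.+1 -> (0 < n)%N -> n%:R != 0 :> S ->
  f (resultant F F^`()) = resultant (map_poly f F) (map_poly f F)^`().
Proof.
move=> mF sF n0 nS; have nR : n%:R != 0 :> R.
  by apply: contraNneq nS => e; rewrite -(rmorph_nat f) e rmorph0.
rewrite deriv_map -map_resultant_gen //; first by rewrite (monicP mF) rmorph1 oner_neq0.
by rewrite (lead_deriv_monic mF sF n0 nR).1 rmorph_nat.
Qed.

(** Brings the comparison at infinity, where q is a power of w, to the form of the equation in
    [hensel_unique]. *)
Lemma factor_perturbation (R : comNzRingType) (q g h G H e : R) :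
  q * q * (g * h) = G * H + e ->
  q * ((q * g - G) * h + g * (q * h - H)) = (q * g - G) * (q * h - H) + e.
Proof. by move/(canLR (addKr _)) => <-; ring. Qed.

Lemma comp_XaddC_inj (R : comNzRingType) (c : R) :
  injective (fun p : {poly R} => p \Po ('X + c%:P)).
Proof.
apply: (can_inj (g := fun p => p \Po ('X - c%:P))) => p.
by rewrite -comp_polyA comp_polyD comp_polyX comp_polyC subrK comp_polyXr.
Qed.

Lemma coef_comp_scaleX (R : comNzRingType) (c : R) (p : {poly R}) i :
  (p \Po (c *: 'X))`_i = c ^+ i * p`_i.
Proof.
rewrite comp_polyE coef_sum; have [hi|hi] := ltnP i (size p).
  rewrite (bigD1 (Ordinal hi)) //= exprZn scalerA coefZ coefXn eqxx mulr1 mulrC.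
  rewrite big1 ?addr0 // => j; rewrite -val_eqE /= => ji.
  by rewrite exprZn scalerA coefZ coefXn eq_sym (negbTE ji) mulr0.
rewrite [p`_i]nth_default // mulr0 big1 // => j _.
by rewrite exprZn scalerA coefZ coefXn gtn_eqF ?mulr0 // (leq_trans (ltn_ord j)).
Qed.

Lemma series_content (R : idomainType) (P : {poly series R}) : P != 0 ->
  exists a P1, P = (sX R a)%:P * P1 /\ map_poly (@s0 R) P1 != 0.
Proof.
move=> P0; have ex : exists a, slice a P != 0.
  apply: boolp.contrapT => h; move/eqP: P0; apply; apply: slice_inj => a.
  apply/eqP; have -> : slice a (0 : {poly series R}) = 0.
    by apply/polyP => i; rewrite coef_slice !coef0.
  by apply: boolp.contrapT => /negP ha; apply: h; exists a.
case: (ex_minnP ex) => a ha hmin.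
have [|P1 eP1] := @poly_div_const _ (sX R a) P.
  move=> i; apply: sX_div => t hta; rewrite -coef_slice.
  have /eqP -> : slice t P == 0; last by rewrite coef0.
  by apply: contraTT hta => /hmin; rewrite -leqNgt.
exists a, P1; split=> //; apply: contraNneq ha => h; apply/eqP/polyP => i.
rewrite coef_slice eP1 coefCM coef_sXM ltnn subnn coef0.
by have := congr1 (fun p : {poly R} => p`_i) h; rewrite coef_map coef0.
Qed.

(* Gauss's lemma for the content with respect to w, after Y -> w^M Y. *)
Lemma content_bound (R : idomainType) (g h : {poly series R}) n M :
  g \is monic -> h \is monic -> size (g * h) = n.+1 ->
  (forall i, (i < n)%N -> exists u, (g * h)`_i = sX R (M * (n.-1 - i)) * u) ->
  forall l, (l.+1 <= n.-1)%N ->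
  exists u, (g^`() * h)`_l = sX R (M * (n.-1 - l.+1)) * u.
Proof.
move=> mg mh sgh hF l hl; pose c := sX R M.
have c0 : c != 0 by exact: sX_neq0.
have nz (p : {poly series R}) : p \is monic -> p \Po (c *: 'X) != 0.
  move=> mp; apply: contra_neq (monic_neq0 mp) => e; apply/polyP => i.
  have := congr1 (fun p : {poly series R} => p`_i) e.
  rewrite coef_comp_scaleX coef0 => /eqP; rewrite mulf_eq0 expf_eq0 (negbTE c0) andbF.
  by move/eqP.
have [a [A1 [eA A10]]] := series_content (nz _ mg).
have [b [B1 [eB B10]]] := series_content (nz _ mh).
have eAB : (g * h) \Po (c *: 'X) = (sX R (a + b))%:P * (A1 * B1).
  by rewrite comp_polyM eA eB sXD polyCM; ring.
(* Every coefficient of the rescaled product is divisible by w^(M(n-1)); a smaller content would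
   make the product of the two nonzero reductions vanish. *)
have ab : (M * n.-1 <= a + b)%N.
  rewrite leqNgt; apply/negP => hab.
  have : map_poly (@s0 R) (A1 * B1) = 0.
    apply/polyP => i; rewrite coef_map coef0 /=.
    have := congr1 (fun p : {poly series R} => p`_i (a + b)%N) eAB.
    rewrite coefCM coef_sXM ltnn subnn coef_comp_scaleX -[_ 0%N]/(s0 _) => <-.
    have [hi|hi] := ltnP i n.
      have [u ->] := hF i hi; rewrite sXX mulrA -sXD -mulnDr coef_sXM.
      by rewrite subnKC ?hab //; lia.
    rewrite sXX coef_sXM (leq_trans hab) // leq_mul2l; apply/orP; right.
    by rewrite (leq_trans (leq_pred _)).
  by rewrite rmorphM => /eqP; rewrite mulf_eq0 (negbTE A10) (negbTE B10).
have e1 : c%:P * ((g^`() * h) \Po (c *: 'X)) = (sX R (a + b))%:P * (A1^`() * B1).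
  have := congr1 (@deriv _) eA; rewrite deriv_comp derivZ derivX derivM derivC mul0r add0r => e2.
  rewrite comp_polyM eB sXD polyCM; transitivity (((g^`() \Po (c *: 'X)) * (c *: 1)) *
    ((sX R b)%:P * B1)); first by rewrite -[c *: 1]mul_polyC mulr1 mulrA [c%:P * _]mulrC.
  by rewrite e2; ring.
have := congr1 (fun p : {poly series R} => p`_l) e1.
rewrite !coefCM coef_comp_scaleX mulrA -exprS sXX => e2.
exists (sX R (a + b - M * n.-1) * (A1^`() * B1)`_l).
apply: (@sX_inj _ (M * l.+1)); rewrite e2 !mulrA -!sXD; congr (sX _ _ * _).
have := leq_mul (leqnn M) hl; rewrite mulnBr; lia.
Qed.

(** * Charts at finite points and at infinity, and bounds on T-degrees *)

Section Charts.
Variables (k L : closedFieldType) (V : idomainType).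
Variables (iV : {rmorphism V -> L}) (hV : {rmorphism V -> k}).
Hypothesis plV : is_place iV hV.
Variable jV : {rmorphism {poly k} -> V}.
Hypothesis hjV : forall p, hV (jV p) = p.[0].
Hypothesis jV_X : jV 'X != 0.

Local Notation red := (map_poly (horner_eval (0 : k))).
Local Notation Red := (map_poly red).
Local Notation eps j := (('X^j : {poly k})%:P%:P : {poly {poly {poly k}}}).

Variables (F : {poly {poly {poly k}}}) (n : nat).
Hypothesis mF : F \is monic.
Hypothesis sF : size F = n.+1.
Hypothesis n_gt1 : (1 < n)%N.
Hypothesis tameL : tame L n.
Variables Gb Hb : {poly {poly k}}.
Hypothesis mGb : Gb \is monic.
Hypothesis mHb : Hb \is monic.
Hypothesis eF : Red F = Gb * Hb.

Let nL : n%:R != 0 :> L. Proof. by apply: tameL; rewrite leqnn ltnW. Qed.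

Lemma natV_neq0 : n%:R != 0 :> V.
Proof. by apply: contraNneq nL => e; rewrite -(rmorph_nat iV) e rmorph0. Qed.

Lemma natS_neq0 : n%:R != 0 :> series V.
Proof.
rewrite -(rmorph_nat (@ps V)) -(rmorph0 (@ps V)) (inj_eq (@ps_inj V)).
by rewrite -(rmorph_nat (@polyC V)) polyC_eq0 natV_neq0.
Qed.

Lemma red_jV p : map_poly hV (map_poly jV p) = red p.
Proof.
by rewrite -map_poly_comp; apply: eq_map_poly => c; rewrite /= hjV.
Qed.

(** Taylor expansion at T = tau, with w = T - tau; [evb_at] is its reduction at the place. *)
Definition ev_at (tau : V) : {rmorphism {poly {poly k}} -> series V} :=
  GRing.RMorphism.clone _ _ (@ps V \o comp_poly ('X + tau%:P) \o map_poly jV) _.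
Definition evb_at (a : k) : {rmorphism {poly k} -> series k} :=
  GRing.RMorphism.clone _ _ (@ps k \o comp_poly ('X + a%:P)) _.

Lemma ev_at_red tau p : map_series hV (ev_at tau p) = evb_at (hV tau) (red p).
Proof.
rewrite /= map_series_ps -red_jV; congr (ps _).
by rewrite map_comp_poly map_polyD map_polyX map_polyC.
Qed.

Lemma ev_at_const tau c : ev_at tau c%:P = ps (jV c)%:P.
Proof. by rewrite /= map_polyC /= comp_polyC. Qed.

Lemma evb_at0 a p : evb_at a p 0%N = p.[a].
Proof.
by rewrite /= -horner_coef0 horner_comp !hornerE.
Qed.

Lemma evb_at_inj a : injective (evb_at a).
Proof. by move=> p q /(@ps_inj k) /(@comp_XaddC_inj _ a). Qed.

Hypothesis good : forall a, exists tau c, hV tau = a /\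
  has_unit_order (ev_at tau (resultant F F^`())) c.

(** The discriminant at T = tau + w is a power of w times a unit, so no branch point other than tau
    reduces to a. This is exactly what the local factorization requires. *)
Lemma finite_charts a : exists ev evb g h, @finite_chart k V hV jV F Gb Hb a ev evb g h.
Proof.
have [tau [c [htau oR]]] := good a.
pose P := map_poly (ev_at tau) F.
have mP : P \is monic by rewrite monic_map.
have sP : size P = n.+1 by rewrite size_map_monic.
have ePb : map_poly (map_series hV) P = map_poly (evb_at a) Gb * map_poly (evb_at a) Hb.
  rewrite -map_polyM -eF -htau /P -!map_poly_comp; apply: eq_map_poly => p.
  exact: ev_at_red.
have mGbb : map_poly (evb_at a) Gb \is monic by rewrite monic_map.
have oR' : has_unit_order (resultant P P^`()) c.
  by rewrite /P -(map_discriminant _ mF sF (ltnW n_gt1) natS_neq0).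
have [N [hN [g [h [al [be [s [c' [[mg mh eP] [eg eh bez os]]]]]]]]]] :=
  local_factor plV mP sP n_gt1 tameL oR' mGbb ePb.
exists (GRing.RMorphism.clone _ _ (ssub hN \o ev_at tau) _),
  (GRing.RMorphism.clone _ _ (ssub hN \o evb_at a) _), g, h; split.
- split=> //.
  + move=> p; transitivity (ssub hN (evb_at a (red p))) => //.
    by rewrite -htau -ev_at_red; exact: map_ssub.
  + move=> d; transitivity (ssub hN (ev_at tau d%:P)) => //.
    by rewrite ev_at_const ssub_ps comp_polyC.
  + by rewrite -eP -map_poly_comp.
  + by rewrite eg -map_poly_comp.
  + by rewrite eh -map_poly_comp.
  + by exists al, be, s, c'.
- by move=> p q e; apply: (@evb_at_inj a); apply: (@ssub_inj _ _ hN); exact: e.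
- move=> p; transitivity (ssub hN (evb_at a p) 0%N) => //.
  by rewrite coef_ssub dvdn0 div0n evb_at0.
Qed.

(** The reduction of the discriminant is nonzero, because a coefficient of its expansion is a unit
    of V; reducing the Bezout relation of F and F_Y shows that Gb and Hb are coprime over k(T). *)
Lemma red_disc_bezout : exists Db a0 b0, Db != 0 /\ a0 * Gb + b0 * Hb = Db%:P.
Proof.
have [tau [c [_ [_ oR]]]] := good 0.
have nP : n%:R != 0 :> {poly {poly k}}.
  by apply: contraNneq natS_neq0 => e; rewrite -(rmorph_nat (ev_at tau)) e rmorph0.
have [_ sF'] := lead_deriv_monic mF sF (ltnW n_gt1) nP.
have sF1 : (1 < size F)%N by rewrite sF ltnS ltnW.
have sF1' : (1 < size F^`())%N by rewrite sF'.
have [[u v] _ /= euv] := resultant_in_ideal sF1 sF1'.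
have := congr1 Red euv; rewrite map_polyC /= map_polyD !map_polyM -deriv_map eF derivM => e.
exists (red (resultant F F^`())), (Red u * Hb + Red v * Hb^`()), (Red v * Gb^`()); split.
  have uc : hV (ev_at tau (resultant F F^`()) c) != 0 by rewrite -(place_unitE plV).
  apply: contraNneq uc => e0; rewrite -coef_map_series ev_at_red e0 rmorph0.
  by rewrite coef_s0.
by rewrite e; ring.
Qed.

(** V is much larger than k[eps], but [hV] after [jV] is evaluation at eps = 0, so factors of eps
    can be removed one by one. *)
Lemma jV_dvd j p v : jV p = jV 'X^j * v -> exists q, p = 'X^j * q.
Proof.
elim: j p => [|j IH] p e; first by exists p; rewrite expr0 mul1r.
have : root p 0.
  apply/rootP; rewrite -hjV e rmorphM exprS rmorphM rmorphM hjV hornerX.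
  by rewrite !mul0r.
case/factor_theorem => q eq; rewrite subr0 in eq.
have [|q' eq'] := IH q; last by exists q'; rewrite eq eq' exprS; ring.
apply: (mulIf jV_X); rewrite -rmorphM -eq e exprS rmorphM; ring.
Qed.

Section Infinity.
Variable m : nat.
Hypothesis bF : forall i, (size (F`_i)%R <= m.+1)%N.
Hypothesis lcD : (lead_coef (resultant F F^`())).[0] != 0.

Local Notation toV := (map_poly (map_poly jV)).

Lemma st_ok_monic (R : comNzRingType) r (G : {poly {poly R}}) : G \is monic ->
  size G = r.+1 -> (forall i, (size (G`_i)%R <= m.+1)%N) -> st_ok m 0 r G.
Proof.
move=> mG sG bG; split=> [|i]; first by rewrite sG.
rewrite leq_eqVlt => /orP[/eqP ->|hi].
  have -> : G`_r = 1 by move/monicP: mG; rewrite lead_coefE sG.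
  by rewrite size_poly1.
by rewrite (leq_trans (bG i)) // ltnS add0n leq_pmulr // subn_gt0.
Qed.

(** F near T = infinity, in the coordinates w = 1/T and w^m Y, in which it stays monic. *)
Definition Pinf : {poly series V} := st m 0 n (toV F).

Lemma mtoV : toV F \is monic /\ size (toV F) = n.+1.
Proof. by rewrite monic_map // size_map_monic. Qed.

Lemma toV_coef G i e : (toV G)`_i`_e = jV G`_i`_e.
Proof. by rewrite coef_map /= coef_map. Qed.

Lemma size_toV G i : (size ((toV G)`_i)%R <= size (G`_i)%R)%N.
Proof. by rewrite coef_map /= size_poly. Qed.

Lemma ok_toVF : st_ok m 0 n (toV F).
Proof.
apply: st_ok_monic; rewrite ?mtoV.1 ?mtoV.2 // => i.
exact: leq_trans (size_toV _ _) (bF i).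
Qed.

Lemma unit_order_cancel (R : idomainType) (s r : series R) A B :
  s * sX R A = sX R B * r -> r 0%N \is a GRing.unit -> exists c, has_unit_order s c.
Proof.
move=> e ru; rewrite mulrC in e.
have co i : (sX R A * s) i = (sX R B * r) i by rewrite e.
have AB : (A <= B)%N.
  rewrite leqNgt; apply/negP => h; have := co B; rewrite !coef_sXM h ltnn subnn => r0.
  by rewrite -r0 unitr0 in ru.
exists (B - A)%N; split=> [i hi|].
  have := co (A + i)%N; rewrite !coef_sXM ltnNge leq_addr addKn /=.
  by rewrite -ltn_subRL hi.
have := co B; rewrite !coef_sXM ltnNge AB ltnn subnn /= => ->.
by [].
Qed.

(** Up to powers of w this discriminant is D(1/w), whose lowest coefficient after reversal is the
    leading coefficient of D, a unit by [lcD]: no branch point moves to infinity. *)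
Lemma Pinf_disc : exists c, has_unit_order (resultant Pinf Pinf^`()) c.
Proof.
pose K : fieldType := {fraction series V}; pose tf : {rmorphism series V -> K} := @tofrac (series V).
pose x : K := tf (sX V 1).
have x0 : x != 0 by rewrite tofrac_eq0 sX_neq0.
have tfI : injective tf by move=> a b /eqP; rewrite tofrac_eq => /eqP.
(* The substitution T = 1/w, which needs the fraction field of V[[w]]. *)
pose phi : {rmorphism {poly V} -> K} := GRing.RMorphism.clone _ _
  (horner_eval x^-1 \o map_poly (tf \o @ps V \o @polyC V)) _.
have xE d : tf (sX V d) = x ^+ d by rewrite /x -rmorphXn sXX mul1n.
have phiE d (p : {poly V}) : (size p <= d.+1)%N -> tf (ps (rv d p)) = x ^+ d * phi p.
  move=> sp; rewrite rvE !rmorph_sum /= /horner_eval (@horner_coef_wide _ d.+1).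
    rewrite mulr_sumr; apply: eq_bigr => e _; rewrite coef_map /= -mul_polyC !rmorphM /=.
    rewrite -/(sX V _) [X in _ * X]xE mulrCA; congr (_ * _).
    have ed : (e <= d)%N by rewrite -ltnS.
    by rewrite -[X in _ = x ^+ X * _](subnK ed) exprD -mulrA -exprMn divff // expr1n mulr1.
  by rewrite (leq_trans (size_poly _ _)).
pose p := map_poly phi (toV F); pose p' := map_poly tf Pinf.
have [mP sP] : Pinf \is monic /\ size Pinf = n.+1 by apply: st_monic; rewrite ?mtoV.1 ?mtoV.2.
have mp : p \is monic by rewrite monic_map ?mtoV.1.
have sp : size p = n.+1 by rewrite size_map_monic ?mtoV.1 ?mtoV.2.
have mp' : p' \is monic by rewrite monic_map.
have sp' : size p' = n.+1 by rewrite size_map_monic.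
have nK : n%:R != 0 :> K.
  by rewrite -(rmorph_nat tf) tofrac_eq0 natS_neq0.
have n0 : (0 < n)%N by exact: ltnW.
have [lp sdp] := lead_deriv_monic mp sp n0 nK.
have [lp' sdp'] := lead_deriv_monic mp' sp' n0 nK.
have cp i : (i <= n)%N -> p'`_i = (x ^+ m) ^+ (n - i) * p`_i.
  move=> hi; rewrite /p [in RHS]coef_map coef_map coef_st // -exprM /= phiE ?add0n //.
  by have [_ /(_ i hi)] := ok_toVF.
have [|||a [b eab]] := @resultant_scale K (x ^+ m) p p^`() p' p'^`() n n.-1 (expf_neq0 _ x0)
    sp _ sp' _ cp.
- by rewrite prednK.
- by rewrite prednK.
- move=> i hi; rewrite !coef_deriv cp; last by rewrite -(prednK n0) ltnS.
  by rewrite mulrnAr -{1}(prednK n0) subSS.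
have nVP : n%:R != 0 :> {poly V}.
  by apply: contraNneq natS_neq0 => e; rewrite -(rmorph_nat (@ps V)) e rmorph0.
have D0V : map_poly jV (resultant F F^`()) = resultant (toV F) (toV F)^`().
  exact: (map_discriminant (map_poly jV) mF sF n0 nVP).
have e1 : tf (resultant Pinf Pinf^`()) = resultant p' p'^`().
  exact: map_discriminant mP sP n0 nK.
have e2 : phi (map_poly jV (resultant F F^`())) = resultant p p^`().
  by rewrite D0V; exact: map_discriminant mtoV.1 mtoV.2 n0 nK.
set D := resultant F F^`() in e2 *; pose d := (size D).-1.
have sD : (size (map_poly jV D) <= d.+1)%N.
  by rewrite (leq_trans (size_poly _ _)) // leqSpred.
apply: (@unit_order_cancel _ _ (ps (rv d (map_poly jV D))) (m * a + d) (m * b)).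
  apply: tfI; rewrite !rmorphM /= !xE phiE // e1 e2 exprD !exprM mulrA eab.
  by rewrite -!mulrA; congr (_ * _); rewrite mulrC.
rewrite coef_ps coef_rv // subn0 coef_map /= -lead_coefE.
by rewrite (place_unitE plV) hjV.
Qed.

Lemma size_coef_factor (R : idomainType) (G H : {poly {poly R}}) : G != 0 -> H != 0 ->
  (forall i, (size ((G * H)`_i)%R <= m.+1)%N) -> forall i, (size (G`_i)%R <= m.+1)%N.
Proof.
move=> G0 H0 h i; apply: leq_trans (max_size_coefXY _ _) _.
have : (sizeY (G * H) <= m.+1)%N by apply/bigmax_leqP.
rewrite !sizeYE rmorphM size_mul ?swapXY_eq0 //; apply: leq_trans.
have : (0 < size (swapXY H))%N by rewrite size_poly_gt0 swapXY_eq0.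
by case: (size (swapXY H)) => // e _; rewrite addnS leq_addr.
Qed.

Section CompareInf.
Variables (j r s : nat) (G H E : {poly {poly {poly k}}}).
Hypothesis mG : G \is monic.
Hypothesis mH : H \is monic.
Hypothesis rG : Red G = Gb.
Hypothesis rH : Red H = Hb.
Hypothesis sGb : size Gb = r.+1.
Hypothesis sHb : size Hb = s.+1.
Hypothesis e : F = G * H + eps j * E.

(** The analogue of [chart_compare] at infinity. The T-degrees of G and H are not controlled yet, so
    their reversals are taken with an excess D, and g, h are compared with them after multiplication
    by w^(ND). *)
Lemma compare_inf : exists N D (g h : {poly series V}) (hN : (0 < N)%N),
  [/\ g \is monic, h \is monic, size g = r.+1, size h = s.+1 &
     map_poly (ssub hN) Pinf = g * h] /\
  [/\ st_ok m D r (toV G), st_ok m D s (toV H),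
     exists gam, (sX V (N * D))%:P * g =
       map_poly (ssub hN) (st m D r (toV G)) + (ps (jV 'X^j)%:P)%:P * gam &
     exists eta, (sX V (N * D))%:P * h =
       map_poly (ssub hN) (st m D s (toV H)) + (ps (jV 'X^j)%:P)%:P * eta].
Proof.
have rs : (r + s)%N = n := deg_split mF sF mGb mHb eF sGb sHb.
have [c oR] := Pinf_disc.
have [mP sP] : Pinf \is monic /\ size Pinf = n.+1 by apply: st_monic; rewrite ?mtoV.1 ?mtoV.2.
have bFb i : (size ((Gb * Hb)`_i)%R <= m.+1)%N.
  by rewrite -eF coef_map (leq_trans (size_poly _ _)).
have bGb := size_coef_factor (monic_neq0 mGb) (monic_neq0 mHb) bFb.
have bHb := @size_coef_factor _ Hb Gb (monic_neq0 mHb) (monic_neq0 mGb).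
rewrite [Hb * Gb]mulrC in bHb; have {}bHb := bHb bFb.
have okG := st_ok_monic mGb sGb bGb; have okH := st_ok_monic mHb sHb bHb.
have rV X : map_poly (map_poly hV) (toV X) = Red X.
  rewrite -map_poly_comp; apply: eq_map_poly => p; exact: red_jV.
have ePb : map_poly (map_series hV) Pinf = st m 0 r Gb * st m 0 s Hb.
  by rewrite map_st rV eF -rs -stM.
have [mgb _] := st_monic m mGb sGb.
have [N [hN [g [h [al [be [s0 [c' [[mg mh eP] [eg eh bez os]]]]]]]]]] :=
  local_factor plV mP sP n_gt1 tameL oR mgb ePb.
have sg : size g = r.+1.
  rewrite -(size_map_monic (map_series hV) mg) eg size_map_monic //.
  exact: (st_monic m mGb sGb).2.
have sh : size h = s.+1.
  rewrite -(size_map_monic (map_series hV) mh) eh.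
  by have [h1 h2] := st_monic m mHb sHb; rewrite size_map_monic.
(* Any common bound for the T-degrees of G, H and E would do. *)
pose D := (sizeY G + sizeY H + sizeY E)%N.
have bound (X : {poly {poly {poly k}}}) : (sizeY X <= D)%N ->
    forall i a, (size ((toV X)`_i)%R <= (D + a).+1)%N.
  move=> hX i a; rewrite (leq_trans (size_toV _ _)) // (leq_trans (max_size_coefXY _ _)) //.
  by rewrite (leq_trans hX) // ltnW // ltnS leq_addr.
have sG : size G = r.+1 by rewrite -sGb -rG size_map_monic.
have sH : size H = s.+1 by rewrite -sHb -rH size_map_monic.
have oG : st_ok m D r (toV G).
  by split=> [|i _]; [rewrite (leq_trans (size_poly _ _)) ?sG | exact: bound (leq_trans (leq_addr _ _) (leq_addr _ _)) _ _].
have oH : st_ok m D s (toV H).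
  by split=> [|i _]; [rewrite (leq_trans (size_poly _ _)) ?sH | exact: bound (leq_trans (leq_addl _ _) (leq_addr _ _)) _ _].
pose sig : {rmorphism {poly series V} -> {poly series V}} := map_poly (ssub hN).
pose q := sX V (N * D); pose pi := (ps (jV 'X^j)%:P : series V).
pose Gt := sig (st m D r (toV G)); pose Ht := sig (st m D s (toV H)).
pose Et := sig (st m (D + D) n (toV E)).
have sigC (t : series V) : sig t%:P = (ssub hN t)%:P by rewrite /sig /= map_polyC.
have eP2 : (q * q)%:P * (g * h) = Gt * Ht + pi%:P * Et.
  have eV : toV F = toV G * toV H + (jV 'X^j)%:P%:P * toV E.
    by rewrite e map_polyD !map_polyM map_polyC /= map_polyC.
  have := congr1 (st m (D + D) n) eV; rewrite stD st_const -{2}rs stM //.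
  have := st_shift (D + D)%N ok_toVF; rewrite addn0 => -> h1; have := congr1 sig h1.
  rewrite rmorphD !rmorphM /= !sigC /= -/Gt -/Ht -/Et -/Pinf => h2.
  rewrite -eP /q -?polyCM -sXD -mulnDr -ssub_sX; apply: (etrans h2).
  by rewrite ssub_ps comp_polyC.
have sz (g0 : {poly series V}) (X : {poly {poly {poly k}}}) r0 : g0 \is monic -> size g0 = r0.+1 ->
    X \is monic -> size X = r0.+1 -> (size (q%:P * g0 - sig (st m D r0 (toV X)))%R < size g0)%N.
  move=> mg0 sg0 mX sX0; rewrite sg0 ltnS; apply/leq_sizeP => l.
  rewrite leq_eqVlt => /orP[/eqP <-|hl]; last first.
    rewrite coefB coefCM !nth_default ?mulr0 ?subrr ?sg0 //.
    by rewrite (leq_trans (size_poly _ _)) // (leq_trans (size_st _ _ _ _)).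
  rewrite coefB coefCM /sig coef_map coef_st // subnn muln0 addn0 /=.
  have -> : g0`_r0 = 1 by move/monicP: mg0; rewrite lead_coefE sg0.
  have -> : (toV X)`_r0 = 1.
    by rewrite coef_map; move/monicP: mX; rewrite lead_coefE sX0 => ->; exact: rmorph1.
  by rewrite -(expr0 'X) rvXn // subn0 -/(sX V D) ssub_sX mulr1 subrr.
have cm (g0 : {poly series V}) (X : {poly {poly {poly k}}}) r0 Xb : Red X = Xb ->
    map_poly (map_series hV) g0 = map_poly (ssub hN) (st m 0 r0 Xb) -> st_ok m 0 r0 Xb ->
    forall l t, hV ((q%:P * g0 - sig (st m D r0 (toV X)))`_l t) = 0.
  move=> rX eg0 okX l t; rewrite -coef_map_series.
  suff h0 : map_poly (map_series hV) (q%:P * g0 - sig (st m D r0 (toV X))) = 0.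
    have := congr1 (fun p : {poly series k} => p`_l) h0.
    by rewrite coef_map coef0 => hc; exact: (congr1 (fun z : series k => z t) hc).
  rewrite map_polyB map_polyM eg0 map_polyC /= map_series_sX.
  have -> : map_poly (map_series hV) (sig (st m D r0 (toV X))) =
      map_poly (ssub hN) (map_poly (map_series hV) (st m D r0 (toV X))).
    rewrite /sig /= -!map_poly_comp; apply: eq_map_poly => a; exact: map_ssub.
  rewrite map_st rV rX; have := st_shift D okX; rewrite addn0 => ->.
  rewrite map_polyM map_polyC /= ssub_sX.
  by rewrite subrr.
have eqn : q%:P * ((q%:P * g - Gt) * h + g * (q%:P * h - Ht)) =
    (q%:P * g - Gt) * (q%:P * h - Ht) + pi%:P * Et.
  by apply: factor_perturbation; rewrite -polyCM.
have oq : has_unit_order q (N * D).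
  split=> [i hi|]; first by rewrite coef_ps coefXn (ltn_eqF hi).
  by rewrite coef_ps coefXn eqxx unitr1.
have key := hensel_unique plV mg mh (sz _ _ _ mg sg mG sG) (sz _ _ _ mh sh mH sH) bez os oq eqn
  (cm _ _ _ _ rG eg okG) (cm _ _ _ _ rH eh okH).
have dv (X : {poly series V}) : (forall l t, exists v, X`_l t = jV 'X^j * v) ->
    exists Y, X = pi%:P * Y.
  move=> hX; apply: poly_div_const => l.
  exists (Series (fun t => projT1 (boolp.cid (hX l t)))); apply/seriesP => t.
  rewrite coef_sM big_ord_recl big1 ?addr0 /=; last by move=> i _; rewrite coefC mul0r.
  by rewrite subn0 coefC /=; case: boolp.cid.
have [gam egam] := dv _ (fun l t => (key l t).1).
have [eta eeta] := dv _ (fun l t => (key l t).2).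
exists N, D, g, h, hN; split=> //; split=> //.
  by exists gam; rewrite -egam addrC subrK.
by exists eta; rewrite -eeta addrC subrK.
Qed.

Lemma coef_series_const (v : V) (X : {poly series V}) l t :
  ((ps v%:P)%:P * X)`_l t = v * X`_l t.
Proof.
rewrite coefCM coef_sM big_ord_recl big1 ?addr0 /= ?subn0 ?coefC //.
by move=> i _; rewrite coefC mul0r.
Qed.

(** In the reversal of G the coefficient of T^a with a > mn stands below w^D, whereas w^(ND) g has
    no term below w^(ND); so it vanishes modulo eps^j. *)
Lemma lift_bounded_coef i a : (m * n < a)%N ->
  (exists q, G`_i`_a = 'X^j * q) /\ (exists q, H`_i`_a = 'X^j * q).
Proof.
move=> ha; have [N [D [g [h [hN [[mg mh sg sh eP] [oG oH [gam eg] [eta eh]]]]]]]] := compare_inf.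
have rs : (r + s)%N = n := deg_split mF sF mGb mHb eF sGb sHb.
have gen (X : {poly {poly {poly k}}}) r0 (g0 gam0 : {poly series V}) : (r0 <= n)%N ->
    st_ok m D r0 (toV X) ->
    (sX V (N * D))%:P * g0 = map_poly (ssub hN) (st m D r0 (toV X)) + (ps (jV 'X^j)%:P)%:P * gam0 ->
    exists q, X`_i`_a = 'X^j * q.
  move=> r0n [sX bX] e0.
  suff [v ev] : exists v, jV X`_i`_a = jV 'X^j * v by exact: jV_dvd ev.
  have [hi|hi] := leqP i r0; last first.
    exists 0; rewrite mulr0 -toV_coef [(toV X)`_i]nth_default ?coef0 //.
    exact: leq_trans sX hi.
  have [hK|hK] := leqP a (D + m * (r0 - i)); last first.
    exists 0; rewrite mulr0 -toV_coef nth_default //.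
    exact: leq_trans (bX i hi) hK.
  pose t := (D + m * (r0 - i) - a)%N.
  have tD : (t < D)%N.
    have : (m * (r0 - i) < a)%N.
      by apply: leq_ltn_trans ha; rewrite leq_mul2l (leq_trans (leq_subr _ _)) ?orbT.
    by rewrite /t; move: (m * _)%N hK; clear; lia.
  exists (- gam0`_i (N * t)%N).
  have := congr1 (fun X : {poly series V} => X`_i (N * t)%N) e0.
  rewrite coefCM coefD coef_sD coef_series_const coef_sXM ltn_pmul2l // tD coef_map coef_st //.
  rewrite [X in X + _]coef_ssub dvdn_mulr // mulKn // coef_ps coef_rv ?leq_subr // subKn //.
  by rewrite toV_coef => /esym/eqP; rewrite addr_eq0 mulrN => /eqP.
by split; [apply: gen oG eg | apply: gen oH eh]; rewrite -rs ?leq_addr ?leq_addl.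
Qed.

(** Bounding G and H separately gives only mn. The content with respect to w bounds G_Y H directly
    by m, the T-degree that Ruppert's theorem admits for Q. *)
Lemma lift_bounded_log l a : (m < a)%N -> exists q, (G^`() * H)`_l`_a = 'X^j * q.
Proof.
move=> ha; have [N [D [g [h [hN [[mg mh sg sh eP] [oG oH [gam eg] [eta eh]]]]]]]] := compare_inf.
have rs : (r + s)%N = n := deg_split mF sF mGb mHb eF sGb sHb.
have [r0|r_gt0] := posnP r.
  have sG1 : size G = 1%N by rewrite -(size_map_monic (map_poly (horner_eval (0 : k))) mG) rG sGb r0.
  have -> : G^`() = 0 by rewrite [G]size1_polyC ?sG1 // derivC.
  by exists 0; rewrite mul0r !coef0 mulr0.
set Q := G^`() * H.
have er : r = r.-1.+1 by rewrite prednK.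
have oG' : st_ok m D r.-1 (toV G^`()).
  have [h1 h2] := oG; split=> [|i hi].
    by rewrite -deriv_map (leq_trans (size_poly _ _)) // -er; case: (size _) h1.
  rewrite -deriv_map coef_deriv -mulr_natr -(rmorph_nat (@polyC V)) mulrC mul_polyC.
  apply: leq_trans (size_scale_leq _ _) (leq_trans (h2 _ _) _); first by rewrite er ltnS.
  by rewrite ltnS leq_add2l leq_mul2l {1}er subSS leqnn orbT.
have en1 : n.-1 = (r.-1 + s)%N by rewrite -rs er.
have oQ : st_ok m (D + D) n.-1 (toV Q).
  rewrite en1.
  by rewrite /Q map_polyM; apply: st_okM.
suff [v ev] : exists v, jV Q`_l`_a = jV 'X^j * v by exact: jV_dvd ev.
have [hl|hl] := leqP l n.-1; last first.
  exists 0; rewrite mulr0 -toV_coef [(toV Q)`_l]nth_default ?coef0 //.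
  exact: leq_trans oQ.1 hl.
have [hK|hK] := leqP a (D + D + m * (n.-1 - l)); last first.
  exists 0; rewrite mulr0 -toV_coef nth_default //.
  exact: leq_trans (oQ.2 l hl) hK.
(* As each F_i has T-degree at most m, the coefficient of Y^i in [Pinf], for i < n, is divisible by
   w^(m(n-1-i)); [content_bound] applies with M = Nm after ramification. For l = n-1 the truncated
   exponent is 0 and nothing is claimed. *)
have [u eu] : exists u, ((sX V (N * D) * sX V (N * D))%:P * (g^`() * h))`_l =
    sX V (N * (D + D + m * (n.-2 - l))) * u.
  have cm : exists u, (g^`() * h)`_l = sX V (N * m * (n.-2 - l)) * u.
    have [hl2|hl2] := leqP l.+1 n.-1.
      have := @content_bound _ g h n (N * m) mg mh _ _ l hl2.
      have -> : (n.-1 - l.+1 = n.-2 - l)%N by rewrite subnS -subn1 subnAC subn1.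
      apply; first by rewrite size_mul ?monic_neq0 // sg sh addnS addSn rs.
      move=> i hi; rewrite -eP coef_map /Pinf coef_st /=; last by exact: ltnW.
      exists (ssub hN (ps (rv m (toV F)`_i))).
      rewrite -mulnA -ssub_sX -rmorphM /= -rmorphM; congr (ssub _ (ps _)).
      have -> : (0 + m * (n - i) = m * (n.-1 - i) + m)%N.
        have n0 := ltnW n_gt1; rewrite add0n -mulnSr -subSn ?(prednK n0) //.
        by rewrite -ltnS (prednK n0).
      rewrite -[X in rv _ X]mul1r rvM ?size_poly1 //; last first.
        by rewrite (leq_trans (size_toV _ _)).
      by congr (_ * _); rewrite -(expr0 'X) rvXn // subn0.
    exists (g^`() * h)`_l; have -> : (n.-2 - l = 0)%N by apply/eqP; rewrite subn_eq0 (leq_trans (leq_pred _)).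
    by rewrite muln0 sX0 mul1r.
  have [u eu] := cm; exists u; rewrite coefCM eu -!sXD mulrA -sXD; congr (sX _ _ * _).
  by rewrite !mulnDr mulnA.
have eQ : (sX V (N * D) * sX V (N * D))%:P * (g^`() * h) =
    map_poly (ssub hN) (st m (D + D) n.-1 (toV Q)) + (ps (jV 'X^j)%:P)%:P *
    (gam^`() * ((sX V (N * D))%:P * h) + (map_poly (ssub hN) (st m D r (toV G)))^`() * eta).
  rewrite {1}en1 /Q map_polyM stM // -deriv_map -st_deriv -er map_polyM.
  rewrite -deriv_map.
  have e1 := congr1 (@deriv _) eg; rewrite derivD !derivM !derivC !mul0r !add0r in e1.
  transitivity (((sX V (N * D))%:P * g^`()) * ((sX V (N * D))%:P * h)); first by rewrite polyCM; ring.
  by rewrite e1 mulrDl {1}eh; ring.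
pose t := (D + D + m * (n.-1 - l) - a)%N.
exists (- (gam^`() * ((sX V (N * D))%:P * h) +
  (map_poly (ssub hN) (st m D r (toV G)))^`() * eta)`_l (N * t)%N).
have := congr1 (fun X : {poly series V} => X`_l (N * t)%N) eQ.
rewrite eu coefD coef_sD coef_series_const coef_sXM ltn_pmul2l //.
have -> : (t < D + D + m * (n.-2 - l))%N.
  rewrite /t; have : (m * (n.-1 - l) <= m * (n.-2 - l) + m)%N.
    by rewrite -mulnSr leq_mul2l; apply/orP; right; move: (n); clear; lia.
  move: hK ha; move: (m * _)%N (m * _)%N; clear; lia.
rewrite coef_map coef_st // [X in X + _]coef_ssub dvdn_mulr // mulKn // coef_ps coef_rv ?leq_subr //.
rewrite subKn // toV_coef => /esym/eqP.
by rewrite addr_eq0 mulrN => /eqP.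
Qed.

End CompareInf.

End Infinity.
End Charts.

(** * The linear system over the parameter ring *)

Lemma fraction_denom (A : idomainType) (x : {fraction A}) :
  exists d a : A, d != 0 /\ tofrac d * x = tofrac a.
Proof.
have [[[a d] d0] ->] : exists r : {ratio A}, x = (\pi_{fraction A} r)%qT.
  by exists (repr x); rewrite reprK.
exists d, a; split=> //; rewrite !piE; apply/eqmodP => /=.
rewrite /FracField.equivf /FracField.mulf /= !numden_Ratio ?oner_neq0 ?mul1r ?mulr1 //.
Qed.

Lemma common_denom (A : idomainType) (I : eqType) (x : I -> {fraction A}) (s : seq I) :
  exists2 d : A, d != 0 & forall i, i \in s -> exists a, tofrac d * x i = tofrac a.
Proof.
elim: s => [|i s [d d0 hd]]; first by exists 1; rewrite ?oner_neq0.
have [e [a [e0 ea]]] := fraction_denom (x i).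
exists (d * e); first exact: mulf_neq0.
move=> i'; rewrite inE => /predU1P[->|/hd[b eb]].
  by exists (d * a); rewrite !rmorphM -mulrA ea.
by exists (e * b); rewrite !rmorphM [tofrac d * _]mulrC -mulrA eb.
Qed.

(** Injectivity is known over L, where Ruppert's theorem lives. Rank does not change under field
    extension, so a left inverse exists over the fraction field of A, and d clears its
    denominators. *)
Lemma injective_left_inverse (A : idomainType) (L : fieldType)
    (io : {rmorphism {fraction A} -> L}) (I J : finType) (B : I -> J -> A) :
  (forall v : I -> L, (forall y, \sum_x v x * io (tofrac (B x y)) = 0) -> forall x, v x = 0) ->
  exists (C : J -> I -> A) (d : A), d != 0 /\
    forall x x', \sum_y B x y * C y x' = d *+ (x == x').
Proof.
move=> inj; pose M : 'M[{fraction A}]_(#|I|, #|J|) :=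
  \matrix_(i, j) tofrac (B (enum_val i) (enum_val j)).
have rf : row_free M.
  rewrite -(row_free_map io); apply/row_freeP/row_freeP/inj_row_free => v hv.
  pose w x : L := v 0 (enum_rank x).
  have w0 : forall x, w x = 0.
    apply: inj => y; have := congr1 (fun u : 'rV_#|J| => u 0 (enum_rank y)) hv.
    rewrite !mxE => e; apply: etrans e.
    rewrite [RHS](reindex_onto enum_rank enum_val) /=; last by move=> i _; rewrite enum_valK.
    apply: eq_big => [x|x _]; first by rewrite enum_rankK eqxx.
    by rewrite !mxE !enum_rankK.
  by apply/rowP => i; rewrite mxE -(enum_valK i) -[LHS]/(w _) w0.
have /row_freeP[N eN] := rf.
have [d d0 hd] := common_denom (fun p : J * I => N (enum_rank p.1) (enum_rank p.2)) (enum {: J * I}).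
pose C y x := projT1 (boolp.cid (hd (y, x) (mem_enum _ _))).
have eC y x : tofrac (C y x) = tofrac d * N (enum_rank y) (enum_rank x).
  by rewrite /C; case: boolp.cid.
exists C, d; split=> // x x'; apply/eqP; rewrite -tofrac_eq; apply/eqP.
have := congr1 (fun u : 'M_#|I| => tofrac d * u (enum_rank x) (enum_rank x')) eN.
rewrite !mxE (inj_eq enum_rank_inj) tofracMn mulr_natr => <-; rewrite rmorph_sum mulr_sumr /=.
rewrite [RHS](reindex_onto enum_rank enum_val) /=; last by move=> i _; rewrite enum_valK.
apply: eq_big => [y|y _]; first by rewrite enum_rankK eqxx.
by rewrite !mxE !enum_rankK rmorphM /= eC mulrCA.
Qed.

Section Monomials.
Variable R : comNzRingType.

Definition bimon (i a : nat) : {poly {poly R}} := ('X^a)%:P * 'X^i.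

Definition bipoly n d (v : 'I_n * 'I_d -> R) : {poly {poly R}} :=
  \sum_x (v x)%:P%:P * bimon x.1 x.2.

Lemma coef_bimon i a l c : (bimon i a)`_l`_c = ((l == i) && (c == a))%:R.
Proof.
rewrite /bimon coefCM coefXn; case: (l == i); last by rewrite mulr0 coef0.
by rewrite mulr1 coefXn.
Qed.

Lemma coef_bipoly n d (v : 'I_n * 'I_d -> R) l c : (bipoly v)`_l`_c =
  \sum_x v x * ((l == x.1) && (c == x.2))%:R.
Proof.
rewrite /bipoly coef_sum coef_sum; apply: eq_bigr => x _.
by rewrite coefCM [LHS]coefCM coef_bimon.
Qed.

Lemma coef_bipoly_ord n d (v : 'I_n * 'I_d -> R) (i : 'I_n) (a : 'I_d) :
  (bipoly v)`_i`_a = v (i, a).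
Proof.
rewrite coef_bipoly (bigD1 (i, a)) //= !eqxx mulr1 big1 ?addr0 // => -[i' a'].
rewrite xpair_eqE /= -!val_eqE /= [i' == i :> nat]eq_sym [a' == a :> nat]eq_sym => /negbTE ->.
by rewrite mulr0.
Qed.

Lemma coef_bipoly_out n d (v : 'I_n * 'I_d -> R) l c : (n <= l)%N || (d <= c)%N ->
  (bipoly v)`_l`_c = 0.
Proof.
move=> h; rewrite coef_bipoly big1 // => -[i a] _ /=.
case: eqP => [e|_]; last by rewrite mulr0.
case: eqP => [e'|_]; last by rewrite mulr0.
by move: h; rewrite e e' leqNgt ltn_ord leqNgt ltn_ord.
Qed.

Lemma size_bipoly n d (v : 'I_n * 'I_d -> R) : (size (bipoly v) <= n)%N.
Proof.
apply/leq_sizeP => l hl; apply/polyP => c.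
by rewrite coef_bipoly_out ?hl // coef0.
Qed.

Lemma size_coef_bipoly n d (v : 'I_n * 'I_d -> R) i : (size ((bipoly v)`_i)%R <= d)%N.
Proof. by apply/leq_sizeP => c hc; rewrite coef_bipoly_out // hc orbT. Qed.

Lemma bipolyK n d (P : {poly {poly R}}) : (size P <= n)%N ->
  (forall i, (size (P`_i)%R <= d)%N) -> P = bipoly (fun x : 'I_n * 'I_d => P`_x.1`_x.2).
Proof.
move=> sP bP; apply/polyP => l; apply/polyP => c.
have [hl|hl] := ltnP l n; last first.
  by rewrite coef_bipoly_out ?hl // [P`_l]nth_default ?coef0 // (leq_trans sP).
have [hc|hc] := ltnP c d; last first.
  by rewrite coef_bipoly_out ?hc ?orbT // [_`_c]nth_default // (leq_trans (bP _)).
by rewrite (coef_bipoly_ord (fun x : 'I_n * 'I_d => P`_x.1`_x.2) (Ordinal hl) (Ordinal hc)).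
Qed.

Lemma derivTD : {morph @derivT R : P Q / P + Q}.
Proof. by move=> P Q; apply/polyP => i; rewrite coefD !coef_derivT coefD derivD. Qed.

Lemma derivTZ c P : derivT (c%:P%:P * P) = c%:P%:P * derivT P :> {poly {poly R}}.
Proof.
by apply/polyP => i; rewrite coefCM !coef_derivT coefCM derivM derivC mul0r add0r.
Qed.

Lemma derivTM (P Q : {poly {poly R}}) : derivT (P * Q) = derivT P * Q + P * derivT Q.
Proof.
apply/polyP => i; rewrite coefD !coefM coef_derivT coefM raddf_sum -big_split /=.
by apply: eq_bigr => l _; rewrite derivM !coef_derivT.
Qed.

Lemma derivT_deriv (P : {poly {poly R}}) : derivT P^`() = (derivT P)^`().
Proof. by apply/polyP => i; rewrite coef_derivT !coef_deriv derivMn coef_derivT. Qed.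

Definition ruppert_op (F Q H : {poly {poly R}}) : {poly {poly R}} :=
  F * derivT Q - Q * derivT F - F * H^`() + H * F^`().

Lemma ruppert_opD F Q Q' H H' :
  ruppert_op F (Q + Q') (H + H') = ruppert_op F Q H + ruppert_op F Q' H'.
Proof. by rewrite /ruppert_op derivTD derivD; ring. Qed.

Lemma ruppert_opZ F c Q H :
  ruppert_op F (c%:P%:P * Q) (c%:P%:P * H) = c%:P%:P * ruppert_op F Q H.
Proof.
by rewrite /ruppert_op derivTZ derivM derivC mul0r add0r; ring.
Qed.

Lemma ruppert_op_grad F : ruppert_op F F^`() (derivT F) = 0.
Proof. by rewrite /ruppert_op derivT_deriv; ring. Qed.

(** The closed form attached to this solution is dG / G. *)
Lemma ruppert_op_factor G H : ruppert_op (G * H) (G^`() * H) (derivT G * H) = 0.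
Proof. by rewrite /ruppert_op !derivTM !derivM derivT_deriv; ring. Qed.

Lemma ruppert_op_sum (I : finType) F (v : I -> R) Q H :
  ruppert_op F (\sum_x (v x)%:P%:P * Q x) (\sum_x (v x)%:P%:P * H x) =
  \sum_x (v x)%:P%:P * ruppert_op F (Q x) (H x).
Proof.
apply: (big_rec3 (fun a b c => ruppert_op F b c = a)).
  by have := ruppert_opZ F 0 0 0; rewrite !polyC0 !mul0r.
by move=> x a b c _ <-; rewrite ruppert_opD ruppert_opZ.
Qed.

End Monomials.

Lemma map_derivT (R S : comNzRingType) (f : {rmorphism R -> S}) (P : {poly {poly R}}) :
  map_poly (map_poly f) (derivT P) = derivT (map_poly (map_poly f) P).
Proof.
by apply/polyP => i; rewrite coef_derivT [LHS]coef_map [in RHS]coef_map coef_derivT /= deriv_map.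
Qed.

Lemma map_ruppert_op (R S : comNzRingType) (f : {rmorphism R -> S}) (F Q H : {poly {poly R}}) :
  map_poly (map_poly f) (ruppert_op F Q H) =
  ruppert_op (map_poly (map_poly f) F) (map_poly (map_poly f) Q) (map_poly (map_poly f) H).
Proof.
by rewrite /ruppert_op map_polyD !map_polyB !map_polyM !map_derivT !deriv_map.
Qed.

Lemma map_bimon (R S : comNzRingType) (f : {rmorphism R -> S}) i a :
  map_poly (map_poly f) (bimon R i a) = bimon S i a.
Proof.
by rewrite map_polyM map_polyC /= !map_polyXn.
Qed.

Section RigidMatrix.
Variables (A : idomainType) (F : {poly {poly A}}) (n m d : nat).

Local Notation idx := ('I_n * 'I_m.+1 + 'I_n * 'I_d)%type.

Definition basisQ (R : comNzRingType) (x : idx) : {poly {poly R}} :=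
  if x is inl y then bimon R y.1 y.2 else 0.
Definition basisH (R : comNzRingType) (x : idx) : {poly {poly R}} :=
  if x is inr y then bimon R y.1 y.2 else 0.

Lemma map_basisQ (R S : comNzRingType) (f : {rmorphism R -> S}) x :
  map_poly (map_poly f) (basisQ R x) = basisQ S x.
Proof. by case: x => y; rewrite ?rmorph0 // map_bimon. Qed.

Lemma map_basisH (R S : comNzRingType) (f : {rmorphism R -> S}) x :
  map_poly (map_poly f) (basisH R x) = basisH S x.
Proof. by case: x => y; rewrite ?rmorph0 // map_bimon. Qed.

Lemma sum_basisQ (R : comNzRingType) (v : idx -> R) :
  \sum_x (v x)%:P%:P * basisQ R x = bipoly (v \o inl).
Proof.
rewrite big_sumType /= [X in _ + X]big1 ?addr0 // => x _.
by rewrite mulr0.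
Qed.

Lemma sum_basisH (R : comNzRingType) (v : idx -> R) :
  \sum_x (v x)%:P%:P * basisH R x = bipoly (v \o inr).
Proof.
rewrite big_sumType /= big1 ?add0r // => x _.
by rewrite mulr0.
Qed.

Let col x := ruppert_op F (basisQ A x) (basisH A x).

Let p := (\max_x size (col x))%N.
Let q := (\max_x sizeY (col x))%N.

(** The row [None] is the normalization: it reads the coefficient of Y^(n-1) T^0 in Q, which for F_Y
    equals n, and so excludes the multiples of (F_Y, F_T). *)
Definition rigid_matrix (x : idx) (y : option ('I_p * 'I_q)) : A :=
  if y is Some z then (col x)`_z.1`_z.2 else (basisQ A x)`_n.-1`_0.

Lemma coef_ruppert_op (R : comNzRingType) (f : {rmorphism A -> R}) (v : idx -> R) l c :
  (ruppert_op (map_poly (map_poly f) F) (bipoly (v \o inl)) (bipoly (v \o inr)))`_l`_c =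
  \sum_x v x * f (col x)`_l`_c.
Proof.
rewrite -sum_basisQ -sum_basisH ruppert_op_sum coef_sum coef_sum.
apply: eq_bigr => x _; rewrite coefCM [LHS]coefCM; congr (_ * _).
by rewrite -(coef_map f) -(coef_map (map_poly f)) map_ruppert_op map_basisQ map_basisH.
Qed.

Lemma coef_normalization (R : comNzRingType) (f : {rmorphism A -> R}) (v : idx -> R) :
  (bipoly (v \o inl))`_n.-1`_0 = \sum_x v x * f (rigid_matrix x None).
Proof.
rewrite -sum_basisQ coef_sum coef_sum.
apply: eq_bigr => x _; rewrite coefCM [LHS]coefCM; congr (_ * _).
by rewrite -(coef_map f) -(coef_map (map_poly f)) map_basisQ.
Qed.

Variables (L : closedFieldType) (io : {rmorphism {fraction A} -> L}).
Let em : {rmorphism A -> L} := GRing.RMorphism.clone _ _ (io \o @tofrac A) _.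
Local Notation FL := (map_poly (map_poly em) F).
Hypothesis mF : F \is monic.
Hypothesis sF : size F = n.+1.
Hypothesis n_gt0 : (0 < n)%N.
Hypothesis m_gt0 : (0 < m)%N.
Hypothesis bF : forall i, (size (F`_i)%R <= m.+1)%N.
Hypothesis irrF : irreducible_elt FL.
Hypothesis charL : forall i, (0 < i <= (2 * n - 1) * m)%N -> i%:R != 0 :> L.
Hypothesis disc0 : resultant FL FL^`() != 0.

Lemma rigid_matrix_inj (v : idx -> L) :
  (forall y, \sum_x v x * em (rigid_matrix x y) = 0) -> forall x, v x = 0.
Proof.
move=> hv; set Q := bipoly (v \o inl); set H := bipoly (v \o inr).
have mFL : FL \is monic by rewrite monic_map.
have sFL : size FL = n.+1 by rewrite size_map_monic.
have bFL i : (size (FL`_i)%R <= m.+1)%N.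
  by rewrite coef_map (leq_trans (size_poly _ _)).
have eQH : ruppert_op FL Q H = 0.
  apply/polyP => l; apply/polyP => c; rewrite coef_ruppert_op !coef0.
  have [hl|hl] := ltnP l p; last first.
    rewrite big1 // => x _; rewrite [(col x)`_l]nth_default ?coef0 ?rmorph0 ?mulr0 //.
    exact: leq_trans (leq_bigmax x) hl.
  have [hc|hc] := ltnP c q; last first.
    rewrite big1 // => x _; rewrite [_`_c]nth_default ?rmorph0 ?mulr0 //.
    apply: leq_trans (max_size_coefXY _ _) _; exact: leq_trans (leq_bigmax x) hc.
  exact: (hv (Some (Ordinal hl, Ordinal hc))).
have sQ : (size Q <= n)%N := size_bipoly _.
have sH : (size H <= n)%N := size_bipoly _.
have [lam eQ] := ruppert mFL sFL n_gt0 m_gt0 bFL irrF charL disc0 sQ sH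
  (size_coef_bipoly _) eQH.
have nL : n%:R != 0 :> L.
  apply: charL; rewrite n_gt0 /=; apply: leq_trans (leq_pmulr _ m_gt0); lia.
have lam0 : lam = 0.
  have := hv None; rewrite -coef_normalization -/Q eQ.
  have nP : n%:R != 0 :> {poly L} by rewrite -(rmorph_nat (@polyC L)) polyC_eq0.
  rewrite coefCM [_`_0]coefCM coef_deriv prednK //.
  have -> : FL`_n = 1 by move/monicP: mFL; rewrite lead_coefE sFL.
  by rewrite -(rmorph_nat (@polyC L)) coefC /= => /eqP; rewrite mulf_eq0 (negbTE nL) orbF => /eqP.
have Q0 : Q = 0 by rewrite eQ lam0 !polyC0 mul0r.
have H0 : H = 0 by exact: ruppert_rigid mFL sFL n_gt0 m_gt0 charL disc0 _ _ sQ sH eQH Q0.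
case=> -[i a].
  by have := coef_bipoly_ord (v \o inl) i a; rewrite -/Q Q0 !coef0.
by have := coef_bipoly_ord (v \o inr) i a; rewrite -/H H0 !coef0.
Qed.

(** The matrix identity with factor dlt holds over A and is transported by any ring morphism f;
    applied to a normalized solution modulo e, it gives divisibility of f(dlt) Q by e. *)
Lemma rigid_denominator : exists dlt : A, dlt != 0 /\
  forall (R : comNzRingType) (f : {rmorphism A -> R}) (Q H E : {poly {poly R}}) e,
  (size Q <= n)%N -> (size H <= n)%N ->
  (forall i, (size (Q`_i)%R <= m.+1)%N) -> (forall i, (size (H`_i)%R <= d)%N) ->
  ruppert_op (map_poly (map_poly f) F) Q H = e%:P%:P * E -> Q`_n.-1`_0 = 0 ->
  forall i a, exists u, f dlt * Q`_i`_a = e * u.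
Proof.
have [C [dlt [dlt0 eC]]] := injective_left_inverse rigid_matrix_inj.
exists dlt; split=> // R f Q H E e sQ sH bQ bH eQH nQ i a.
have [hi|hi] := ltnP i n; last first.
  by exists 0; rewrite [Q`_i]nth_default ?coef0 ?mulr0 // (leq_trans sQ).
have [ha|ha] := ltnP a m.+1; last first.
  by exists 0; rewrite [_`_a]nth_default ?mulr0 // (leq_trans (bQ _)).
pose v (x : idx) : R := match x with inl y => Q`_y.1`_y.2 | inr y => H`_y.1`_y.2 end.
have eQ : Q = bipoly (v \o inl) by exact: bipolyK.
have eH : H = bipoly (v \o inr) by exact: bipolyK.
have dv y : exists u, \sum_x v x * f (rigid_matrix x y) = e * u.
  case: y => [[l c]|]; last by exists 0; rewrite -coef_normalization -eQ nQ mulr0.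
  exists E`_l`_c; rewrite -coef_ruppert_op -eQ -eH eQH.
  by rewrite coefCM [LHS]coefCM.
pose u y := projT1 (boolp.cid (dv y)).
have eu y : \sum_x v x * f (rigid_matrix x y) = e * u y by rewrite /u; case: boolp.cid.
pose x0 : idx := inl (Ordinal hi, Ordinal ha).
exists (\sum_y u y * f (C y x0)).
have -> : Q`_i`_a = v x0 by [].
transitivity (\sum_x v x * f (\sum_y rigid_matrix x y * C y x0)).
  rewrite (bigD1 x0) //= eC eqxx big1 ?addr0 ?mulr1n 1?mulrC // => x /negbTE xx0.
  by rewrite eC xx0 rmorph0 mulr0.
rewrite mulr_sumr; under eq_bigr => x _ do rewrite rmorph_sum mulr_sumr /=.
rewrite exchange_big /=; apply: eq_bigr => y _.
rewrite mulrA -eu mulr_suml; apply: eq_bigr => x _.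
by rewrite rmorphM mulrA.
Qed.

End RigidMatrix.

(** * Solutions modulo powers of epsilon *)

Section Truncation.
Variable R : comNzRingType.
Implicit Types P : {poly {poly R}}.

Definition truncT d P : {poly {poly R}} := map_poly (take_poly d) P.

Lemma coef_truncT d P i a : (truncT d P)`_i`_a = if (a < d)%N then P`_i`_a else 0.
Proof. by rewrite coef_map /= coef_take_poly. Qed.

Lemma size_coef_truncT d P i : (size ((truncT d P)`_i)%R <= d)%N.
Proof. by rewrite coef_map /= size_take_poly. Qed.

Lemma truncT_div d P e : (forall i a, (d <= a)%N -> exists q, P`_i`_a = e * q) ->
  exists E, P = truncT d P + e%:P%:P * E.
Proof.
move=> h; have [|E eE] := @poly_div_const {poly R} e%:P (P - truncT d P).
  move=> i; apply: poly_div_const => a.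
  have -> : (P - truncT d P)`_i`_a = P`_i`_a - (truncT d P)`_i`_a by rewrite coefB [LHS]coefB.
  rewrite coef_truncT.
  have [_|ge] := ltnP a d; first by exists 0; rewrite subrr mulr0.
  have [q eq] := h i a ge; exists q; by rewrite eq subr0.
by exists E; rewrite -eE addrC subrK.
Qed.

Lemma size_derivT_monic P r : P \is monic -> size P = r.+1 -> (size (derivT P) <= r)%N.
Proof.
move=> mP sP; apply/leq_sizeP => i; rewrite leq_eqVlt coef_derivT => /orP[/eqP <-|hi].
  have -> : P`_r = 1 by move/monicP: mP; rewrite lead_coefE sP.
  by rewrite derivC.
by rewrite nth_default ?sP // derivC.
Qed.

Lemma ruppert_opDl (F F' Q H : {poly {poly R}}) c :
  ruppert_op (F + c%:P%:P * F') Q H = ruppert_op F Q H + c%:P%:P * ruppert_op F' Q H.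
Proof.
by rewrite /ruppert_op derivTD derivTZ derivD derivM derivC mul0r add0r; ring.
Qed.

End Truncation.

Section SplitSolution.
Variables (k L : closedFieldType) (V : idomainType).
Variables (iV : {rmorphism V -> L}) (hV : {rmorphism V -> k}).
Hypothesis plV : is_place iV hV.
Variable jV : {rmorphism {poly k} -> V}.
Hypothesis hjV : forall p, hV (jV p) = p.[0].
Hypothesis jV_X : jV 'X != 0.

Local Notation red := (map_poly (horner_eval (0 : k))).
Local Notation Red := (map_poly red).
Local Notation eps j := (('X^j : {poly k})%:P%:P : {poly {poly {poly k}}}).

Variables (F : {poly {poly {poly k}}}) (n m : nat).
Hypothesis mF : F \is monic.
Hypothesis sF : size F = n.+1.
Hypothesis n_gt1 : (1 < n)%N.
Hypothesis tameL : tame L n.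
Hypothesis bF : forall i, (size (F`_i)%R <= m.+1)%N.
Hypothesis lcD : (lead_coef (resultant F F^`())).[0] != 0.
Hypothesis good : forall a, exists tau c, hV tau = a /\
  has_unit_order (ev_at jV tau (resultant F F^`())) c.
Variables Gb Hb : {poly {poly k}}.
Hypothesis mGb : Gb \is monic.
Hypothesis mHb : Hb \is monic.
Hypothesis sGb : (1 < size Gb)%N.
Hypothesis sHb : (1 < size Hb)%N.
Hypothesis eF : Red F = Gb * Hb.

Lemma tame_residue i : (0 < i <= n)%N -> i%:R != 0 :> k.
Proof.
move=> /tameL; apply: contraNneq => i0.
rewrite -(rmorph_nat iV) -(rmorph_nat jV) -(rmorph_nat (@polyC k)) i0.
by rewrite !rmorph0.
Qed.

(** The normalization forces c = deg Gb, so deg(Hb) Gb' Hb = deg(Gb) Gb Hb'. By coprimality over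
    k(T), Gb then divides a nonzero multiple of Gb', which has smaller degree; tameness excludes Gb'
    = 0. *)
Lemma log_deriv_not_gradient (c : k) :
  n%:R%:P%:P * (Gb^`() * Hb) - c%:P%:P * (Gb * Hb)^`() = 0 :> {poly {poly k}} ->
  c = (Gb^`() * Hb)`_n.-1`_0 -> False.
Proof.
have [r eG] : exists r, size Gb = r.+2 by exists (size Gb).-2; case: (size Gb) sGb => [|[]].
have [s eH] : exists s, size Hb = s.+2 by exists (size Hb).-2; case: (size Hb) sHb => [|[]].
have rs : (r.+1 + s.+1)%N = n := deg_split mF sF mGb mHb eF eG eH.
have lG : Gb`_r.+1 = 1 by move/monicP: mGb; rewrite lead_coefE eG.
have lH : Hb`_s.+1 = 1 by move/monicP: mHb; rewrite lead_coefE eH.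
have sG' : (size Gb^`() <= r.+1)%N by rewrite -ltnS -eG lt_size_deriv ?monic_neq0.
move=> e ec; have {}ec : c = r.+1%:R.
  rewrite ec -rs addSn /= (@coefM_top _ _ _ r s.+1) ?eH // coef_deriv lG lH mulr1.
  by rewrite -(rmorph_nat (@polyC k)) coefC.
have {}e : s.+1%:R%:P%:P * (Gb^`() * Hb) = Gb * (r.+1%:R%:P%:P * Hb^`()) :> {poly {poly k}}.
  apply/eqP; rewrite -subr_eq0 -e ec -rs natrD !polyCD derivM; apply/eqP; ring.
have [Db [a0 [b0 [Db0 ebez]]]] := red_disc_bezout plV hjV mF sF n_gt1 tameL eF good.
have sk : s.+1%:R != 0 :> k by apply: tame_residue; rewrite -rs leq_addl.
have rk : r.+1%:R != 0 :> k by apply: tame_residue; rewrite -rs leq_addr.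
have d0 : s.+1%:R%:P * Db != 0 by rewrite mulf_neq0 ?polyC_eq0.
have G'0 : Gb^`() = 0.
  apply: (monic_eq0_small d0 mGb (X := s.+1%:R%:P%:P * a0 * Gb^`() + b0 * (r.+1%:R%:P%:P * Hb^`()))).
    by rewrite eG.
  rewrite polyCM -ebez mulrDr [RHS]mulrDr.
  transitivity (s.+1%:R%:P%:P * (a0 * Gb) * Gb^`() + b0 * (s.+1%:R%:P%:P * (Gb^`() * Hb))).
    by ring.
  by rewrite e; ring.
have := congr1 (fun p : {poly {poly k}} => p`_r) G'0.
rewrite coef_deriv lG coef0 -(rmorph_nat (@polyC k)) => /eqP.
by rewrite polyC_eq0 (negbTE rk).
Qed.

(** From a lifted factorization, (G_Y H, G_T H) is truncated in T, which costs only multiples of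
    eps^j, and then corrected by a multiple of (F_Y, F_T) to satisfy the normalization. It stays
    nonzero at eps = 0 by [log_deriv_not_gradient]. *)
Lemma split_solution j : (0 < j)%N -> exists Q H E : {poly {poly {poly k}}},
  [/\ (size Q <= n)%N, (size H <= n)%N, (forall i, (size (Q`_i)%R <= m.+1)%N)
    & (forall i, (size (H`_i)%R <= (m * n + m * n).+2)%N)] /\
  [/\ ruppert_op F Q H = eps j * E, Q`_n.-1`_0 = 0 & exists i a, (Q`_i`_a).[0] != 0].
Proof.
move=> j0; have charts := finite_charts plV hjV mF sF n_gt1 tameL mGb eF good.
have [Db [a0 [b0 [Db0 ebez]]]] := red_disc_bezout plV hjV mF sF n_gt1 tameL eF good.
have [G [H [E [mG mH rG rH e]]]] :=
  lift_all plV hjV jV_X mF sF n_gt1 mGb mHb eF charts j0 Db0 ebez.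
have [r eG] : exists r, size Gb = r.+1 by exists (size Gb).-1; case: (size Gb) sGb.
have [s eH] : exists s, size Hb = s.+1 by exists (size Hb).-1; case: (size Hb) sHb.
have rs : (r + s)%N = n := deg_split mF sF mGb mHb eF eG eH.
have sG : size G = r.+1 by rewrite -(size_map_monic red mG) rG eG.
have sH : size H = s.+1 by rewrite -(size_map_monic red mH) rH eH.
have bnd := lift_bounded_coef plV hjV jV_X mF sF n_gt1 tameL mGb mHb eF bF lcD
  mG mH rG rH eG eH e.
have bndQ := lift_bounded_log plV hjV jV_X mF sF n_gt1 tameL mGb mHb eF bF lcD
  mG mH rG rH eG eH e.
have [E1 eQ1] := truncT_div bndQ.
have [E2 eG1] := truncT_div (fun i a h => (bnd i a h).1).
have [E3 eH1] := truncT_div (fun i a h => (bnd i a h).2).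
set Q1 := truncT _ _ in eQ1; set G1 := truncT _ _ in eG1; set H1 := truncT _ _ in eH1.
pose c := Q1`_n.-1`_0.
pose nn : {poly k} := n%:R.
have monic_trunc (P : {poly {poly {poly k}}}) t : P \is monic -> size P = t.+1 ->
    truncT (m * n).+1 P \is monic /\ size (truncT (m * n).+1 P) = t.+1.
  move=> mP sP; have lP : (truncT (m * n).+1 P)`_t = 1.
    have -> : (truncT (m * n).+1 P)`_t = take_poly (m * n).+1 P`_t by rewrite coef_map.
    have -> : P`_t = 1 by move/monicP: mP; rewrite lead_coefE sP.
    by apply/polyP => a; rewrite coef_take_poly !coef1; case: a => [|a] //=; rewrite if_same.
  have sT : size (truncT (m * n).+1 P) = t.+1.
    apply/eqP; rewrite eqn_leq (leq_trans (size_poly _ _)) ?sP //= ltnNge.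
    apply/negP => h; move: lP; rewrite nth_default // => /esym/eqP.
    by rewrite oner_eq0.
  by rewrite monicE lead_coefE sT lP eqxx.
have [mG1 sG1] := monic_trunc _ _ mG sG; have [mH1 sH1] := monic_trunc _ _ mH sH.
rewrite -/G1 in mG1 sG1; rewrite -/H1 in mH1 sH1.
have RedQ1 : Red Q1 = Gb^`() * Hb.
  have := congr1 Red eQ1; rewrite map_polyD !map_polyM map_polyC /= map_polyC /= -deriv_map rG rH.
  by rewrite /horner_eval hornerXn expr0n (gtn_eqF j0) !polyC0 mul0r addr0 => ->.
have op1 : exists E4, ruppert_op F Q1 (derivT G1 * H1) = eps j * E4.
  have eW : derivT G * H = derivT G1 * H1 + eps j * (derivT E2 * H + derivT G1 * E3).
    by rewrite {1}eG1 derivTD derivTZ {1 2}eH1; ring.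
  have : ruppert_op F (G^`() * H) (derivT G * H) = eps j * ruppert_op E (G^`() * H) (derivT G * H).
    by rewrite e ruppert_opDl ruppert_op_factor add0r.
  rewrite {1}eQ1 {1}eW ruppert_opD ruppert_opZ => e4.
  exists (ruppert_op E (G^`() * H) (derivT G * H) - ruppert_op F E1 (derivT E2 * H + derivT G1 * E3)).
  by rewrite mulrBr -e4 addrK.
have [E4 eE4] := op1.
(* Multiplying by n instead of dividing c by n cancels the coefficient of Y^(n-1) T^0, as that of
   F_Y is n. *)
pose Q := nn%:P%:P * Q1 + (- c)%:P%:P * F^`().
pose W := nn%:P%:P * (derivT G1 * H1) + (- c)%:P%:P * derivT F.
have sC (P : {poly {poly {poly k}}}) (t : {poly k}) u : (size P <= u)%N -> (size (t%:P%:P * P)%R <= u)%N.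
  by move=> h; rewrite mul_polyC (leq_trans (size_scale_leq _ _)).
have sCc (P : {poly {poly {poly k}}}) (t : {poly k}) u i : (size (P`_i)%R <= u)%N ->
    (size ((t%:P%:P * P)`_i)%R <= u)%N.
  by move=> h; rewrite coefCM mul_polyC (leq_trans (size_scale_leq _ _)).
have sF' : (size F^`() <= n)%N by rewrite -ltnS -sF lt_size_deriv ?monic_neq0.
have bF' i : (size ((F^`())`_i)%R <= m.+1)%N.
  by rewrite coef_deriv -mulr_natl -(rmorph_nat (@polyC _)) mul_polyC (leq_trans (size_scale_leq _ _)).
have bFT i : (size ((derivT F)`_i)%R <= (m * n + m * n).+2)%N.
  rewrite coef_derivT (leq_trans (size_poly _ _)) // (leq_trans (leq_pred _)) //.
  rewrite (leq_trans (bF _)) // ltnS ltnW // ltnS (leq_trans _ (leq_addr _ _)) //.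
  by rewrite leq_pmulr // ltnW.
have dT1 : (size (derivT G1) <= r)%N by exact: size_derivT_monic.
have sW1 : (size (derivT G1 * H1)%R <= n)%N.
  rewrite (leq_trans (size_polyMleq _ _)) // sH1 addnS /= -rs leq_add2r.
  exact: dT1.
have bW1 i : (size ((derivT G1 * H1)%R`_i)%R <= (m * n + m * n).+2)%N.
  rewrite coefM (leq_trans (size_sum _ _ _)) //; apply/bigmax_leqP => l _.
  rewrite (leq_trans (size_polyMleq _ _)) // (leq_trans (leq_pred _)) //.
  rewrite -addnS -addSn leq_add // ?size_coef_truncT //.
  by rewrite coef_derivT (leq_trans (size_poly _ _)) // (leq_trans (leq_pred _)) // size_coef_truncT.
have cQ : Q`_n.-1`_0 = 0.
  have -> : Q`_n.-1`_0 = nn * Q1`_n.-1`_0 + (- c) * (F^`())`_n.-1`_0.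
    rewrite /Q coefD [LHS]coefD; congr (_ + _); by rewrite coefCM [LHS]coefCM.
  have -> : (F^`())`_n.-1`_0 = nn.
    rewrite coef_deriv prednK; last exact: ltnW.
    have -> : F`_n = 1 by move/monicP: mF; rewrite lead_coefE sF.
    by rewrite -(rmorph_nat (@polyC _)) coefC.
  by rewrite -/c; ring.
exists Q, W, (nn%:P%:P * E4); split.
  split.
  - rewrite /Q (leq_trans (size_polyD _ _)) // geq_max !sC //.
    rewrite (leq_trans (size_poly _ _)) // (leq_trans (size_polyMleq _ _)) // sH addnS /=.
    by rewrite -rs leq_add2r -ltnS -sG lt_size_deriv ?monic_neq0.
  - rewrite /W (leq_trans (size_polyD _ _)) // geq_max !sC //.
    exact: size_derivT_monic.
  - move=> i; rewrite /Q coefD (leq_trans (size_polyD _ _)) // geq_max !sCc //.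
    exact: size_coef_truncT.
  - by move=> i; rewrite /W coefD (leq_trans (size_polyD _ _)) // geq_max !sCc.
split=> //.
  rewrite /Q /W ruppert_opD !ruppert_opZ ruppert_op_grad mulr0 addr0 eE4; ring.
apply: boolp.contrapT => h.
have RQ : Red Q = 0.
  apply/polyP => i; apply/polyP => a; rewrite !coef0.
  have -> : (Red Q)`_i`_a = (Q`_i`_a).[0] by rewrite coef_map /= coef_map.
  by apply/eqP/negPn/negP => h'; apply: h; exists i, a.
apply: (@log_deriv_not_gradient (c.[0])); last first.
  by rewrite -RedQ1 coef_map /= coef_map.
rewrite -RQ /Q map_polyD !map_polyM !map_polyC /= !map_polyC /= RedQ1 -deriv_map eF.
rewrite /horner_eval hornerN !polyCN mulNr; congr (_ * _ - _).
by rewrite -(rmorph_nat (horner_eval (0 : k))).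
Qed.

End SplitSolution.

(** * Specialization to a line through a good point *)

Lemma digits_inj s N (f g : 'I_s -> nat) : (forall i, f i < N)%N -> (forall i, g i < N)%N ->
  (\sum_i f i * N ^ i = \sum_i g i * N ^ i)%N -> f =1 g.
Proof.
elim: s f g => [|s IH] f g hf hg; first by move=> _ [].
rewrite !big_ord_recl /= !muln1.
have red (h : 'I_s.+1 -> nat) : (\sum_(i < s) h (lift ord0 i) * N ^ bump 0 i =
    N * \sum_(i < s) h (lift ord0 i) * N ^ i)%N.
  by rewrite big_distrr; apply: eq_bigr => i _; rewrite /bump add1n expnS mulnCA.
rewrite !red ![(f _ + _)%N]addnC ![(g _ + _)%N]addnC ![(N * _)%N]mulnC => e.
have e0 : f ord0 = g ord0.
  by have := congr1 (fun x => x %% N)%N e; rewrite !modnMDl !modn_small.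
have N0 : (0 < N)%N by apply: leq_ltn_trans (hf ord0).
have e1 : (\sum_(i < s) f (lift ord0 i) * N ^ i = \sum_(i < s) g (lift ord0 i) * N ^ i)%N.
  by have := congr1 (fun x => x %/ N)%N e; rewrite !divnMDl // !divn_small // !addn0.
move=> i; case: (unliftP ord0 i) => [i'|] -> //.
exact: (IH (fun i => f (lift ord0 i)) (fun i => g (lift ord0 i))).
Qed.

(* Kronecker's substitution X_i := x^(N^i) is injective on monomials of degree < N. *)
Lemma meval_neq0 (k : closedFieldType) s (P : {mpoly k[s]}) : P != 0 ->
  exists v, P.@[v] != 0.
Proof.
move=> P0; pose N := msize P; pose phi (m : 'X_{1..s}) := (\sum_i m i * N ^ i)%N.
pose p : {poly k} := \sum_(m <- msupp P) P@_m *: 'X^(phi m).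
have phiI m m' : m \in msupp P -> m' \in msupp P -> phi m = phi m' -> m = m'.
  have lt m0 i : m0 \in msupp P -> (m0 i < N)%N.
    move=> /msize_mdeg_lt; apply: leq_ltn_trans.
    by rewrite mdegE (bigD1 i) //= leq_addr.
  by move=> hm hm' e; apply/mnmP; apply: digits_inj e => i; apply: lt.
have [m hm] : exists m, m \in msupp P.
  by case e: (msupp P) => [|m l]; [move/eqP: e; rewrite msupp_eq0 (negbTE P0) | exists m; rewrite mem_head].
have p0 : p != 0.
  apply: contraTneq hm => e; rewrite mcoeff_msupp negbK; apply/eqP.
  have := congr1 (fun q : {poly k} => q`_(phi m)) e; rewrite coef0 coef_sum => e1.
  have [hm|hm] := boolP (m \in msupp P); last by rewrite memN_msupp_eq0.
  rewrite -[RHS]e1 (bigD1_seq m) //= coefZ coefXn eqxx mulr1 big_seq_cond big1 ?addr0 //.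
  move=> m' /andP[hm' mm']; rewrite coefZ coefXn; case: eqP => [/phiI e2|]; last by rewrite mulr0.
  by rewrite e2 ?eqxx in mm'.
have /closed_nonrootP[x hx] := p0.
exists (fun i => x ^+ (N ^ i)); apply: contraNneq hx => e; rewrite rootE -[X in _ == X]e mevalE.
rewrite /p horner_sum; apply/eqP; apply: eq_bigr => m' _.
rewrite !hornerE /=; congr (_ * _); rewrite -prodrXr.
by apply: eq_bigr => i _; rewrite -exprM mulnC.
Qed.

Section Line.
Variables (k : closedFieldType) (s : nat) (x u : 'I_s -> k).

Definition line : {rmorphism {mpoly k[s]} -> {poly k}} :=
  GRing.RMorphism.clone _ _ (mmap (@polyC k) (fun i => (x i)%:P + u i *: 'X)) _.

Lemma line_horner P c : (line P).[c] = P.@[fun i => x i + c * u i].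
Proof.
rewrite /= /mmap horner_sum mevalE; apply: eq_bigr => m _; rewrite hornerCM; congr (_ * _).
rewrite /mmap1 horner_prod; apply: eq_bigr => i _.
by rewrite horner_exp !hornerE [u i * c]mulrC.
Qed.

End Line.

Lemma line_horner0 (k : closedFieldType) s (x u : 'I_s -> k) P : (line x u P).[0] = P.@[x].
Proof.
by rewrite line_horner; apply: meval_eq => i; rewrite mul0r addr0.
Qed.

Lemma line_neq0 (k : closedFieldType) s (x : 'I_s -> k) (P : {mpoly k[s]}) : P != 0 ->
  exists u, line x u P != 0.
Proof.
move=> /meval_neq0[v Pv]; exists (fun i => v i - x i).
apply: contraNneq Pv => e; have := line_horner x (fun i => v i - x i) P 1.
rewrite e horner0 => ->; apply/eqP/meval_eq => i.
by rewrite mul1r addrC subrK.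
Qed.

(** Embeds k[eps] in k[t], hence in L, to obtain a place of L above eps = 0. It is unrelated to the
    line, a map in the opposite direction. *)
Definition univ (k : closedFieldType) s (i : 'I_s) : {rmorphism {poly k} -> {mpoly k[s]}} :=
  GRing.RMorphism.clone _ _ (horner_eval 'X_i \o map_poly (@mpolyC s k)) _.

Lemma univ_inj (k : closedFieldType) s (i : 'I_s) : injective (univ k i).
Proof.
apply: raddf_inj => p e; apply/eqP/negPn/negP => /closed_nonrootP[c] /negP; apply.
have := congr1 (meval (fun=> c)) e; rewrite meval0 /= /horner_eval.
rewrite -[meval _ _]/(_ _) -horner_map /= mevalXU -map_poly_comp /=.
by rewrite map_poly_id => [/rootP //|a _]; rewrite /= mevalC.
Qed.

Lemma rmorph_factor (R V L : nzRingType) (iV : {rmorphism V -> L}) (f : {rmorphism R -> L}) :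
  injective iV -> (forall a, exists v, iV v = f a) ->
  exists g : {rmorphism R -> V}, forall a, iV (g a) = f a.
Proof.
move=> iI h; pose g a := projT1 (boolp.cid (h a)).
have gE a : iV (g a) = f a by rewrite /g; case: boolp.cid.
have hB : zmod_morphism g by move=> a b; apply: iI; rewrite rmorphB !gE rmorphB.
have hM : monoid_morphism g.
  by split; [apply: iI; rewrite gE !rmorph1 | move=> a b; apply: iI; rewrite rmorphM !gE rmorphM].
pose hA := GRing.isZmodMorphism.Build _ _ g hB.
pose hA2 := GRing.isMonoidMorphism.Build _ _ g hM.
by pose g' : {rmorphism R -> V} := HB.pack g hA hA2; exists g'.
Qed.

Lemma prod_offdiag_const (R : comNzRingType) (T : eqType) (r : seq T) (c : R) : uniq r ->
  \prod_(x <- r) \prod_(y <- r | y != x) c ^+ 2 = c ^+ (2 * size r * (size r).-1).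
Proof.
move=> ur; rewrite -mulnA exprM.
transitivity (\prod_(x <- r) (c ^+ 2) ^+ (size r).-1).
  apply: eq_big_seq => x xr; rewrite big_const_seq iter_mulr_1; congr (_ ^+ _).
  by have := count_predC (pred1 x) r; rewrite count_uniq_mem // xr => <-.
by rewrite big_const_seq iter_mulr_1 count_predT -exprM mulnC.
Qed.

(* A place of L over the specialisation f of em moves the roots of D to those of f(D). *)
Lemma specialize_roots (A : idomainType) (L : closedFieldType) (em f : {rmorphism A -> L})
    (D : {poly A}) (B : A) : injective em -> D != 0 -> f (lead_coef D) != 0 ->
  em B = em (lead_coef D) * disc (reduced (map_poly em D)) ->
  let tau := distinct_roots (map_poly em D) in exists t : L -> L,
  map_poly f D = f (lead_coef D) *:
    \prod_(x <- closed_roots (map_poly em D)) ('X - (t x)%:P) /\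
  f B = f (lead_coef D) * (f (lead_coef D) ^+ (2 * size tau * (size tau).-1) *
    \prod_(x <- tau) \prod_(y <- tau | y != x) (t y - t x)).
Proof.
move=> emI D0 fl; set DL := map_poly em D => eB tau.
have [V [iV [hV [pl ext]]]] := place_extension f emI.
have iVI := place_inj pl.
have [j ej] := rmorph_factor iVI (fun a => let: ex_intro v h := ext a in ex_intro _ v h.1).
have hj a : hV (j a) = f a.
  by have [v [ev <-]] := ext a; congr (hV _); apply: iVI; rewrite ej ev.
have eDL : DL = map_poly iV (map_poly j D).
  by rewrite -map_poly_comp; apply: eq_map_poly => a /=; rewrite ej.
have em0 : em (lead_coef D) != 0.
  by rewrite -(rmorph0 em) (inj_eq emI) lead_coef_eq0.
have lDL : lead_coef DL = em (lead_coef D) by exact: lead_coef_map_eq.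
have DL0 : DL != 0 by rewrite -lead_coef_eq0 lDL.
have lj : lead_coef (map_poly j D) = j (lead_coef D).
  by apply: lead_coef_map_eq; rewrite -(inj_eq iVI) ej rmorph0.
have rt x : x \in closed_roots DL -> exists v, iV v = x.
  move=> xr; apply: (place_root pl (P := map_poly j D)); first by rewrite lj hj.
  by rewrite -eDL -mem_distinct_roots // mem_undup.
pose w x := if boolp.pselect (exists v, iV v = x) is left h then projT1 (boolp.cid h) else 0.
have ew x : x \in closed_roots DL -> iV (w x) = x.
  by rewrite /w => /rt h; case: boolp.pselect => // h'; case: boolp.cid.
have ewt x : x \in tau -> iV (w x) = x by rewrite mem_undup; exact: ew.
exists (hV \o w); split.
  have e : map_poly j D = j (lead_coef D) *: \prod_(x <- closed_roots DL) ('X - (w x)%:P).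
    apply: (map_inj_poly iVI (rmorph0 iV)); rewrite -eDL map_polyZ rmorph_prod /= ej -lDL.
    rewrite [LHS]closed_rootsE; congr (_ *: _); apply: eq_big_seq => x xr.
    by rewrite map_polyXsubC ew.
  transitivity (map_poly hV (map_poly j D)).
    by rewrite -map_poly_comp; apply: eq_map_poly => a /=; rewrite hj.
  rewrite e map_polyZ rmorph_prod /= hj; congr (_ *: _); apply: eq_bigr => x _.
  by rewrite map_polyXsubC.
have e : j B = j (lead_coef D) * (j (lead_coef D) ^+ (2 * size tau * (size tau).-1) *
    \prod_(x <- tau) \prod_(y <- tau | y != x) (w y - w x)).
  apply: iVI; rewrite !rmorphM rmorphXn rmorph_prod /= !ej eB disc_reducedE // lDL.
  congr (_ * (_ * _)); apply: eq_big_seq => x xt; rewrite rmorph_prod.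
  rewrite big_seq_cond [RHS]big_seq_cond; apply: eq_bigr => y /andP[yt _].
  by rewrite rmorphB /= !ewt.
rewrite -hj e !rmorphM rmorphXn rmorph_prod /= !hj; congr (_ * (_ * _)).
by apply: eq_bigr => x _; rewrite rmorph_prod; apply: eq_bigr => y _; rewrite rmorphB.
Qed.

(** The branch points are specialized twice: along the line into L, using the embedding [j0], then
    by a place above eps = 0 into k. At the second stage B(tstar) being nonzero keeps them finite
    and distinct. *)
Lemma good_place (A : idomainType) (k L : closedFieldType) (em : {rmorphism A -> L})
    (psi : {rmorphism A -> {poly k}}) (j0 : {rmorphism {poly k} -> L}) (D : {poly A}) (B : A) :
  injective em -> injective j0 -> psi (lead_coef D) != 0 ->
  em B = em (lead_coef D) * disc (reduced (map_poly em D)) -> (psi B).[0] != 0 ->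
  exists (V : idomainType) (iV : {rmorphism V -> L}) (hV : {rmorphism V -> k})
    (jV : {rmorphism {poly k} -> V}),
    [/\ is_place iV hV, forall p, hV (jV p) = p.[0], jV 'X != 0, (psi (lead_coef D)).[0] != 0
      & forall a, exists tau c, hV tau = a /\ has_unit_order (ev_at jV tau (map_poly psi D)) c].
Proof.
move=> emI j0I pl0 eB psiB.
have [V [iV [hV [pl ext]]]] := place_extension (horner_eval (0 : k)) j0I.
have iVI := place_inj pl.
have [jV ej] := rmorph_factor iVI (fun a => let: ex_intro v h := ext a in ex_intro _ v h.1).
have hj p : hV (jV p) = p.[0].
  by have [v [ev hv]] := ext p; rewrite -[RHS]hv; congr (hV _); apply: iVI; rewrite ej ev.
exists V, iV, hV, jV.
have D0 : D != 0 by apply: contraNneq pl0 => ->; rewrite lead_coef0 rmorph0.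
pose f : {rmorphism A -> L} := GRing.RMorphism.clone _ _ (j0 \o psi) _.
have fE a : f a = iV (jV (psi a)) by rewrite ej.
have fl0 : f (lead_coef D) != 0 by rewrite /= -(rmorph0 j0) (inj_eq j0I).
have [t [et eBt]] := specialize_roots emI D0 fl0 eB.
set rs := closed_roots _ in et; set tau := distinct_roots _ in eBt.
have mem_tau x : (x \in tau) = (x \in rs) by rewrite mem_undup.
pose d0 := jV (psi (lead_coef D)).
pose P := map_poly jV (map_poly psi D).
have lP : lead_coef P = d0.
  rewrite /P (lead_coef_map_eq (f := jV)) ?(lead_coef_map_eq (f := psi)) //.
  by rewrite -(inj_eq iVI) ej rmorph0.
have eP : map_poly iV P = map_poly f D.
  by rewrite /P -!map_poly_comp; apply: eq_map_poly => a; rewrite [RHS]fE.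
have rP x : x \in rs -> root (map_poly iV P) (t x).
  move=> xr; rewrite eP et rootZ // -(big_map t xpredT (fun z => 'X - z%:P)).
  by rewrite root_prod_XsubC map_f.
(* Before d0 is known to be a unit, only d0 times a root is known to lie in V. *)
pose e x := if boolp.pselect (exists v, iV v = iV d0 * t x) is left h
  then projT1 (boolp.cid h) else 0.
have ee x : x \in tau -> iV (e x) = iV d0 * t x.
  rewrite mem_tau => /rP /(place_leading_root pl); rewrite lP /e => h.
  by case: boolp.pselect => // h'; case: boolp.cid.
have eB2 : iV (jV (psi B)) = iV d0 * (iV d0 ^+ (2 * size tau * (size tau).-1) *
    \prod_(x <- tau) \prod_(y <- tau | y != x) (t y - t x)).
  by rewrite /d0 -!fE; exact: eBt.
have utau : uniq tau by exact: undup_uniq.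
(* The power 2 rho (rho - 1) of d0 in B supplies two factors d0 for each ordered pair of roots. One
   makes the difference integral and the other is left over, so B is d0 times an element of V. *)
have d0k : hV d0 != 0.
  have e1 : jV (psi B) = d0 * \prod_(x <- tau) \prod_(y <- tau | y != x) (d0 * (e y - e x)).
    apply: iVI; rewrite eB2 rmorphM rmorph_prod; congr (_ * _).
    rewrite -(prod_offdiag_const _ utau) -big_split /=; apply: eq_big_seq => x xt.
    rewrite rmorph_prod -big_split /= big_seq_cond [RHS]big_seq_cond.
    apply: eq_bigr => y /andP[yt _]; by rewrite rmorphM rmorphB /= !ee // expr2 -mulrA mulrBr.
  by apply: contraNneq psiB => e0; rewrite -hj e1 rmorphM /= e0 mul0r.
pose w x := if boolp.pselect (exists v, iV v = t x) is left h then projT1 (boolp.cid h) else 0.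
have ew x : x \in rs -> iV (w x) = t x.
  move=> /rP /(place_root pl); rewrite lP /w => /(_ d0k) h.
  by case: boolp.pselect => // h'; case: boolp.cid.
have ewt x : x \in tau -> iV (w x) = t x by rewrite mem_tau; exact: ew.
(* Two branch points with the same reduction would make a factor of B vanish at the place. *)
have dist x y : x \in tau -> y \in tau -> hV (w x) = hV (w y) -> x = y.
  move=> xt yt exy; apply/eqP; apply: contraNT psiB => xy.
  have e1 : jV (psi B) = d0 * (d0 ^+ (2 * size tau * (size tau).-1) *
      \prod_(x <- tau) \prod_(y <- tau | y != x) (w y - w x)).
    apply: iVI; rewrite eB2 !rmorphM rmorphXn rmorph_prod; congr (_ * (_ * _)).
    apply: eq_big_seq => x' xt'; rewrite rmorph_prod big_seq_cond [RHS]big_seq_cond.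
    by apply: eq_bigr => y' /andP[yt' _]; rewrite rmorphB /= !ewt.
  rewrite -hj e1 !rmorphM rmorph_prod /= (big_rem x) //= rmorph_prod /= (big_rem y) //=.
  by rewrite [y == x]eq_sym xy rmorphB exy subrr mul0r mul0r !mulr0.
have eP2 : P = d0 *: \prod_(x <- rs) ('X - (w x)%:P).
  apply: (map_inj_poly iVI (rmorph0 iV)); rewrite eP et map_polyZ rmorph_prod.
  congr (_ *: _); first exact: fE.
  by apply: eq_big_seq => x xr; rewrite /= map_polyXsubC ew.
split=> //.
- by rewrite -(inj_eq iVI) rmorph0 ej -(rmorph0 j0) (inj_eq j0I) polyX_eq0.
- by rewrite -hj.
(* [tt] is the branch point reducing to a if there is one, and the constant a otherwise; every other
   branch point is at unit distance from it. *)
move=> a; have [tt [ht hw]] : exists tt, hV tt = a /\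
    forall x, x \in rs -> w x = tt \/ hV (tt - w x) != 0.
  have [[x xr xa]|nx] := boolp.pselect (exists2 x, x \in rs & hV (w x) = a).
    exists (w x); split=> // y yr; have [exy|nxy] := eqVneq (hV (w y)) a; last first.
      by right; rewrite rmorphB /= xa subr_eq0 eq_sym.
    by left; rewrite (@dist y x) ?mem_tau // exy.
  exists (jV a%:P); rewrite hj hornerC; split=> // y yr; right.
  rewrite rmorphB hj hornerC subr_eq0; apply/eqP => ea; apply: nx.
  by exists y.
exists tt.
have [c hc] : exists c, has_unit_order (\prod_(x <- rs) ps ('X + (tt - w x)%:P)) c.
  rewrite big_seq; elim/big_rec: _ => [|x s xr [c hc]].
    by exists 0%N; split=> //; rewrite coef_s1 unitr1.
  have [d hd] : exists d, has_unit_order (ps ('X + (tt - w x)%:P)) d.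
    have [->|u] := hw x xr; last first.
      by exists 0%N; split=> //; rewrite coef_ps coefD coefX coefC add0r /= (place_unitE pl).
    exists 1%N; rewrite subrr polyC0 addr0.
    by split=> [i|]; rewrite coef_ps coefX ?unitr1 // => /ltn_eqF; rewrite eq_sym => ->.
  by exists (d + c)%N; exact: has_unit_orderM.
exists c; split=> //.
have -> : ev_at jV tt (map_poly psi D) = ps d0%:P * \prod_(x <- rs) ps ('X + (tt - w x)%:P).
  rewrite -rmorph_prod -rmorphM /= -/P eP2; congr (ps _).
  rewrite comp_polyZ mul_polyC; congr (_ *: _); rewrite rmorph_prod /=; apply: eq_bigr => x _.
  by rewrite comp_polyB comp_polyX comp_polyC polyCB addrA.
rewrite -[c]add0n; apply: has_unit_orderM hc; split=> //.
by rewrite coef_ps coefC /= (place_unitE pl).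
Qed.

Lemma embed_inj (k : closedFieldType) s (L : closedFieldType)
    (iota : {rmorphism {fraction {mpoly k[s]}} -> L}) : injective (embed iota).
Proof. by move=> a b /fmorph_inj /eqP; rewrite tofrac_eq => /eqP. Qed.

Lemma dvd_exp_of_mul (K : fieldType) j (p q u : {poly K}) : q.[0] != 0 -> p * q = 'X^j * u ->
  ('X^j %| p)%R.
Proof.
move=> q0 e; rewrite -(@Gauss_dvdpl _ p q); first by rewrite e dvdp_mulr.
by rewrite coprimep_expl // -['X]subr0 -polyC0 coprimep_sym coprimep_XsubC.
Qed.

Lemma map_discY (R S : idomainType) (f : {rmorphism R -> S}) (F : {poly {poly R}}) n :
  F \is monic -> size F = n.+1 -> (0 < n)%N -> n%:R != 0 :> {poly S} ->
  resultant (map_poly (map_poly f) F) (map_poly (map_poly f) F)^`() = map_poly f (discY F).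
Proof. by move=> mF sF n0 nS; rewrite /discY (map_discriminant (map_poly f) mF sF n0 nS). Qed.

Theorem corollary2p8 (k : closedFieldType) (s : nat) (hs : (1 <= s)%N)
  (L : closedFieldType) (iota : {rmorphism {fraction {mpoly k[s]}} -> L})
  (hL : is_algebraic_closure iota)
  (F : {poly {poly {mpoly k[s]}}}) (n m : nat)
  (hirr : irreducible_elt (map_bipoly (embed iota) F))
  (hmonic : F \is monic)
  (hn : n = degY F) (hn2 : (2 <= n)%N)
  (hm : m = degT F) (hm1 : (1 <= m)%N)
  (hchar : [pchar k] =i pred0 \/
           exists2 p : nat, p \in [pchar k] & ((2 * n - 1) * m < p)%N)
  (B : {mpoly k[s]}) (hB : is_bad_prime_divisor iota F B)
  (tstar : 'I_s -> k) (ht : B.@[tstar] != 0) :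
  irreducible_elt (map_bipoly (meval tstar) F).
Proof.
pose em : {rmorphism {mpoly k[s]} -> L} := GRing.RMorphism.clone _ _ (iota \o @tofrac _) _.
have emI : injective em by exact: embed_inj.
have n_gt0 : (0 < n)%N by exact: ltnW.
have n_le : (n <= (2 * n - 1) * m)%N by apply: leq_trans (leq_pmulr _ hm1); clear -hn2; lia.
have charK i : (0 < i <= (2 * n - 1) * m)%N -> i%:R != 0 :> k.
  case/andP=> i0 ile; apply/negP => iz; case: hchar => [c0|[p pc lt]].
    by have [p] := natf0_pchar i0 iz; rewrite c0.
  move: iz; rewrite -(dvdn_pcharf pc) => /(dvdn_leq i0) pi.
  by have := leq_ltn_trans (leq_trans pi ile) lt; rewrite ltnn.
have charL i : (0 < i <= (2 * n - 1) * m)%N -> i%:R != 0 :> L.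
  move=> /charK; apply: contraNneq => iz.
  have e : i%:R = 0 :> {mpoly k[s]} by apply: emI; rewrite rmorph_nat iz rmorph0.
  by move/eqP: e; rewrite -mpolyC_nat mpolyC_eq0.
have tameL : tame L n by move=> i /andP[i0 i1]; apply: charL; rewrite i0 (leq_trans i1).
have sF : size F = n.+1 by rewrite hn /degY prednK // size_poly_gt0 monic_neq0.
have bF i : (size (F`_i)%R <= m.+1)%N.
  by rewrite (leq_trans (max_size_coefXY _ _)) // hm leqSpred.
pose D := discY F.
have Bem : embed iota B != 0.
  by rewrite -(rmorph0 em) (inj_eq emI); apply: contraNneq ht => ->; rewrite meval0.
have D0 : D != 0.
  apply: contraNneq Bem; rewrite hB -/D => ->.
  by rewrite lead_coef0 -[embed _ 0]/(em 0) rmorph0 mul0r.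
have nL : n%:R != 0 :> {poly L}.
  by rewrite -(rmorph_nat (@polyC L)) polyC_eq0; apply: tameL; rewrite n_gt0 leqnn.
have disc0 : resultant (map_poly (map_poly em) F) (map_poly (map_poly em) F)^`() != 0.
  rewrite (map_discY em hmonic sF n_gt0 nL).
  apply: contraNneq D0 => h; apply/eqP/(map_inj_poly emI (rmorph0 em)).
  by apply: (etrans h); rewrite rmorph0.
(* The constant 2mn + 2 bounds the size in T of the second component in [split_solution], built from
   a product of two truncations of size at most mn + 1. *)
have [dlt [dlt0 rig]] := @rigid_denominator _ F n m (m * n + m * n).+2 L iota hmonic sF
  n_gt0 hm1 bF hirr charL disc0.
have [u] : exists u, line tstar u (dlt * lead_coef D) != 0.
  by apply: line_neq0; rewrite mulf_neq0 // lead_coef_eq0.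
set psi := line tstar u; rewrite rmorphM mulf_eq0 negb_or => /andP[pdlt plc].
pose j0 : {rmorphism {poly k} -> L} := GRing.RMorphism.clone _ _ (em \o univ k (Ordinal hs)) _.
have j0I : injective j0 by move=> p q /emI /univ_inj.
have psiB : (psi B).[0] != 0 by rewrite line_horner0.
have [V [iV [hV [jV [pl hjV jVX lcD good]]]]] := good_place emI j0I plc hB psiB.
pose F' := map_poly (map_poly psi) F.
have mF' : F' \is monic by rewrite monic_map.
have sF' : size F' = n.+1 by rewrite size_map_monic.
have bF' i : (size (F'`_i)%R <= m.+1)%N by rewrite coef_map (leq_trans (size_poly _ _)).
have nk : n%:R != 0 :> {poly {poly k}}.
  rewrite -(rmorph_nat (@polyC {poly k})) polyC_eq0 -(rmorph_nat (@polyC k)) polyC_eq0.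
  by apply: charK; rewrite n_gt0.
have eD : resultant F' F'^`() = map_poly psi D.
  by have := map_discY psi hmonic sF n_gt0 nk.
set Fb := map_bipoly (meval tstar) F.
have Fred : map_poly (map_poly (horner_eval (0 : k))) F' = Fb.
  rewrite /F' -map_poly_comp; apply: eq_map_poly => p /=.
  rewrite -map_poly_comp; apply: eq_map_poly => a; exact: line_horner0.
have mFb : Fb \is monic by rewrite -Fred !monic_map.
have sFb : size Fb = n.+1 by rewrite -Fred size_map_monic.
have split (Gb Hb : {poly {poly k}}) : Gb \is monic -> Hb \is monic -> (1 < size Gb)%N ->
    (1 < size Hb)%N -> Fb = Gb * Hb -> False.
  (* With this j, eps^j has larger degree than [psi dlt] and cannot divide it. *)
  move=> mG mH sG sH e; pose j := size (psi dlt).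
  have j_gt0 : (0 < j)%N by rewrite size_poly_gt0.
  have lc' : (lead_coef (resultant F' F'^`())).[0] != 0.
    by rewrite eD (lead_coef_map_eq (f := psi)).
  have good' a : exists tau c, hV tau = a /\ has_unit_order (ev_at jV tau (resultant F' F'^`())) c.
    by rewrite eD; exact: good.
  have eF : map_poly (map_poly (horner_eval (0 : k))) F' = Gb * Hb by rewrite Fred.
  have [Q [W [E [[sQ sW bQ bW] [eQW nQ [i [a qia]]]]]]] :=
    split_solution pl hjV jVX mF' sF' hn2 tameL bF' lc' good' mG mH sG sH eF j_gt0.
  have [v ev] := rig _ psi Q W E 'X^j sQ sW bQ bW eQW nQ i a.
  have := dvdp_leq pdlt (dvd_exp_of_mul qia ev).
  by rewrite size_polyXn ltnn.
split.
- exact: monic_neq0.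
- by rewrite poly_unitE sFb eqSS (gtn_eqF n_gt0).
move=> a b eab.
have lab : lead_coef a * lead_coef b = 1 by rewrite -lead_coefM -eab (monicP mFb).
have ua : lead_coef a \is a GRing.unit by apply/unitrPr; exists (lead_coef b).
have ub : lead_coef b \is a GRing.unit by apply/unitrPr; exists (lead_coef a); rewrite mulrC.
have unit_neq0 (c : {poly k}) : c \is a GRing.unit -> c != 0.
  by apply: contraTneq => ->; rewrite unitr0.
have unit1 (c : {poly {poly k}}) : lead_coef c \is a GRing.unit -> (size c <= 1)%N ->
    c \is a GRing.unit.
  move=> uc sc; have c0 : c != 0 by rewrite -lead_coef_eq0 unit_neq0.
  have s1 : size c = 1%N by apply/eqP; rewrite eqn_leq sc size_poly_gt0.
  by rewrite poly_unitE s1 eqxx; move: uc; rewrite lead_coefE s1.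
have [sa|sa] := leqP (size a) 1; first by left; exact: unit1.
have [sb|sb] := leqP (size b) 1; first by right; exact: unit1.
(* The leading coefficients are inverse to each other, so exchanging them makes both factors
   monic. *)
case: (@split (lead_coef b *: a) (lead_coef a *: b)).
- by rewrite monicE lead_coefZ mulrC lab.
- by rewrite monicE lead_coefZ lab.
- by rewrite size_scale // unit_neq0.
- by rewrite size_scale // unit_neq0.
by rewrite -scalerAl -scalerAr scalerA mulrC lab scale1r.
Qed.
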